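(* There exist universal constants $0<c<C<\infty$ such that for all integers $k\ge 2$ and all integers $n\ge 1$ the following hold. (1) If $A=\{A_1,A_2,\dots,A_k\}$ is a partition of $\mathbb{R}^n$ into $k$ measurable sets, each of $\gamma_n$-measure $1/k$, then $\gamma_{n-1}(\partial A)\ge c\sqrt{\log k}$. (2) If $k\le n$, then there is a partition $A=\{A_1,A_2,\dots,A_{2k}\}$ of $\mathbb{R}^n$ into $2k$ measurable sets, each of $\gamma_n$-measure $1/(2k)$, such that $\gamma_{n-1}(\partial A)\le C\sqrt{\log k}$.
   Context: $\gamma_n$ denotes the canonical (standard) Gaussian probability measure on $\mathbb{R}^n$, with density $(2\pi)^{-n/2}e^{-|x|^2/2}$. A partition of $\mathbb{R}^n$ into $m$ measurable sets is a collection $A=\{A_1,\dots,A_m\}$ of pairwise disjoint measurable sets whose union is $\mathbb{R}^n$. For $B\subseteq\mathbb{R}^n$ and $\varepsilon>0$, $B_\varepsilon=\{x\in\mathbb{R}^n : \inf_{b\in B}|x-b|<\varepsilon\}$ is the (Euclidean) $\varepsilon$-neighborhood of $B$. The $\varepsilon$-boundary of a partition $A=\{A_1,\dots,A_m\}$ is $$\partial_\varepsilon A=\bigcup_{i=1}^m\Big(\Big(\bigcup_{j\ne i}A_j\Big)_\varepsilon\setminus\bigcup_{j\ne i}A_j\Big),$$ and the $(n-1)$-dimensional Gaussian measure of the boundary of $A$ is defined as $$\gamma_{n-1}(\partial A)=\liminf_{\varepsilon\to0^+}\frac{\gamma_n(\partial_\varepsilon A)}{\sqrt{2/\pi}\,\varepsilon}\in[0,\infty].$$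 (The normalization is such that the partition into two half-spaces separated by a hyperplane at distance $t$ from the origin has boundary measure $e^{-t^2/2}$.) The notation $\gamma_{n-1}(\partial A)$ stands only for this quantity; no set $\partial A$ is defined. *)

(* Defs.v *)
From HB Require Import structures.
From mathcomp Require Import all_boot all_order all_algebra.
From mathcomp Require Import all_classical all_reals all_analysis.
From mathcomp Require Import measurable_realfun.

Set Implicit Arguments.
Unset Strict Implicit.
Unset Printing Implicit Defensive.

Import Order.TTheory GRing.Theory Num.Theory.
Import numFieldNormedType.Exports.

Local Open Scope classical_set_scope.
Local Open Scope ring_scope.

(* R^n, with the sigma-algebra that the library puts on tuples: the product of
   n copies of the Borel sigma-algebra of R, i.e. the Borel sets of R^n. *)
Notation euclid R n := (n.-tuple (measurableTypeR R)).

Section lebesgue_step.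
Context {R : realType} {n : nat}.

Definition econs (p : measurableTypeR R * euclid R n) : euclid R n.+1 :=
  [tuple of p.1 :: p.2].

Definition euncons (x : euclid R n.+1) : measurableTypeR R * euclid R n :=
  (thead x, [tuple of behead x]).

Lemma measurable_econs : measurable_fun [set: _] econs.
Proof. exact: measurable_cons. Qed.

Lemma measurable_euncons : measurable_fun [set: _] euncons.
Proof.
apply: measurable_fun_pair; last exact: measurable_behead.
exact: (measurable_tnth ord0).
Qed.

Lemma econsK : cancel econs euncons.
Proof. by move=> [x y]; congr pair; apply/val_inj. Qed.

Lemma eunconsK : cancel euncons econs.
Proof. by move=> x; rewrite [RHS]tuple_eta. Qed.

Variable m : {sigma_finite_measure set (euclid R n) -> \bar R}.

Definition lebesgue_step : set (euclid R n.+1) -> \bar R :=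
  pushforward (lebesgue_measure \x m)%E econs.

HB.instance Definition _ := Measure.copy lebesgue_step
  (measure_function_pushforward__canonical__measure_function_Measure
    (lebesgue_measure \x m)%E measurable_econs).

Let sigma_finite_lebesgue_step : sigma_finite setT lebesgue_step.
Proof.
pose l : {sigma_finite_measure set (measurableTypeR R) -> \bar R} :=
  lebesgue_measure.
have /sigma_finiteP[F [TF ndF Foo]] := sigma_finiteT l.
have /sigma_finiteP[G [TG ndG Goo]] := sigma_finiteT m.
exists (fun k => euncons @^-1` (F k `*` G k)) => [|k].
  apply/seteqP; split=> // z _.
  have [i _ Fi] : (\bigcup_i F i) (euncons z).1 by rewrite -TF.
  have [j _ Gj] : (\bigcup_i G i) (euncons z).2 by rewrite -TG.
  exists (maxn i j) => //; split.
  - by move: Fi; exact/subsetPset/ndF/leq_maxl.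
  - by move: Gj; exact/subsetPset/ndG/leq_maxr.
have [mF Fk] := Foo k; have [mG Gk] := Goo k; split.
  by rewrite -[X in measurable X]setTI; apply: measurable_euncons => //;
    exact: measurableX.
rewrite /lebesgue_step /pushforward -comp_preimage.
rewrite (_ : _ \o _ = id) ?preimage_id; last by apply/funext => p; exact: econsK.
by rewrite (product_measure1E l m)// lte_mul_pinfty// ge0_fin_numE.
Qed.

HB.instance Definition _ := Measure_isSigmaFinite.Build _ _ _ lebesgue_step
  sigma_finite_lebesgue_step.

End lebesgue_step.

(* n-dimensional Lebesgue measure: the n-fold product of the one-dimensional
   one, transported along (x, y) |-> x :: y; the point mass when n = 0. *)
Fixpoint lebesgue (R : realType) (n : nat) :
    {sigma_finite_measure set (euclid R n) -> \bar R} :=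
  if n is n'.+1 then lebesgue_step (lebesgue R n')
  else dirac ([tuple] : euclid R 0).

Section gaussian.
Context {R : realType} {n : nat}.
Implicit Types (x y : euclid R n) (A : set (euclid R n)).

Definition ecoord x (i : 'I_n) : R := tnth x i.

Definition enorm x : R := Num.sqrt (\sum_(i < n) ecoord x i ^+ 2).

Definition gaussian_pdf x : R :=
  (2 * pi) `^ (- (n%:R / 2)) * expR (- (enorm x ^+ 2 / 2)).

Definition gaussian A : \bar R :=
  (\int[lebesgue R n]_(x in A) (gaussian_pdf x)%:E)%E.

Let gaussian0 : gaussian set0 = 0%E.
Proof. exact: integral_set0. Qed.

Let gaussian_pdf_ge0 x : 0 <= gaussian_pdf x.
Proof. by rewrite mulr_ge0 ?powR_ge0 ?expR_ge0. Qed.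

Let gaussian_ge0 A : (0 <= gaussian A)%E.
Proof. by apply: integral_ge0 => x _; rewrite lee_fin. Qed.

Lemma measurable_gaussian_pdf : measurable_fun [set: euclid R n] gaussian_pdf.
Proof.
have -> : gaussian_pdf = fun x => (2 * pi) `^ (- (n%:R / 2)) *
    expR (- ((\sum_(i < n) ecoord x i ^+ 2) / 2)).
  apply/funext => x; rewrite /gaussian_pdf /enorm sqr_sqrtr//.
  by apply: sumr_ge0 => i _; exact: sqr_ge0.
apply: measurable_funM => //; apply: measurableT_comp => //.
apply: measurableT_comp => //; apply: measurable_funM => //.
apply: measurable_sum => i; apply: measurable_funX.
exact: measurable_tnth.
Qed.

Let gaussian_sigma_additive : semi_sigma_additive gaussian.
Proof.
apply: semi_sigma_additive_nng_induced => [|x]; last by rewrite lee_fin.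
by apply/measurable_EFinP; exact: measurable_gaussian_pdf.
Qed.

HB.instance Definition _ := isMeasure.Build _ _ _ gaussian
  gaussian0 gaussian_ge0 gaussian_sigma_additive.

End gaussian.

Section gaussian_probability.
Context {R : realType}.

Lemma gaussian_pdf_econs n (p : measurableTypeR R * euclid R n) :
  gaussian_pdf (econs p) = normal_pdf 0 1 (p.1 : R) * gaussian_pdf p.2.
Proof.
have sq m (x : euclid R m) : enorm x ^+ 2 = \sum_(i < m) ecoord x i ^+ 2.
  by rewrite sqr_sqrtr// sumr_ge0// => i _; exact: sqr_ge0.
rewrite normal_pdfE ?oner_eq0// /gaussian_pdf !sq big_ord_recl.
rewrite /normal_peak /normal_fun expr1n subr0 mul1r.
have -> : ecoord (econs p) ord0 = p.1 :> R by [].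
have tl i : ecoord (econs p) (lift ord0 i) = ecoord p.2 i.
  by rewrite /ecoord tnthS; congr tnth; exact: val_inj.
under eq_bigr do rewrite tl.
have pi2 : 0 < 2 * pi :> R by rewrite mulr_gt0 ?pi_gt0.
have -> : - (n.+1%:R / 2) = - (n%:R / 2) - 2^-1 :> R.
  by rewrite -[n.+1]addn1 natrD mulrDl mul1r opprD.
rewrite powRD ?(gt_eqF pi2) ?implybT// (powRN _ 2^-1) powR12_sqrt ?ltW//.
rewrite (mulrDl (_ ^+ 2)) opprD expRD mulNr -[pi *+ 2]mulr_natl.
set a := _ `^ _; set b := _^-1; set c := expR _; set d := expR _.
by rewrite [a * b]mulrC mulrACA.
Qed.

Lemma gaussian_setT n : gaussian [set: euclid R n] = 1%E.
Proof.
elim: n => [|n IH].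
  rewrite /gaussian /= integral_dirac//; last first.
    by apply/measurable_EFinP; exact: measurable_gaussian_pdf.
  rewrite diracT mul1e /gaussian_pdf /enorm big_ord0 sqrtr0 expr0n/= !mul0r.
  by rewrite oppr0 powRr0 expR0 mulr1.
have mpdf m : measurable_fun [set: euclid R m] (EFin \o gaussian_pdf).
  by apply/measurable_EFinP; exact: measurable_gaussian_pdf.
have pdf_ge0 m (x : euclid R m) : 0 <= gaussian_pdf x.
  by rewrite mulr_ge0 ?powR_ge0 ?expR_ge0.
pose l : {sigma_finite_measure set (measurableTypeR R) -> \bar R} :=
  lebesgue_measure.
rewrite /gaussian /= /lebesgue_step.
rewrite (ge0_integral_pushforward measurable_econs) ?preimage_setT//.
- have := @fubini_tonelli1 _ _ _ _ _ l (lebesgue R n)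
    ((EFin \o gaussian_pdf) \o econs).
  move=> -> /=; last 2 first.
  + exact: (measurableT_comp (mpdf _) measurable_econs).
  + by move=> x; rewrite lee_fin.
  rewrite -[RHS](@integral_normal_pdf R 0 1).
  apply: eq_integral => x _; rewrite /fubini_F/=.
  under eq_integral do rewrite gaussian_pdf_econs EFinM.
  rewrite /= ge0_integralZl//=.
  + by rewrite -/(gaussian _) IH mule1.
  + exact: mpdf.
  + by move=> y _; rewrite lee_fin.
  + by rewrite lee_fin normal_pdf_ge0.
- exact: mpdf.
- by move=> x _; rewrite lee_fin.
Qed.

HB.instance Definition _ n :=
  Measure_isProbability.Build _ _ R (@gaussian R n) (gaussian_setT n).

End gaussian_probability.

Section partition.
Context {R : realType} {n : nat}.

Definition edist (x y : euclid R n) : R :=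
  Num.sqrt (\sum_(i < n) (ecoord x i - ecoord y i) ^+ 2).

(* The infimum is taken in [-oo, +oo], so that the neighborhood of the empty set
   is empty. *)
Definition enbhd (B : set (euclid R n)) (e : R) : set (euclid R n) :=
  [set x | (ereal_inf [set (edist x b)%:E | b in B] < e%:E)%E].

Definition is_partition (m : nat) (A : 'I_m -> set (euclid R n)) : Prop :=
  [/\ forall i, measurable (A i), trivIset setT A & \bigcup_i A i = setT].

Definition others (m : nat) (A : 'I_m -> set (euclid R n)) (i : 'I_m) :=
  \bigcup_(j in [set j | j != i]) A j.

Definition eboundary (m : nat) (A : 'I_m -> set (euclid R n)) (e : R) :=
  \bigcup_i (enbhd (others A i) e `\` others A i).

Definition boundary_measure (m : nat) (A : 'I_m -> set (euclid R n)) : \bar R :=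
  limf_einf (fun e : R =>
    gaussian (eboundary A e) * ((Num.sqrt (2 / pi) * e)^-1)%:E)%E 0^'+.

End partition.

(* Main.v *)
Require Import Defs.
From HB Require Import structures.
From mathcomp Require Import all_boot all_order all_algebra.
From mathcomp Require Import all_classical all_reals all_analysis.
From mathcomp Require Import measurable_realfun ring lra zify.

Import Order.TTheory GRing.Theory Num.Theory.
Import numFieldNormedType.Exports.

Set Implicit Arguments.
Unset Strict Implicit.
Unset Printing Implicit Defensive.

Local Open Scope classical_set_scope.
Local Open Scope ring_scope.

(** Lower bound. For X standard Gaussian and Y an independent copy, put
    X_t = cos t X + sin t Y. For a set A of measure p, hypercontractivity at one
    fixed correlation gives P(X in A, X_t in A) <= p^(5/4); since the noise
    operators form a self-adjoint semigroup, Cauchy-Schwarz squares the ratio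
    P(X in A, X_t in A) / p each time the correlation is squared, so that after
    about log log (1/p) halvings the ratio is still bounded away from 1 at an
    angle t of order 1 / sqrt (log (1/p)). On the other hand
    f = min(1, d(., ~A)^2 / e^2) rises along the rotation from X to X_t by at
    most O(t / e) gaussian(A_e) on average, where A_e is the part of A within e
    of its complement: the rotation is cut into small steps of the same law, and
    for one step the squared distance has an affine upper bound up to a quadratic
    error. Hence gaussian(A_e) / e is at least of order p sqrt (log (1/p)), and
    one sums over the parts.

    Upper bound. Cut R^n according to the coordinate of largest absolute value
    among the first k and to its sign. Given the maximum M of the other
    coordinates, the boundary layer has mass at most 2 e phi(M), and Mills' ratio
    gives phi(M) <= phi(T) + C (1 + T) P(g > M), with T = 2 sqrt (log k). *)

(** * Expectations of bounded measurable functions *)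

(** All constants must be independent of the dimension and of [k], and this shapes both halves. In
    the crossing estimate the dimension enters only through terms of second order in the angle;
    subdividing the rotation makes them vanish in the limit. Hypercontractivity enters at one fixed
    small correlation because repeated squaring brings any correlation cos t down to it: cos t is
    about 1 - t^2/2, so an exponent of order 1/t^2 suffices. There the ratio of stability to mass is
    at most p^(1/4), and a root of order log (1/p) of this is a constant below 1; matching the two
    exponents gives the angle. With p = 1/k, the factor p of each part cancels in the sum over the k
    parts.

    For the upper bound, the mean of P(g > M) over the other coordinates is the mass of one cell,
    which is 1/(2k) by symmetry. The law of the maximum M therefore enters only through this
    identity, and [T] only has to make k phi(T) bounded while staying of order sqrt (log k).

    Both estimates hold for each small e separately, so the passage to the lower limit is
    immediate. *)

Section bounded_measurable.
Context {d} {T : measurableType d} {R : realType}.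
Implicit Types f g : T -> R.

(** Such functions are integrable for every probability and stable under ring operations, sections
    and partial expectations, so linearity and Fubini apply without further integrability
    conditions. *)
Definition bmeas f := measurable_fun [set: T] f /\ exists M, forall x, `|f x| <= M.

Lemma bmeas_cst (c : R) : bmeas (fun=> c).
Proof. by split=> //; exists `|c|. Qed.

Lemma bmeasD f g : bmeas f -> bmeas g -> bmeas (fun x => f x + g x).
Proof.
move=> [mf [M fM]] [mg [N gN]]; split; first exact: measurable_funD.
by exists (M + N) => x; rewrite (le_trans (ler_normD _ _))// lerD.
Qed.

Lemma bmeasM f g : bmeas f -> bmeas g -> bmeas (fun x => f x * g x).
Proof.
move=> [mf [M fM]] [mg [N gN]]; split; first exact: measurable_funM.
by exists (M * N) => x; rewrite normrM ler_pM.
Qed.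

Lemma bmeasN f : bmeas f -> bmeas (fun x => - f x).
Proof.
by move=> [mf [M fM]]; split; [exact: measurable_funN|exists M => x; rewrite normrN].
Qed.

Lemma bmeasB f g : bmeas f -> bmeas g -> bmeas (fun x => f x - g x).
Proof. by move=> bf bg; apply: bmeasD => //; exact: bmeasN. Qed.

Lemma bmeasX f n : bmeas f -> bmeas (fun x => f x ^+ n).
Proof.
move=> [mf [M fM]]; split; first exact: measurable_funX.
by exists (M ^+ n) => x; rewrite normrX lerXn2r ?nnegrE// (le_trans _ (fM x)).
Qed.

Lemma bmeas_max0 f : bmeas f -> bmeas (fun x => Num.max 0 (f x)).
Proof.
move=> [mf [M fM]]; split; first exact: measurable_maxr.
exists M => x; rewrite (le_trans _ (fM x))// ger0_norm ?le_max ?lexx//.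
by rewrite ge_max normr_ge0 ler_norm.
Qed.

Lemma bmeas_comp d' (T' : measurableType d') (h : T' -> T) f :
  bmeas f -> measurable_fun [set: T'] h ->
  measurable_fun [set: T'] (fun x => f (h x)) /\
  exists M, forall x, `|f (h x)| <= M.
Proof.
move=> [mf [M fM]] mh; split; first exact: measurableT_comp.
by exists M.
Qed.

Lemma bmeas_indic (A : set T) : measurable A -> bmeas (\1_A : T -> R).
Proof.
move=> mA; split; first exact: measurable_indic.
by exists 1 => x; rewrite indicE; case: (_ \in _); rewrite ?normr1 ?normr0.
Qed.

End bounded_measurable.

Section expectation.
Context {d} {T : measurableType d} {R : realType} (P : probability T R).
Implicit Types f g : T -> R.

Definition Ex f : R := \int[P]_x f x.

Lemma bmeas_integrable f : bmeas f -> P.-integrable [set: T] (EFin \o f).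
Proof.
move=> [mf [M fM]]; apply: measurable_bounded_integrable => //.
  by rewrite (le_lt_trans (probability_le1 _ _))// ltry.
exists M; split; first exact: num_real.
by move=> N MN x _; apply: le_trans (fM x) _; exact: ltW.
Qed.

Lemma ExE f : bmeas f -> (Ex f)%:E = (\int[P]_x (f x)%:E)%E.
Proof.
by move=> bf; rewrite fineK//; apply: integrable_fin_num => //; exact: bmeas_integrable.
Qed.

Lemma eq_Ex f g : f =1 g -> Ex f = Ex g.
Proof. by move=> /funext ->. Qed.

Lemma ExD f g : bmeas f -> bmeas g -> Ex (fun x => f x + g x) = Ex f + Ex g.
Proof. by move=> bf bg; apply: RintegralD => //; exact: bmeas_integrable. Qed.

Lemma ExB f g : bmeas f -> bmeas g -> Ex (fun x => f x - g x) = Ex f - Ex g.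
Proof. by move=> bf bg; apply: RintegralB => //; exact: bmeas_integrable. Qed.

Lemma ExZ (c : R) f : bmeas f -> Ex (fun x => c * f x) = c * Ex f.
Proof. by move=> bf; apply: RintegralZl => //; exact: bmeas_integrable. Qed.

Lemma ExZr (c : R) f : bmeas f -> Ex (fun x => f x * c) = Ex f * c.
Proof. by move=> bf; apply: RintegralZr => //; exact: bmeas_integrable. Qed.

Lemma Ex_cst (c : R) : Ex (fun=> c) = c.
Proof. rewrite /Ex Rintegral_cst//; have /= -> := probability_setT P; exact: mulr1. Qed.

Lemma le_Ex f g : bmeas f -> bmeas g -> (forall x, f x <= g x) -> Ex f <= Ex g.
Proof. by move=> bf bg fg; apply: le_Rintegral => //; exact: bmeas_integrable. Qed.

Lemma Ex_ge0 f : (forall x, 0 <= f x) -> 0 <= Ex f.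
Proof. by move=> f0; apply: Rintegral_ge0. Qed.

Lemma Ex_indic (A : set T) : measurable A -> (Ex \1_A)%:E = P A.
Proof. by move=> mA; rewrite ExE ?integral_indic ?setIT//; exact: bmeas_indic. Qed.

Lemma norm_Ex f M : bmeas f -> (forall x, `|f x| <= M) -> `|Ex f| <= M.
Proof.
move=> bf fM; rewrite ler_norml -{1}(Ex_cst (- M)) -{2}(Ex_cst M).
by apply/andP; split; apply: le_Ex => //; (try exact: bmeas_cst) => x;
  move: (fM x); rewrite ler_norml => /andP[].
Qed.

Lemma Ex_CS f g : bmeas f -> bmeas g ->
  Ex (fun x => f x * g x) ^+ 2 <= Ex (fun x => f x ^+ 2) * Ex (fun x => g x ^+ 2).
Proof.
move=> bf bg.
set a := Ex (fun x => f x ^+ 2); set b := Ex (fun x => f x * g x).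
set c := Ex (fun x => g x ^+ 2).
have c0 : 0 <= c by apply: Ex_ge0 => x; exact: sqr_ge0.
have key t : 0 <= a - 2 * t * b + t ^+ 2 * c.
  have -> : a - 2 * t * b + t ^+ 2 * c = Ex (fun x => (f x - t * g x) ^+ 2).
    transitivity (Ex (fun x => (f x ^+ 2 - (2 * t) * (f x * g x)) + t ^+ 2 * g x ^+ 2)).
      rewrite ExD; first rewrite ExB; first rewrite !ExZ//.
      all: repeat (apply: bmeasB || apply: bmeasD || apply: bmeasM ||
        apply: bmeasX || apply: bmeas_cst || assumption).
    by apply: eq_Ex => x; ring.
  by apply: Ex_ge0 => x; exact: sqr_ge0.
have [c0'|cn0] := eqVneq c 0.
  have a0 : 0 <= a by have := key 0; rewrite mulr0 mul0r expr0n/= mul0r subr0 addr0.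
  have b0 : b = 0.
    apply/eqP; apply: contraT => bn0.
    (* When [c = 0] the polynomial is affine in [t]; at this value of [t] it equals -1. *)
    have := key ((a + 1) / (2 * b)).
    rewrite c0' mulr0 addr0.
    have -> : 2 * ((a + 1) / (2 * b)) * b = a + 1 by field.
    by rewrite opprD addrA subrr add0r lerNr oppr0 ler10.
  by rewrite b0 c0' mulr0 expr0n.
have cp : 0 < c by rewrite lt_neqAle eq_sym cn0.
have := key (b / c).
have -> : a - 2 * (b / c) * b + (b / c) ^+ 2 * c = (a * c - b ^+ 2) / c by field.
by rewrite pmulr_lge0 ?invr_gt0// subr_ge0.
Qed.

End expectation.

Ltac bm := repeat first [ assumption | exact: bmeas_cst | apply: bmeasB
  | apply: bmeasD | apply: bmeasN | apply: bmeasX | apply: bmeasM ].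

Section fubini_expectation.
Context {d1 d2} {T1 : measurableType d1} {T2 : measurableType d2} {R : realType}.
Variable (P2 : probability T2 R).
Implicit Types F : T1 * T2 -> R.

Lemma bmeas_pair1 F x : bmeas F -> bmeas (fun y => F (x, y)).
Proof. by move=> bF; apply: (bmeas_comp bF); exact: pair1_measurable. Qed.

Lemma bmeas_pair2 F y : bmeas F -> bmeas (fun x => F (x, y)).
Proof. by move=> bF; apply: (bmeas_comp bF); exact: pair2_measurable. Qed.

(** Tonelli gives the measurability of partial integrals of nonnegative functions; [F] is shifted by
    its bound [M] and the shift is subtracted afterwards. *)
Lemma bmeas_Ex2 F : bmeas F -> bmeas (fun x => Ex P2 (fun y => F (x, y))).
Proof.
move=> bF; have [mF [M FM]] := bF; split; last first.
  by exists M => x; apply: norm_Ex => //; exact: bmeas_pair1.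
have mFM : measurable_fun [set: T1 * T2] (fun z => (F z + M)%:E).
  by apply/measurable_EFinP; exact: measurable_funD.
have FM0 z : (0 <= (F z + M)%:E)%E.
  by rewrite lee_fin -lerBlDr sub0r; move: (FM z); rewrite ler_norml => /andP[].
have E x : Ex P2 (fun y => F (x, y)) =
    fine (fubini_F P2 (fun z => (F z + M)%:E) x) - M.
  rewrite /fubini_F -[fine _]/(Ex P2 (fun y => F (x, y) + M)).
  by rewrite (ExD _ (bmeas_pair1 x bF) (bmeas_cst M)) Ex_cst addrK.
rewrite (funext E); apply: measurable_funB => //.
apply: measurableT_comp; first exact: fine_measurable.
exact: (measurable_fun_fubini_tonelli_F _ mFM).
Qed.

End fubini_expectation.

Section fubini_exchange.
Context {d1 d2} {T1 : measurableType d1} {T2 : measurableType d2} {R : realType}.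
Variables (P1 : probability T1 R) (P2 : probability T2 R).
Implicit Types F : T1 * T2 -> R.

Lemma bmeas_Ex1 F : bmeas F -> bmeas (fun y => Ex P1 (fun x => F (x, y))).
Proof.
move=> bF; apply: (@bmeas_Ex2 _ _ _ _ _ P1 (fun z => F (z.2, z.1))).
by apply: (bmeas_comp bF); exact: measurable_swap.
Qed.

Lemma Ex_fubini F : bmeas F ->
  Ex P1 (fun x => Ex P2 (fun y => F (x, y))) =
  Ex P2 (fun y => Ex P1 (fun x => F (x, y))).
Proof.
move=> bF; apply: EFin_inj.
rewrite (ExE _ (bmeas_Ex2 P2 bF)) (ExE _ (bmeas_Ex1 bF)).
under eq_integral do rewrite (ExE _ (bmeas_pair1 _ bF)).
under [RHS]eq_integral do rewrite (ExE _ (bmeas_pair2 _ bF)).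
apply: (@Fubini _ _ _ _ _ P1 P2 (EFin \o F)).
exact: (@bmeas_integrable _ _ _ (P1 \x P2)%E).
Qed.

End fubini_exchange.

(** * Gaussian measures and rotation invariance *)

(** The density [g] and the Radon-Nikodym derivative have the same integral over every measurable
    set, so they agree almost everywhere and [g] can replace the derivative in the change of
    variables. *)
Lemma ge0_integral_density d (T : measurableType d) (R : realType)
    (nu : {finite_measure set T -> \bar R})
    (mu : {sigma_finite_measure set T -> \bar R}) (g : T -> R) :
  measurable_fun [set: T] g -> (forall x, 0 <= g x) ->
  (forall A, measurable A -> nu A = (\int[mu]_(x in A) (g x)%:E)%E) ->
  forall f : T -> \bar R, measurable_fun [set: T] f -> (forall x, (0 <= f x)%E) ->
  (\int[nu]_x f x = \int[mu]_x (f x * (g x)%:E))%E.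
Proof.
move=> mg g0 nuE f mf f0.
have mgE : measurable_fun [set: T] (EFin \o g) by exact/measurable_EFinP.
have numu : nu `<< mu.
  apply/null_content_dominatesP => A mA muA0; rewrite nuE//.
  apply: null_set_integral => //; exact: measurable_funTS.
rewrite -(Radon_Nikodym_SigmaFinite.change_of_variables numu)//.
apply: ae_eq_integral => //.
- apply: emeasurable_funM => //.
  exact: measurable_int (Radon_Nikodym_SigmaFinite.f_integrable numu).
- exact: emeasurable_funM.
- apply: ae_eqe_mul2l; apply: integral_ae_eq => //.
    exact: Radon_Nikodym_SigmaFinite.f_integrable.
  by move=> E _ mE; rewrite -Radon_Nikodym_SigmaFinite.f_integral// nuE.
Qed.

Section affine.
Context {R : realType}.
Notation mu := (@lebesgue_measure R).

Lemma measurable_affine (a b : R) :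
  measurable_fun [set: measurableTypeR R] (fun x : measurableTypeR R => a * x + b : measurableTypeR R).
Proof. by apply: measurable_funD => //; exact: measurable_funM. Qed.

(** The image of Lebesgue measure under the affine map, scaled by |a|, gives half-open intervals
    their length, and uniqueness of Lebesgue measure concludes. For negative [a] the preimage of
    such an interval is half-open on the other side. *)
Lemma ge0_integral_affine (a b : R) (f : R -> \bar R) : a != 0 ->
  measurable_fun [set: R] f -> (forall x, (0 <= f x)%E) ->
  (\int[mu]_x f x = `|a|%:E * \int[mu]_x f (a * x + b)%R)%E.
Proof.
move=> a0 mf f0.
pose phi : measurableTypeR R -> measurableTypeR R := fun x => a * x + b.
have mphi : measurable_fun [set: measurableTypeR R] phi by exact: measurable_affine.
pose nu := pushforward mu phi.
pose nu' : {measure set (measurableTypeR R) -> \bar R} :=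
  measure_function_pushforward__canonical__measure_function_Measure mu mphi.
have an0 : 0 <= `|a| by [].
pose m' : {measure set (measurableTypeR R) -> \bar R} := mscale (NngNum an0) nu'.
have E A : measurable A -> mu A = m' A.
  apply: lebesgue_measure_unique => _ [[u v]] _ <- /=.
  rewrite /mscale /= /pushforward lebesgue_measure_itv/= lte_fin.
  have [ap|an|/eqP] := ltgtP a 0; last by rewrite (negbTE a0).
  - rewrite (_ : phi @^-1` _ = `[(v - b) / a, (u - b) / a[%classic); last first.
      apply/seteqP; split => x; rewrite /phi/= !in_itv/= => /andP[h1 h2].
        by rewrite ler_ndivrMr// ltr_ndivlMr//; apply/andP; split; lra.
      move: h1 h2; rewrite ler_ndivrMr// ltr_ndivlMr// => h1 h2.
      by apply/andP; split; lra.
    rewrite lebesgue_measure_itv/= lte_fin ltr_nM2r ?invr_lt0// ltrD2r.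
    case: ifP => uv; last by rewrite mule0.
    by rewrite -EFinM -EFinD ltr0_norm//; congr (_%:E); field.
  - rewrite (_ : phi @^-1` _ = `](u - b) / a, (v - b) / a]%classic); last first.
      apply/seteqP; split => x; rewrite /phi/= !in_itv/= => /andP[h1 h2].
        by rewrite ler_pdivlMr// ltr_pdivrMr//; apply/andP; split; lra.
      move: h1 h2; rewrite ler_pdivlMr// ltr_pdivrMr// => h1 h2.
      by apply/andP; split; lra.
    rewrite lebesgue_measure_itv/= lte_fin ltr_pM2r ?invr_gt0// ltrD2r.
    case: ifP => uv; last by rewrite mule0.
    by rewrite -EFinM -EFinD gtr0_norm//; congr (_%:E); field.
rewrite (eq_measure_integral m'); last by move=> A mA _; exact: E.
rewrite ge0_integral_mscale//; congr (_ * _)%E.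
by rewrite (ge0_integral_pushforward mphi)// preimage_setT.
Qed.

End affine.

Section normal.
Context {R : realType}.
Notation mu := (@lebesgue_measure R).

Definition std_normal : probability (measurableTypeR R) R := normal_prob 0 1.

Arguments std_normal : simpl never.

Definition std_normal_pdf (x : R) : R := normal_pdf 0 1 x.

Lemma std_normal_pdfE x : std_normal_pdf x = (Num.sqrt (2 * pi))^-1 * expR (- (x ^+ 2 / 2)).
Proof.
rewrite /std_normal_pdf normal_pdfE ?oner_eq0// /normal_peak /normal_fun expr1n subr0 mul1r.
by rewrite mulr_natl mulNr.
Qed.

Lemma std_normal_pdf_ge0 x : 0 <= std_normal_pdf x. Proof. exact: normal_pdf_ge0. Qed.

Lemma measurable_std_normal_pdf : measurable_fun [set: R] std_normal_pdf.
Proof. exact: measurable_normal_pdf. Qed.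

Lemma ge0_integral_std_normal (f : measurableTypeR R -> \bar R) :
  measurable_fun [set: measurableTypeR R] f -> (forall x, (0 <= f x)%E) ->
  (\int[std_normal]_x f x = \int[mu]_x (f x * (std_normal_pdf x)%:E))%E.
Proof.
move=> mf f0; apply: ge0_integral_density => //; first exact: measurable_std_normal_pdf.
exact: std_normal_pdf_ge0.
Qed.

Section reflection_density.
Context (l : {sigma_finite_measure set (measurableTypeR R) -> \bar R}).
Hypothesis integral_l_std_normal : forall f : measurableTypeR R -> \bar R,
  measurable_fun [set: measurableTypeR R] f -> (forall x, (0 <= f x)%E) ->
  (\int[std_normal]_x f x = \int[l]_x (f x * (std_normal_pdf x)%:E))%E.
Hypothesis integral_l_affine : forall (a b : R) (f : measurableTypeR R -> \bar R),
  a != 0 -> measurable_fun [set: measurableTypeR R] f -> (forall x, (0 <= f x)%E) ->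
  (\int[l]_x f x = `|a|%:E * \int[l]_x f (a * x + b)%R)%E.

(** The reflection factors into two affine substitutions in one variable, separated by an exchange
    of integrals: u = a x + b y at fixed x, then x = b v + a u at fixed u. Their factors 1/|b| and
    |b| cancel, and the product of the two densities is unchanged since it depends only on x^2 +
    y^2. A reflection is preferred to a rotation because it is its own inverse. *)
Lemma integral_refl_density (a b : R)
    (F : measurableTypeR R * measurableTypeR R -> \bar R) :
  a ^+ 2 + b ^+ 2 = 1 -> b != 0 ->
  measurable_fun setT F -> (forall z, (0 <= F z)%E) ->
  (\int[std_normal]_x \int[std_normal]_y F (a * x + b * y, b * x - a * y)%R =
   \int[std_normal]_x \int[std_normal]_y F (x, y))%E.
Proof.
move=> ab b0 mF F0.
have an0 : `|b| != 0 by rewrite normr_eq0.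
have ab1 : 1 - a ^+ 2 = b ^+ 2 by rewrite -ab addrAC subrr add0r.
have iter2 G : measurable_fun setT G -> (forall z, (0 <= G z)%E) ->
  (\int[std_normal]_x \int[std_normal]_y G (x, y) =
   \int[l]_x \int[l]_y (G (x, y) * (std_normal_pdf x * std_normal_pdf y)%:E))%E.
  move=> mG G0.
  rewrite integral_l_std_normal; [|exact: (measurable_fun_fubini_tonelli_F _ mG)|]; last first.
    by move=> x; exact: integral_ge0.
  apply: eq_integral => x _.
  rewrite integral_l_std_normal//; last exact: (measurableT_comp mG (pair1_measurable _)).
  rewrite -ge0_integralZr//.
  - by apply: eq_integral => y _; rewrite -muleA -EFinM mulrC.
  - apply: emeasurable_funM; first exact: (measurableT_comp mG (pair1_measurable _)).
    by apply/measurable_EFinP; exact: measurable_std_normal_pdf.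
  - by move=> y _; rewrite mule_ge0// lee_fin std_normal_pdf_ge0.
  - by rewrite lee_fin std_normal_pdf_ge0.
have mphi2 (h1 h2 : measurableTypeR R * measurableTypeR R -> R) :
    measurable_fun setT h1 -> measurable_fun setT h2 ->
    measurable_fun setT (fun z => (std_normal_pdf (h1 z) * std_normal_pdf (h2 z))%:E).
  move=> m1 m2; apply/measurable_EFinP; apply: measurable_funM;
    exact: measurableT_comp measurable_std_normal_pdf _.
rewrite (iter2 (fun z => F (a * z.1 + b * z.2, b * z.1 - a * z.2))); last 2 first.
- apply: (measurableT_comp mF); apply: measurable_fun_pair => /=.
    by apply: measurable_funD; apply: measurable_funM.
  by apply: measurable_funB; apply: measurable_funM.
- by move=> z.
rewrite (iter2 _ mF F0).
pose H (z : measurableTypeR R * measurableTypeR R) := (F (z.2, ((z.1 : R) - a * z.2) / b)%R *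
  (std_normal_pdf z.1 * std_normal_pdf (((z.2 : R) - a * z.1) / b))%R%:E)%E.
have mH : measurable_fun setT H.
  apply: emeasurable_funM.
    apply: (measurableT_comp mF); apply: measurable_fun_pair => //=.
    apply: measurable_funM => //; apply: measurable_funB => //.
    by apply: measurable_funM.
  apply: mphi2 => //.
  apply: measurable_funM => //; apply: measurable_funB => //.
  by apply: measurable_funM.
have H0 z : (0 <= H z)%E by rewrite mule_ge0// lee_fin mulr_ge0// std_normal_pdf_ge0.
transitivity (`|b|^-1%:E * \int[l]_x \int[l]_u H (x, u))%E.
  rewrite -ge0_integralZl//; last 2 first.
  - exact: (measurable_fun_fubini_tonelli_F (m2:=l) H mH H0).
  - by move=> x _; exact: integral_ge0.
  apply: eq_integral => x _.
  rewrite [in RHS](@integral_l_affine b (a * x))//; last exact: (measurableT_comp mH (pair1_measurable _)).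
  rewrite muleA -EFinM mulVf// mul1e; apply: eq_integral => y _.
  rewrite /H /=; congr (F _ * (std_normal_pdf _ * std_normal_pdf _)%:E)%E; last by field.
  congr pair; first by rewrite addrC.
  have -> : (x - a * (b * y + a * x)) / b = (x * (1 - a ^+ 2) - a * b * y) / b by field.
  by rewrite ab1; field.
transitivity (`|b|^-1%:E * \int[l]_u \int[l]_x H (x, u))%E.
  have FT := @fubini_tonelli _ _ _ _ _ l l H mH H0.
  exact: (congr1 (mule (`|b|^-1)%:E) FT).
rewrite -ge0_integralZl//; last 2 first.
- exact: (measurable_fun_fubini_tonelli_G (m1:=l) H mH H0).
- by move=> x _; exact: integral_ge0.
apply: eq_integral => u _.
rewrite (@integral_l_affine b (a * u))//; last exact: (measurableT_comp mH (pair2_measurable _)).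
rewrite muleA -EFinM mulVf// mul1e; apply: eq_integral => v _.
rewrite /H /=; congr (F _ * _%:E)%E; first by congr pair; field.
rewrite !std_normal_pdfE mulrACA [RHS]mulrACA; congr (_ * _); rewrite -!expRD; congr expR.
have -> : (u - a * (b * v + a * u)) / b = (u * (1 - a ^+ 2) - a * b * v) / b by field.
rewrite ab1.
have -> : (u * b ^+ 2 - a * b * v) / b = b * u - a * v by field.
have -> : - ((b * v + a * u) ^+ 2 / 2) - (b * u - a * v) ^+ 2 / 2 =
  - ((a ^+ 2 + b ^+ 2) * (u ^+ 2 + v ^+ 2) / 2) by field.
by rewrite ab; field.
Qed.

End reflection_density.

Lemma ge0_integral_std_normal_refl (a b : R)
    (F : measurableTypeR R * measurableTypeR R -> \bar R) :
  a ^+ 2 + b ^+ 2 = 1 -> b != 0 ->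
  measurable_fun setT F -> (forall z, (0 <= F z)%E) ->
  (\int[std_normal]_x \int[std_normal]_y F (a * x + b * y, b * x - a * y)%R =
   \int[std_normal]_x \int[std_normal]_y F (x, y))%E.
Proof.
apply: (@integral_refl_density mu); first exact: ge0_integral_std_normal.
exact: ge0_integral_affine.
Qed.

Lemma Ex_std_normal_refl (a b : R) (F : measurableTypeR R * measurableTypeR R -> R) :
  a ^+ 2 + b ^+ 2 = 1 -> b != 0 -> bmeas F ->
  Ex std_normal (fun x => Ex std_normal (fun y => F (a * x + b * y, b * x - a * y))) =
  Ex std_normal (fun x => Ex std_normal (fun y => F (x, y))).
Proof.
move=> ab b0 bF; have [mF [M FM]] := bF.
pose r (z : measurableTypeR R * measurableTypeR R) :
  measurableTypeR R * measurableTypeR R := (a * z.1 + b * z.2, b * z.1 - a * z.2).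
have mr : measurable_fun setT r.
  apply: measurable_fun_pair => /=.
    by apply: measurable_funD; apply: measurable_funM.
  by apply: measurable_funB; apply: measurable_funM.
have bFr : bmeas (F \o r) by exact: (bmeas_comp bF).
have bc : bmeas (fun _ : measurableTypeR R * measurableTypeR R => M) by exact: bmeas_cst.
(* Adding the bound [M] reduces the bounded case to the nonnegative one. *)
have shift G : bmeas G -> Ex std_normal (fun x => Ex std_normal (fun y => G (x, y))) =
   Ex std_normal (fun x => Ex std_normal (fun y => G (x, y) + M)) - M.
  move=> bG; rewrite -[LHS](addrK M) -[X in _ + X - _](Ex_cst std_normal M).
  congr (_ - _); rewrite -(ExD _ (bmeas_Ex2 std_normal bG) (bmeas_cst M)).
  apply: eq_Ex => x.
  by rewrite (ExD _ (bmeas_pair1 x bG) (bmeas_cst M)) Ex_cst.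
apply: etrans (shift _ bFr) _; apply: etrans _ (esym (shift _ bF)).
apply: (congr1 (fun t => t - M)); apply: EFin_inj.
have conv G : bmeas G -> (Ex std_normal (fun x => Ex std_normal (fun y => G (x, y))))%:E =
   (\int[std_normal]_x \int[std_normal]_y (G (x, y))%:E)%E.
  move=> bG; rewrite (ExE _ (bmeas_Ex2 std_normal bG)).
  by apply: eq_integral => x _; rewrite (ExE _ (bmeas_pair1 _ bG)).
apply: etrans (conv _ (bmeasD bFr bc)) _.
apply: etrans _ (esym (conv _ (bmeasD bF bc))).
apply: (ge0_integral_std_normal_refl (F := fun z => (F z + M)%:E)) => //.
  by apply/measurable_EFinP; exact: measurable_funD.
move=> z; rewrite lee_fin -lerBlDr sub0r.
by move: (FM z); rewrite ler_norml => /andP[].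
Qed.

End normal.

Section gaussian_recursion.
Context {R : realType}.

Definition std_gauss n : probability (euclid R n) R := gaussian.
Arguments std_gauss : simpl never.

Lemma gaussian_pdf_ge0 n (x : euclid R n) : 0 <= gaussian_pdf x.
Proof. by rewrite mulr_ge0 ?powR_ge0 ?expR_ge0. Qed.

Lemma ge0_integral_std_gauss n (f : euclid R n -> \bar R) :
  measurable_fun [set: euclid R n] f -> (forall x, (0 <= f x)%E) ->
  (\int[std_gauss n]_x f x = \int[lebesgue R n]_x (f x * (gaussian_pdf x)%:E))%E.
Proof.
move=> mf f0; apply: ge0_integral_density => //; first exact: measurable_gaussian_pdf.
exact: gaussian_pdf_ge0.
Qed.

Lemma ge0_integral_std_gaussS n (f : euclid R n.+1 -> \bar R) :
  measurable_fun [set: euclid R n.+1] f -> (forall x, (0 <= f x)%E) ->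
  (\int[std_gauss n.+1]_x f x = \int[std_normal]_t \int[std_gauss n]_y f (econs (t, y)))%E.
Proof.
move=> mf f0; rewrite ge0_integral_std_gauss//.
pose l : {sigma_finite_measure set (measurableTypeR R) -> \bar R} := lebesgue_measure.
have mpdf m : measurable_fun [set: euclid R m] (EFin \o gaussian_pdf).
  by apply/measurable_EFinP; exact: measurable_gaussian_pdf.
have mfg : measurable_fun [set: euclid R n.+1] (fun x => f x * (gaussian_pdf x)%:E)%E.
  by apply: emeasurable_funM => //; exact: mpdf.
have fg0 x : (0 <= f x * (gaussian_pdf x)%:E)%E.
  by rewrite mule_ge0// lee_fin gaussian_pdf_ge0.
rewrite /lebesgue_step (ge0_integral_pushforward measurable_econs)//.
rewrite preimage_setT.
have mfe : measurable_fun setT (f \o @econs R n) by exact: (measurableT_comp mf measurable_econs).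
have FT := @fubini_tonelli1 _ _ _ _ _ l (lebesgue R n)
  ((fun x => f x * (gaussian_pdf x)%:E)%E \o @econs R n)
  (measurableT_comp mfg measurable_econs) (fun z => fg0 _).
apply: etrans FT _.
rewrite ge0_integral_std_normal; last 2 first.
- exact: (measurable_fun_fubini_tonelli_F (m2 := std_gauss n) _ mfe (fun z => f0 _)).
- by move=> x; exact: integral_ge0.
apply: eq_integral => t _; rewrite /fubini_F/=.
have mft : measurable_fun setT (fun y => f (econs (t, y))).
  exact: (measurableT_comp mfe (pair1_measurable _)).
rewrite ge0_integral_std_gauss// -ge0_integralZr//.
- apply: eq_integral => y _.
  by rewrite gaussian_pdf_econs -muleA -EFinM mulrC.
- by apply: emeasurable_funM => //; exact: mpdf.
- by move=> y _; rewrite mule_ge0// lee_fin gaussian_pdf_ge0.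
- by rewrite lee_fin std_normal_pdf_ge0.
Qed.

Lemma bmeas_econs n (f : euclid R n.+1 -> R) : bmeas f ->
  bmeas (fun z : measurableTypeR R * euclid R n => f (econs z)).
Proof. by move=> bf; apply: (bmeas_comp bf); exact: measurable_econs. Qed.

Lemma Ex_std_gaussS n (f : euclid R n.+1 -> R) : bmeas f ->
  Ex (std_gauss n.+1) f = Ex std_normal (fun t => Ex (std_gauss n) (fun y => f (econs (t, y)))).
Proof.
move=> bf; have [mf [M fM]] := bf.
pose g x := f x + M.
have bg : bmeas g by apply: bmeasD => //; exact: bmeas_cst.
have bfe := bmeas_econs bf; have bge := bmeas_econs bg.
have g0 x : (0 <= (g x)%:E)%E.
  by rewrite lee_fin -lerBlDr sub0r; move: (fM x); rewrite ler_norml => /andP[].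
suff : Ex (std_gauss n.+1) g = Ex std_normal (fun t => Ex (std_gauss n) (fun y => g (econs (t, y)))).
  rewrite (ExD _ bf (bmeas_cst M)) Ex_cst.
  have -> : (fun t => Ex (std_gauss n) (fun y => g (econs (t, y)))) =
      (fun t => Ex (std_gauss n) (fun y => f (econs (t, y))) + M).
    apply/funext => t; rewrite /g.
    by rewrite (ExD _ (bmeas_pair1 t bfe) (bmeas_cst M)) Ex_cst.
  by rewrite (ExD _ (bmeas_Ex2 (std_gauss n) bfe) (bmeas_cst M)) Ex_cst => /addIr.
apply: EFin_inj; rewrite (ExE _ bg) (ExE _ (bmeas_Ex2 (std_gauss n) bge)).
have mg : measurable_fun [set: euclid R n.+1] (EFin \o g).
  by apply/measurable_EFinP; case: bg.
rewrite (ge0_integral_std_gaussS mg g0); apply: eq_integral => t _.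
by rewrite (ExE _ (bmeas_pair1 t bge)).
Qed.

Definition lincomb n (a b : R) (x y : euclid R n) : euclid R n :=
  [tuple a * ecoord x i + b * ecoord y i | i < n].

Lemma ecoord_lincomb n a b (x y : euclid R n) i :
  ecoord (lincomb a b x y) i = a * ecoord x i + b * ecoord y i.
Proof. by rewrite /ecoord tnth_mktuple. Qed.

Lemma eq_euclid n (x y : euclid R n) : (forall i, ecoord x i = ecoord y i) -> x = y.
Proof. exact: eq_from_tnth. Qed.

Lemma ecoord_econs0 n t (y : euclid R n) : ecoord (econs (t, y)) ord0 = t.
Proof. by []. Qed.

Lemma ecoord_econsS n t (y : euclid R n) i :
  ecoord (econs (t, y)) (lift ord0 i) = ecoord y i.
Proof. by rewrite /ecoord tnthS; congr tnth; exact: val_inj. Qed.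

Lemma lincomb_econs n a b (t s : R) (x y : euclid R n) :
  lincomb a b (econs (t, x)) (econs (s, y)) = econs (a * t + b * s, lincomb a b x y).
Proof.
apply: eq_euclid => i; rewrite ecoord_lincomb.
case: (unliftP ord0 i) => [j|] ->; last by rewrite !ecoord_econs0.
by rewrite !ecoord_econsS ecoord_lincomb.
Qed.

Lemma measurable_ecoord n (i : 'I_n) :
  measurable_fun [set: euclid R n] (fun x => ecoord x i).
Proof. exact: measurable_tnth. Qed.

Lemma measurable_lincomb d (T : measurableType d) n a b (f g : T -> euclid R n) :
  measurable_fun [set: T] f -> measurable_fun [set: T] g ->
  measurable_fun [set: T] (fun x => lincomb a b (f x) (g x)).
Proof.
move=> mf mg; apply/measurable_fun_tnthP => i.
have -> : (@tnth n (measurableTypeR R)) ^~ i \o (fun x => lincomb a b (f x) (g x)) =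
    fun x => a * ecoord (f x) i + b * ecoord (g x) i.
  by apply/funext => x /=; rewrite tnth_mktuple.
by apply: measurable_funD; apply: measurable_funM => //;
  exact: measurableT_comp (measurable_ecoord i) _.
Qed.

Lemma measurable_econs2 d (T : measurableType d) n (f : T -> measurableTypeR R)
    (g : T -> euclid R n) :
  measurable_fun [set: T] f -> measurable_fun [set: T] g ->
  measurable_fun [set: T] (fun x => econs (f x, g x)).
Proof.
move=> mf mg; apply: (measurableT_comp measurable_econs).
exact: measurable_fun_pair.
Qed.

End gaussian_recursion.

Ltac mfun := repeat first
  [ exact: measurable_fst | exact: measurable_snd
  | exact: measurable_id
  | exact: (measurableT_comp measurable_fst measurable_fst)
  | exact: (measurableT_comp measurable_fst measurable_snd)
  | exact: (measurableT_comp measurable_snd measurable_fst)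
  | exact: (measurableT_comp measurable_snd measurable_snd)
  | exact: measurable_cst
  | apply: measurable_econs2 | apply: measurable_lincomb
  | apply: measurable_fun_pair | apply: measurable_funD | apply: measurable_funB
  | apply: measurable_funM ].

Section reflection.
Context {R : realType}.
Notation std_gauss := (@std_gauss R).
Notation std_normal := (@std_normal R).

(** Brings the first coordinates of the two vectors next to each other, so that the planar
    reflection can act on (t, s) while the induction hypothesis acts on (x, y). *)
Lemma Ex_swap4 n (K : (measurableTypeR R * euclid R n) * (measurableTypeR R * euclid R n) -> R) :
  bmeas K ->
  Ex std_normal (fun t => Ex (std_gauss n) (fun x => Ex std_normal (fun s => Ex (std_gauss n) (fun y =>
    K ((t, x), (s, y)))))) =
  Ex std_normal (fun t => Ex std_normal (fun s => Ex (std_gauss n) (fun x => Ex (std_gauss n) (fun y =>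
    K ((t, x), (s, y)))))).
Proof.
move=> bK; apply: eq_Ex => t.
apply: (@Ex_fubini _ _ _ _ _ (std_gauss n) std_normal
  (fun z => Ex (std_gauss n) (fun y => K ((t, z.1), (z.2, y))))).
apply: (@bmeas_Ex2 _ _ _ _ _ (std_gauss n)
  (fun w => K ((t, w.1.1), (w.1.2, w.2)))).
by apply: (bmeas_comp bK); mfun.
Qed.

Lemma Ex_std_gauss_refl n (a b : R) (F : euclid R n * euclid R n -> R) :
  a ^+ 2 + b ^+ 2 = 1 -> b != 0 -> bmeas F ->
  Ex (std_gauss n) (fun x => Ex (std_gauss n) (fun y => F (lincomb a b x y, lincomb b (- a) x y))) =
  Ex (std_gauss n) (fun x => Ex (std_gauss n) (fun y => F (x, y))).
Proof.
move=> ab b0; elim: n F => [|n IH] F bF.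
  apply: eq_Ex => x; apply: eq_Ex => y; congr (F _).
  by rewrite (tuple0 x) (tuple0 y); congr pair; exact: tuple0.
have split4 G : bmeas G -> Ex (std_gauss n.+1) (fun x => Ex (std_gauss n.+1) (fun y => G (x, y))) =
    Ex std_normal (fun t => Ex std_normal (fun s => Ex (std_gauss n) (fun x => Ex (std_gauss n) (fun y =>
     G (econs (t, x), econs (s, y)))))).
  move=> bG.
  have bK : bmeas (fun z : (measurableTypeR R * euclid R n) * (measurableTypeR R * euclid R n) =>
      G (econs z.1, econs z.2)).
    apply: (bmeas_comp bG); apply: measurable_fun_pair;
    by apply: (measurableT_comp measurable_econs); mfun.
  rewrite -(Ex_swap4 bK) Ex_std_gaussS; last exact: bmeas_Ex2.
  apply: eq_Ex => t; apply: eq_Ex => x.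
  by rewrite Ex_std_gaussS //; exact: bmeas_pair1.
rewrite (split4 _ bF).
have bFr : bmeas (fun z => F (lincomb a b z.1 z.2, lincomb b (- a) z.1 z.2)).
  by apply: (bmeas_comp bF); mfun.
rewrite (split4 _ bFr) /=.
pose H (z : measurableTypeR R * measurableTypeR R) :=
  Ex (std_gauss n) (fun x => Ex (std_gauss n) (fun y => F (econs (z.1, x), econs (z.2, y)))).
have bH : bmeas H.
  apply: (@bmeas_Ex2 _ _ _ _ _ (std_gauss n) (fun w => Ex (std_gauss n) (fun y =>
     F (econs (w.1.1, w.2), econs (w.1.2, y))))).
  apply: (@bmeas_Ex2 _ _ _ _ _ (std_gauss n) (fun w =>
     F (econs (w.1.1.1, w.1.2), econs (w.1.1.2, w.2)))).
  apply: (bmeas_comp bF); mfun.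
    apply: (measurableT_comp measurable_fst).
    exact: (measurableT_comp measurable_fst measurable_fst).
  apply: (measurableT_comp measurable_snd).
  exact: (measurableT_comp measurable_fst measurable_fst).
apply: etrans (Ex_std_normal_refl ab b0 bH).
apply: eq_Ex => t; apply: eq_Ex => s.
have bI : bmeas (fun z : euclid R n * euclid R n =>
    F (econs (a * t + b * s, z.1), econs (b * t - a * s, z.2))).
  by apply: (bmeas_comp bF); mfun.
apply: etrans (IH _ bI); apply: eq_Ex => x; apply: eq_Ex => y /=.
by rewrite !lincomb_econs mulNr.
Qed.

Lemma Ex_std_gauss_comb n (a b : R) (f : euclid R n -> R) :
  a ^+ 2 + b ^+ 2 = 1 -> b != 0 -> bmeas f ->
  Ex (std_gauss n) (fun x => Ex (std_gauss n) (fun y => f (lincomb a b x y))) = Ex (std_gauss n) f.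
Proof.
move=> ab b0 bf.
have bF : bmeas (fun z : euclid R n * euclid R n => f z.1).
  by apply: (bmeas_comp bf); mfun.
apply: etrans (Ex_std_gauss_refl ab b0 bF) _.
by apply: eq_Ex => x; exact: (Ex_cst (std_gauss n) (f x)).
Qed.

End reflection.

(** * Hypercontractivity *)

Section hypercontractivity1.
Context {R : realType}.
Notation std_normal := (@std_normal R).
Notation mu := (@lebesgue_measure R).

Lemma measurable_exp_quadratic (al be : R) :
  measurable_fun [set: measurableTypeR R] (fun z : measurableTypeR R => expR (al * z ^+ 2 + be * z)).
Proof.
by apply: measurableT_comp => //; apply: measurable_funD; apply: measurable_funM.
Qed.

(** Completing the square: with k = 1 - 2 al, the integrand times the standard density is a constant
    multiple of the normal density of mean be / k and variance 1 / k. *)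
Lemma integral_std_normal_expR (al be : R) : 1 - 2 * al > 0 ->
  (\int[std_normal]_z (expR (al * z ^+ 2 + be * z))%:E =
   ((Num.sqrt (1 - 2 * al))^-1 * expR (be ^+ 2 / (2 * (1 - 2 * al))))%:E)%E.
Proof.
move=> al0; set k := 1 - 2 * al.
have mE : measurable_fun [set: measurableTypeR R]
    (fun z : measurableTypeR R => (expR (al * z ^+ 2 + be * z))%:E).
  by apply/measurable_EFinP; exact: measurable_exp_quadratic.
rewrite ge0_integral_std_normal//.
pose s := (Num.sqrt k)^-1.
have sk : 0 < Num.sqrt k by rewrite sqrtr_gt0.
have s0 : s != 0 by rewrite invr_neq0// gt_eqF.
have s2 : s ^+ 2 = k^-1 by rewrite exprVn sqr_sqrtr// ltW.
have k0 : k != 0 by rewrite gt_eqF.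
transitivity (\int[mu]_z ((s * expR (be ^+ 2 / (2 * k)))%:E *
   (normal_pdf (be / k) s z)%:E))%E.
  apply: eq_integral => z _; rewrite -!EFinM; congr (_%:E).
  rewrite std_normal_pdfE normal_pdfE// /normal_peak /normal_fun.
  have -> : Num.sqrt (s ^+ 2 * pi *+ 2) = s * Num.sqrt (2 * pi).
    rewrite -mulrnAr -mulr_natl sqrtrM ?sqr_ge0// sqrtr_sqr gtr0_norm//.
    by rewrite invr_gt0.
  have p0 : Num.sqrt (2 * pi) != 0 :> R by rewrite gt_eqF// sqrtr_gt0 mulr_gt0// pi_gt0.
  rewrite [RHS](_ : _ = (Num.sqrt (2 * pi))^-1 * (expR (be ^+ 2 / (2 * k)) *
    expR (- (z - be / k) ^+ 2 / (s ^+ 2 *+ 2)))); last by field; rewrite s0 p0.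
  rewrite -expRD mulrCA -expRD; congr (_ * expR _).
  by rewrite s2 -mulr_natl /k; field; rewrite -/k k0.
rewrite ge0_integralZl//.
- by rewrite integral_normal_pdf mule1.
- by apply/measurable_EFinP; exact: measurable_normal_pdf.
- by move=> x _; rewrite lee_fin normal_pdf_ge0.
- by rewrite lee_fin mulr_ge0// ?expR_ge0// invr_ge0 ltW.
Qed.


Section kernel.
Variables (a b : R).
Hypotheses (b0 : 0 < b) (ab : a ^+ 2 + b ^+ 2 = 1).

Let b2E : b ^+ 2 = 1 - a ^+ 2.
Proof. by rewrite -ab addrAC subrr add0r. Qed.

(* Mehler's kernel: the density of a x + b Z with respect to the law of Z;
   [mehler2 x] is its second moment. *)
Definition mehler (x z : R) : R :=
  b^-1 * expR (x ^+ 2 / 2) * expR (- ((a * z - x) ^+ 2 / (2 * b ^+ 2))).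

Definition mehler2 (x : R) : R :=
  (b * Num.sqrt (1 + a ^+ 2))^-1 * expR (a ^+ 2 / (1 + a ^+ 2) * x ^+ 2).

Lemma mehler_ge0 x z : 0 <= mehler x z.
Proof. by rewrite !mulr_ge0 ?expR_ge0// invr_ge0 ltW. Qed.

Lemma bmeas_mehler x : bmeas (fun z : measurableTypeR R => mehler x z).
Proof.
split.
  apply: measurable_funM => //; apply: measurableT_comp => //.
  apply: measurableT_comp => //; apply: measurable_funM => //.
  by apply: measurable_funX; apply: measurable_funB => //; exact: measurable_funM.
exists (b^-1 * expR (x ^+ 2 / 2)) => z; rewrite ger0_norm ?mehler_ge0// ler_piMr//.
  by rewrite mulr_ge0 ?expR_ge0// invr_ge0 ltW.
by rewrite -expR0 ler_expR oppr_le0 divr_ge0 ?sqr_ge0// mulr_ge0// sqr_ge0.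
Qed.

Lemma mehlerE (g : measurableTypeR R -> R) x : bmeas g -> (forall z, 0 <= g z) ->
  Ex std_normal (fun y => g (a * x + b * y)) = Ex std_normal (fun z => mehler x z * g z).
Proof.
move=> bg g0; have [mg _] := bg.
have bga : bmeas (fun y : measurableTypeR R => g (a * x + b * y)).
  by apply: (bmeas_comp bg); mfun.
have bn : b != 0 by rewrite gt_eqF.
have bM := bmeas_mehler x.
apply: EFin_inj; rewrite (ExE _ bga) (ExE _ (bmeasM bM bg)).
rewrite ge0_integral_std_normal; last 2 first.
- by apply/measurable_EFinP; case: bga.
- by move=> y; rewrite lee_fin.
rewrite ge0_integral_std_normal; last 2 first.
- by apply/measurable_EFinP; case: (bmeasM bM bg).
- by move=> y; rewrite lee_fin mulr_ge0// mehler_ge0.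
(* The substitution z = a x + b y, at fixed x. *)
rewrite [RHS](@ge0_integral_affine _ b (a * x))//; last 2 first.
- apply: emeasurable_funM; first by apply/measurable_EFinP; case: (bmeasM bM bg).
  by apply/measurable_EFinP; exact: measurable_std_normal_pdf.
- by move=> z; apply: mule_ge0; rewrite lee_fin ?std_normal_pdf_ge0// mulr_ge0// mehler_ge0.
rewrite -ge0_integralZl//; last 2 first.
- apply/measurable_EFinP; apply: measurable_funM.
    have [mMg _] := bmeasM bM bg.
    by apply: (measurableT_comp mMg); mfun.
  by apply: (measurableT_comp measurable_std_normal_pdf); mfun.
- by move=> z _; apply: mule_ge0; rewrite lee_fin ?std_normal_pdf_ge0// mulr_ge0// mehler_ge0.
apply: eq_integral => y _; rewrite -!EFinM gtr0_norm//; congr (_%:E).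
rewrite (addrC (b * y)) mulrCA -[RHS]mulrA [RHS]mulrCA; congr (_ * _).
rewrite /mehler !std_normal_pdfE.
rewrite [RHS](_ : _ = (Num.sqrt (2 * pi))^-1 * (expR (x ^+ 2 / 2) *
   expR (- ((a * (a * x + b * y) - x) ^+ 2 / (2 * b ^+ 2))) *
   expR (- ((a * x + b * y) ^+ 2 / 2)))); last first.
  have p0 : Num.sqrt (2 * pi) != 0 :> R by rewrite gt_eqF// sqrtr_gt0 mulr_gt0// pi_gt0.
  by field; rewrite p0 bn.
rewrite -!expRD; congr (_ * expR _).
have -> : a * (a * x + b * y) - x = b * (a * y - b * x).
  rewrite (_ : a * (a * x + b * y) - x = a * b * y - x * (1 - a ^+ 2)); last by ring.
  by rewrite -ab (addrC (a ^+ 2)) addrK; ring.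
have -> : (b * (a * y - b * x)) ^+ 2 / (2 * b ^+ 2) = (a * y - b * x) ^+ 2 / 2.
  by field.
rewrite [RHS](_ : _ = x ^+ 2 / 2 - (a ^+ 2 + b ^+ 2) * (x ^+ 2 + y ^+ 2) / 2); last by field.
by rewrite ab; field.
Qed.

Lemma Ex_mehler x : Ex std_normal (mehler x) = 1.
Proof.
have := @mehlerE (fun=> 1) x (bmeas_cst 1) (fun=> ler01).
rewrite Ex_cst => ->; apply: eq_Ex => z; exact/esym/mulr1.
Qed.

Lemma Ex_mehler_sqr x : Ex std_normal (fun z => mehler x z ^+ 2) = mehler2 x.
Proof.
have bn : b != 0 by rewrite gt_eqF.
have a1 : 0 < 1 + a ^+ 2 by rewrite ltr_wpDr// sqr_ge0.
apply: EFin_inj; rewrite (ExE _ (bmeasX _ (bmeas_mehler x))).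
(* The coefficients of z^2 and z in the exponent of the squared kernel. *)
pose al := - (a ^+ 2 / b ^+ 2); pose be := 2 * a * x / b ^+ 2.
have alE : 1 - 2 * al = (1 + a ^+ 2) / b ^+ 2.
  rewrite /al (_ : 1 + a ^+ 2 = b ^+ 2 + 2 * a ^+ 2); last by rewrite b2E; ring.
  by field.
have al0 : 0 < 1 - 2 * al by rewrite alE divr_gt0// exprn_gt0.
transitivity (\int[std_normal]_z ((b ^-2 * expR (x ^+ 2 - x ^+ 2 / b ^+ 2))%:E *
   (expR (al * z ^+ 2 + be * z))%:E))%E.
  apply: eq_integral => z _; rewrite -EFinM; congr (_%:E).
  rewrite /mehler !exprMn exprVn -mulrA; rewrite -[RHS]mulrA; congr (_ * _).
  rewrite -!expRM_natl -!expRD; congr expR.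
  by rewrite /al /be; field.
rewrite ge0_integralZl//; last 2 first.
- by apply/measurable_EFinP; exact: measurable_exp_quadratic.
- by rewrite lee_fin mulr_ge0 ?expR_ge0// invr_ge0 sqr_ge0.
rewrite integral_std_normal_expR// -EFinM; congr (_%:E); rewrite alE /mehler2.
rewrite sqrtrM ?(ltW a1)// sqrtrV ?sqr_ge0// sqrtr_sqr gtr0_norm//.
have s0 : Num.sqrt (1 + a ^+ 2) != 0 by rewrite gt_eqF// sqrtr_gt0.
rewrite [LHS](_ : _ = (b * Num.sqrt (1 + a ^+ 2))^-1 * (expR (x ^+ 2 - x ^+ 2 / b ^+ 2) *
   expR (be ^+ 2 / (2 * ((1 + a ^+ 2) / b ^+ 2))))); last by field; rewrite s0 bn.
rewrite -expRD; congr (_ * expR _); rewrite /be.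
rewrite (_ : x ^+ 2 - x ^+ 2 / b ^+ 2 = - ((1 - b ^+ 2) * x ^+ 2 / b ^+ 2)); last by field.
rewrite (_ : 1 - b ^+ 2 = a ^+ 2); last by rewrite b2E; ring.
rewrite [LHS](_ : _ = a ^+ 2 * x ^+ 2 / b ^+ 2 * (1 - a ^+ 2) / (1 + a ^+ 2)); last first.
  by field; rewrite bn gt_eqF.
rewrite -b2E.
by field; rewrite bn gt_eqF.
Qed.

(** The kernel has mean one, so its second moment exceeds 1 by its variance. *)
Lemma mehler2_ge1 x : 1 <= mehler2 x.
Proof.
rewrite -Ex_mehler_sqr; have bM := bmeas_mehler x.
have : 0 <= Ex std_normal (fun z => (mehler x z - 1) ^+ 2) by apply: Ex_ge0 => z; exact: sqr_ge0.
suff -> : Ex std_normal (fun z => (mehler x z - 1) ^+ 2) = Ex std_normal (fun z => mehler x z ^+ 2) - 1.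
  by rewrite subr_ge0.
transitivity (Ex std_normal (fun z => mehler x z ^+ 2 - 2 * mehler x z + 1)).
  by apply: eq_Ex => z; ring.
rewrite ExD; last 2 first.
- by bm.
- exact: bmeas_cst.
rewrite ExB; last 2 first.
- by bm.
- by bm.
by rewrite ExZ// Ex_mehler Ex_cst; ring.
Qed.

(** With r = a^2 the integral is the inverse of (1 - r^2) sqrt ((1 - 3 r) / (1 + r)), finite when r
    < 1/3. The range r <= 1/100 brings it down to 5/4, whose excess 1/4 over 1 is the factor that
    the fourth moment argument can afford. *)
Lemma integral_mehler2_sqr : a ^+ 2 <= 100^-1 ->
  (\int[std_normal]_x (mehler2 x ^+ 2)%:E <= (5 / 4)%:E)%E.
Proof.
move=> a100; set r := a ^+ 2 in a100 *.
have r0 : 0 <= r by exact: sqr_ge0.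
have bn : b != 0 by rewrite gt_eqF.
have r1 : 0 < 1 + r by lra.
have b2 : b ^+ 2 = 1 - r by exact: b2E.
have -> : (\int[std_normal]_x (mehler2 x ^+ 2)%:E = \int[std_normal]_z ((((1 - r) * (1 + r))^-1)%:E *
   (expR (2 * r / (1 + r) * z ^+ 2 + 0 * z))%:E))%E.
  apply: eq_integral => z _; rewrite -EFinM; congr (_%:E).
  rewrite /mehler2 exprMn exprVn exprMn sqr_sqrtr ?ltW// b2; congr (_ * _).
  by rewrite -expRM_natl; congr expR; rewrite -/r; field; rewrite gt_eqF.
have al0 : 1 - 2 * (2 * r / (1 + r)) = (1 - 3 * r) / (1 + r) by field; rewrite gt_eqF.
have k0 : 0 < (1 - 3 * r) / (1 + r) by rewrite divr_gt0//; lra.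
have c0 : 0 < (1 - r) * (1 + r) by rewrite mulr_gt0//; lra.
rewrite ge0_integralZl//; last 2 first.
- by apply/measurable_EFinP; exact: measurable_exp_quadratic.
- by rewrite lee_fin invr_ge0 ltW.
rewrite integral_std_normal_expR ?al0// -EFinM lee_fin expr0n mul0r expR0 mulr1.
have s1 : 9 / 10 <= Num.sqrt ((1 - 3 * r) / (1 + r)).
  rewrite -[leLHS]ger0_norm; last by lra.
  rewrite -sqrtr_sqr ler_sqrt; last by rewrite ltW.
  by rewrite ler_pdivlMr//; lra.
rewrite -invfM -[leRHS]invrK lef_pV2 ?posrE; last 2 first.
- by rewrite mulr_gt0// sqrtr_gt0.
- by rewrite invr_gt0; lra.
apply: (@le_trans _ _ (99 / 100 * (9 / 10))); first by lra.
by apply: ler_pM => //; nra.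
Qed.

(** As [mehler2] is unbounded, the comparison takes place between extended integrals; adding [c] to
    [h] turns it into one between nonnegative functions. *)
Lemma Ex_le_mehler2 (h : measurableTypeR R -> R) (c : R) : a ^+ 2 <= 100^-1 ->
  bmeas h -> 0 <= c -> (forall x, 0 <= h x <= (mehler2 x ^+ 2 - 1) * c) ->
  Ex std_normal h <= c / 4.
Proof.
move=> a100 bh c0 hc.
have bhc : bmeas (fun x => h x + c) by bm.
have m2 : measurable_fun [set: measurableTypeR R] (fun x => (mehler2 x ^+ 2)%:E).
  apply/measurable_EFinP; apply: measurable_funX; apply: measurable_funM => //.
  by apply: measurableT_comp => //; apply: measurable_funM.
suff : Ex std_normal (fun x => h x + c) <= 5 / 4 * c.
  rewrite (ExD _ bh (bmeas_cst c)) Ex_cst; lra.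
rewrite -lee_fin (ExE _ bhc).
apply: (@le_trans _ _ (\int[std_normal]_x (c%:E * (mehler2 x ^+ 2)%:E))%E).
  apply: ge0_le_integral => //.
  - by move=> x _; rewrite lee_fin addr_ge0//; case/andP: (hc x).
  - by apply/measurable_EFinP; case: bhc.
  - exact: emeasurable_funM.
  - move=> x _; rewrite -EFinM lee_fin; case/andP: (hc x); lra.
rewrite ge0_integralZl//; last by move=> x _; rewrite lee_fin sqr_ge0.
by rewrite mulrC EFinM lee_wpmul2l// integral_mehler2_sqr.
Qed.

(* With m = E g, the deviation v of the smoothed function from m is
   E[(mehler x - 1) (g - m)], so Cauchy-Schwarz bounds v^2 by Var g times a factor
   which is small in mean square when a is small. *)
Lemma hypercontractive1 (g : measurableTypeR R -> R) : a ^+ 2 <= 100^-1 ->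
  bmeas g -> (forall z, 0 <= g z) ->
  Ex std_normal (fun x => Ex std_normal (fun y => g (a * x + b * y)) ^+ 4) <=
  Ex std_normal (fun x => g x ^+ 2) ^+ 2.
Proof.
move=> a100 bg g0.
have bn : b != 0 by rewrite gt_eqF.
set m := Ex std_normal g; set s := Ex std_normal (fun x => g x ^+ 2).
pose u x := Ex std_normal (fun y => g (a * x + b * y)).
have bu : bmeas u.
  apply: (@bmeas_Ex2 _ _ _ _ _ std_normal (fun z => g (a * z.1 + b * z.2))).
  by apply: (bmeas_comp bg); mfun.
have Eu : Ex std_normal u = m.
  have bF : bmeas (fun z : measurableTypeR R * measurableTypeR R => g z.1).
    by apply: (bmeas_comp bg); mfun.
  apply: etrans (Ex_std_normal_refl ab bn bF) _.
  by apply: eq_Ex => x; exact: (Ex_cst std_normal (g x)).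
have VE : Ex std_normal (fun z => (g z - m) ^+ 2) = s - m ^+ 2.
  transitivity (Ex std_normal (fun z => g z ^+ 2 - (2 * m) * g z + m ^+ 2)).
    by apply: eq_Ex => z; ring.
  rewrite ExD; [|by bm|exact: bmeas_cst].
  rewrite ExB; [|by bm|by bm].
  by rewrite ExZ// Ex_cst -/m -/s; ring.
have V0 : 0 <= s - m ^+ 2 by rewrite -VE; apply: Ex_ge0 => z; exact: sqr_ge0.
have v2 x : (u x - m) ^+ 2 <= (mehler2 x - 1) * (s - m ^+ 2).
  have bM := bmeas_mehler x.
  have -> : u x - m = Ex std_normal (fun z => (mehler x z - 1) * (g z - m)).
    transitivity (Ex std_normal (fun z => (mehler x z * g z - m * mehler x z) - (g z - m))).
      rewrite ExB; [|by bm|by bm].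
      rewrite !ExB//; [|by bm|by bm|exact: bmeas_cst].
      rewrite ExZ// Ex_mehler Ex_cst -mehlerE// -/m -/(u x); ring.
    by apply: eq_Ex => z; ring.
  have -> : mehler2 x - 1 = Ex std_normal (fun z => (mehler x z - 1) ^+ 2).
    transitivity (Ex std_normal (fun z => mehler x z ^+ 2 - 2 * mehler x z + 1)).
      rewrite ExD; [|by bm|exact: bmeas_cst].
      rewrite ExB; [|by bm|by bm].
      by rewrite ExZ// Ex_mehler Ex_cst Ex_mehler_sqr; ring.
    by apply: eq_Ex => z; ring.
  by rewrite -VE; apply: Ex_CS; bm.
have E2 : Ex std_normal (fun x => (u x - m) ^+ 2) <= (s - m ^+ 2) / 4.
  apply: Ex_le_mehler2 => //; first by bm.
  move=> x; rewrite sqr_ge0/= (le_trans (v2 x))// ler_wpM2r//.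
  by rewrite lerD2r ler_eXnr// mehler2_ge1.
have E4 : Ex std_normal (fun x => (u x - m) ^+ 4) <= (s - m ^+ 2) ^+ 2 / 4.
  apply: Ex_le_mehler2 => //; [by bm|exact: sqr_ge0|].
  move=> x; rewrite (exprM _ 2 2) sqr_ge0/=.
  apply: (@le_trans _ _ (((mehler2 x - 1) * (s - m ^+ 2)) ^+ 2)).
    by rewrite lerXn2r ?nnegrE ?sqr_ge0// mulr_ge0// subr_ge0 mehler2_ge1.
  rewrite exprMn ler_wpM2r ?sqr_ge0//.
  have := mehler2_ge1 x; nra.
have E1 : Ex std_normal (fun x => u x - m) = 0.
  by rewrite ExB//; [rewrite Eu Ex_cst subrr|exact: bmeas_cst].
(* In the expansion of (m + v)^4 the cubic term is absorbed by 4 m v^3 <= 2 m^2 v^2 + 2 v^4; the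
   linear term has mean zero. *)
apply: (@le_trans _ _ (Ex std_normal (fun x => m ^+ 4 + (4 * m ^+ 3) * (u x - m) +
    (8 * m ^+ 2) * (u x - m) ^+ 2 + 3 * (u x - m) ^+ 4))).
  apply: le_Ex; [by bm|by bm|move=> x].
  rewrite -/(u x); set v := u x - m.
  have -> : u x = m + v by rewrite /v; ring.
  rewrite -subr_ge0 [X in 0 <= X](_ : _ = 2 * v ^+ 2 * (m - v) ^+ 2); last by ring.
  by apply: mulr_ge0; [apply: mulr_ge0 => //; exact: sqr_ge0|exact: sqr_ge0].
rewrite ExD; [|by bm|by bm]; rewrite ExD; [|by bm|by bm]; rewrite ExD; [|by bm|by bm].
rewrite !ExZ; try by bm.
rewrite E1 Ex_cst.
(* With V = s - m^2 the bound becomes m^4 + 2 m^2 V + (3/4) V^2, at most (m^2 + V)^2 = s^2. The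
   factor 1/4 in [E2] is exactly what the middle term allows. *)
set A := Ex _ _ in E2 *; set B := Ex _ _ in E4 *.
have m0 : 0 <= m ^+ 2 by exact: sqr_ge0.
rewrite [leLHS](_ : _ = m ^+ 2 * m ^+ 2 + 8 * (m ^+ 2 * A) + 3 * B); last by ring.
have : m ^+ 2 * A <= m ^+ 2 * ((s - m ^+ 2) / 4) by rewrite ler_wpM2l.
have : 0 <= (s - m ^+ 2) ^+ 2 by exact: sqr_ge0.
move: (m ^+ 2) (m ^+ 2 * A) E4 => q qA; nra.
Qed.

End kernel.

End hypercontractivity1.

Section hypercontractivity.
Context {R : realType}.
Notation std_normal := (@std_normal R).
Notation std_gauss := (@std_gauss R).
Variables (a b : R).
Hypotheses (b0 : 0 < b) (ab : a ^+ 2 + b ^+ 2 = 1).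

Lemma Ex_std_gauss0 (f : euclid R 0 -> R) : Ex (std_gauss 0) f = f [tuple].
Proof.
rewrite -[RHS](Ex_cst (std_gauss 0)); apply: eq_Ex => x.
by congr f; exact: tuple0.
Qed.

(* Tensorization: the one-dimensional inequality in the first coordinate, then
   Minkowski's inequality in the form
   E_x (E_t h(t, x)^2)^2 = E_t E_t' E_x h(t, x)^2 h(t', x)^2. *)
Lemma hypercontractive n (g : euclid R n -> R) : a ^+ 2 <= 100^-1 ->
  bmeas g -> (forall z, 0 <= g z) ->
  Ex (std_gauss n) (fun x => Ex (std_gauss n) (fun y => g (lincomb a b x y)) ^+ 4) <=
  Ex (std_gauss n) (fun x => g x ^+ 2) ^+ 2.
Proof.
move=> a100; elim: n g => [|n IH] g bg g0.
  rewrite !Ex_std_gauss0 -exprM lerXn2r ?nnegrE ?g0//.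
  by rewrite (_ : lincomb _ _ _ _ = [tuple])//; exact: tuple0.
(* In [h] the noise acts on the last [n] coordinates only; [u] then adds it in the first one. *)
pose h (z : measurableTypeR R * euclid R n) :=
  Ex (std_gauss n) (fun y => g (econs (z.1, lincomb a b z.2 y))).
have h0 z : 0 <= h z by apply: Ex_ge0 => y; exact: g0.
have bh : bmeas h.
  apply: (@bmeas_Ex2 _ _ _ _ _ (std_gauss n) (fun w => g (econs (w.1.1, lincomb a b w.1.2 w.2)))).
  by apply: (bmeas_comp bg); mfun.
pose u (z : measurableTypeR R * euclid R n) := Ex std_normal (fun s => h (a * z.1 + b * s, z.2)).
have bu : bmeas u.
  apply: (@bmeas_Ex2 _ _ _ _ _ std_normal (fun w => h (a * w.1.1 + b * w.2, w.1.2))).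
  by apply: (bmeas_comp bh); mfun.
have bgc : bmeas (fun z : euclid R n.+1 * euclid R n.+1 => g (lincomb a b z.1 z.2)).
  by apply: (bmeas_comp bg); mfun.
have uE t x : Ex (std_gauss n.+1) (fun y => g (lincomb a b (econs (t, x)) y)) = u (t, x).
  rewrite Ex_std_gaussS; last exact: (bmeas_pair1 _ bgc).
  by apply: eq_Ex => s; apply: eq_Ex => y; rewrite lincomb_econs.
pose G t := Ex (std_gauss n) (fun x => g (econs (t, x)) ^+ 2).
have bge := bmeas_econs bg.
have bG : bmeas G by apply: (@bmeas_Ex2 _ _ _ _ _ (std_gauss n) (fun w => g (econs w) ^+ 2)); bm.
have G0 t : 0 <= G t by apply: Ex_ge0 => x; exact: sqr_ge0.
rewrite (Ex_std_gaussS (bmeasX 2 bg)) -/G Ex_std_gaussS; last first.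
  by apply: bmeasX; exact: (bmeas_Ex2 (std_gauss n.+1) bgc).
have -> : Ex std_normal (fun t => Ex (std_gauss n) (fun x =>
    Ex (std_gauss n.+1) (fun y => g (lincomb a b (econs (t, x)) y)) ^+ 4)) =
    Ex std_normal (fun t => Ex (std_gauss n) (fun x => u (t, x) ^+ 4)).
  by apply: eq_Ex => t; apply: eq_Ex => x; rewrite uE.
rewrite (Ex_fubini std_normal (std_gauss n) (bmeasX 4 bu)).
pose H x := Ex std_normal (fun t => h (t, x) ^+ 2).
have bH : bmeas H.
  apply: (@bmeas_Ex2 _ _ _ _ _ std_normal (fun w => h (w.2, w.1) ^+ 2)).
  by apply: bmeasX; apply: (bmeas_comp bh); mfun.
apply: (@le_trans _ _ (Ex (std_gauss n) (fun x => H x ^+ 2))).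
  apply: le_Ex.
  - apply: (@bmeas_Ex2 _ _ _ _ _ std_normal (fun w => u (w.2, w.1) ^+ 4)).
    by apply: bmeasX; apply: (bmeas_comp bu); mfun.
  - exact: bmeasX.
  - move=> x; apply: hypercontractive1 => //; exact: (bmeas_pair2 x bh).
pose K (w : euclid R n * measurableTypeR R * measurableTypeR R) :=
   h (w.1.2, w.1.1) ^+ 2 * h (w.2, w.1.1) ^+ 2.
have bK : bmeas K.
  apply: bmeasM; apply: bmeasX; apply: (bmeas_comp bh); mfun.
have bhx x : bmeas (fun t => h (t, x)) by exact: (bmeas_pair2 x bh).
have bht t : bmeas (fun x => h (t, x)) by exact: (bmeas_pair1 t bh).
have -> : Ex (std_gauss n) (fun x => H x ^+ 2) =
   Ex std_normal (fun t => Ex std_normal (fun t' => Ex (std_gauss n) (fun x => h (t, x) ^+ 2 * h (t', x) ^+ 2))).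
  transitivity (Ex (std_gauss n) (fun x => Ex std_normal (fun t => Ex std_normal (fun t' => K (x, t, t'))))).
    apply: eq_Ex => x; rewrite expr2 -(ExZr _ _ (bmeasX 2 (bhx x))).
    by apply: eq_Ex => t; rewrite -(ExZ _ _ (bmeasX 2 (bhx x))).
  apply: etrans (Ex_fubini (std_gauss n) std_normal (bmeas_Ex2 std_normal bK)) _; apply: eq_Ex => t.
  apply: (Ex_fubini (std_gauss n) std_normal (F := fun w => K (w.1, t, w.2))).
  by apply: (bmeas_comp bK); mfun.
have -> : Ex std_normal G ^+ 2 = Ex std_normal (fun t => Ex std_normal (fun t' => G t * G t')).
  rewrite expr2 -(ExZr _ _ bG); apply: eq_Ex => t.
  by rewrite -(ExZ _ _ bG).
have bL : bmeas (fun z : measurableTypeR R * measurableTypeR R =>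
   Ex (std_gauss n) (fun x => h (z.1, x) ^+ 2 * h (z.2, x) ^+ 2)).
  apply: (@bmeas_Ex2 _ _ _ _ _ (std_gauss n) (fun w => K (w.2, w.1.1, w.1.2))).
  by apply: (bmeas_comp bK); mfun.
have bGG : bmeas (fun z : measurableTypeR R * measurableTypeR R => G z.1 * G z.2).
  by apply: bmeasM; apply: (bmeas_comp bG); mfun.
apply: le_Ex; [exact: (bmeas_Ex2 std_normal bL)|exact: (bmeas_Ex2 std_normal bGG)|move=> t].
apply: le_Ex; [exact: (bmeas_pair1 t bL)|exact: (bmeas_pair1 t bGG)|move=> t'].
have bgt r : bmeas (fun x => g (econs (r, x))) by exact: (bmeas_pair1 r bge).
have IHr r : Ex (std_gauss n) (fun x => (h (r, x) ^+ 2) ^+ 2) <= G r ^+ 2.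
  rewrite [leLHS](_ : _ = Ex (std_gauss n) (fun x => h (r, x) ^+ 4)); last first.
    by apply: eq_Ex => x; rewrite -exprM.
  exact: (IH _ (bgt r)).
(* After squaring, Cauchy-Schwarz in x separates [t] from [t'], and the induction hypothesis applies
   to each factor. *)
rewrite -ler_sqr ?nnegrE ?mulr_ge0//; last by apply: Ex_ge0 => x; rewrite mulr_ge0 ?sqr_ge0.
apply: le_trans (Ex_CS _ (bmeasX 2 (bht t)) (bmeasX 2 (bht t'))) _.
rewrite exprMn; apply: ler_pM => //; apply: Ex_ge0 => x; exact: sqr_ge0.
Qed.

End hypercontractivity.

(** * Noise stability *)

Section noise_stability.
Context {R : realType} {n : nat}.
Notation std_gauss := (@std_gauss R n).
Implicit Types (f : euclid R n -> R) (a b : R).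

Definition noise a f x := Ex std_gauss (fun y => f (lincomb a (Num.sqrt (1 - a ^+ 2)) x y)).

Definition stab a f := Ex std_gauss (fun x => f x * noise a f x).

Lemma bmeas_lincomb a b f : bmeas f ->
  bmeas (fun z : euclid R n * euclid R n => f (lincomb a b z.1 z.2)).
Proof. by move=> bf; apply: (bmeas_comp bf); mfun. Qed.

Lemma bmeas_noise a f : bmeas f -> bmeas (noise a f).
Proof. by move=> bf; exact: (bmeas_Ex2 std_gauss (bmeas_lincomb _ _ bf)). Qed.

(* [noise a] is self-adjoint and [noise a \o noise a = noise (a ^ 2)]. *)
Lemma Ex_noise_sqr a f : 0 < a < 1 -> bmeas f ->
  Ex std_gauss (fun x => noise a f x ^+ 2) = stab (a ^+ 2) f.
Proof.
move=> /andP[a0 a1] bf.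
have a20 : 0 < 1 - a ^+ 2 by rewrite subr_gt0 expr_lt1 ?ltW.
have a40 : 0 < 1 - (a ^+ 2) ^+ 2 by rewrite subr_gt0 expr_lt1 ?sqr_ge0// expr_lt1// ltW.
set b := Num.sqrt (1 - a ^+ 2).
have b0 : 0 < b by rewrite sqrtr_gt0.
have b2 : b ^+ 2 = 1 - a ^+ 2 by rewrite sqr_sqrtr// ltW.
set b' := Num.sqrt (1 - (a ^+ 2) ^+ 2).
have b'0 : 0 < b' by rewrite sqrtr_gt0.
have b'2 : b' ^+ 2 = 1 - (a ^+ 2) ^+ 2 by rewrite sqr_sqrtr// ltW.
have ab : a ^+ 2 + b ^+ 2 = 1 by rewrite b2 addrC subrK.
have bn : b != 0 by rewrite gt_eqF.
have b'n : b' != 0 by rewrite gt_eqF.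
have bfab := bmeas_lincomb a b bf.
have bfx x : bmeas (fun y => f (lincomb a b x y)) by exact: (bmeas_pair1 x bfab).
pose K (w : euclid R n * euclid R n * euclid R n) :=
  f (lincomb a b w.1.2 w.2) * f (lincomb a b w.1.2 w.1.1).
have bK : bmeas K by apply: bmeasM; apply: (bmeas_comp bf); mfun.
pose L (w : euclid R n * euclid R n * euclid R n) :=
  f w.1.2 * f (lincomb a b (lincomb a b w.1.2 w.2) w.1.1).
have bL : bmeas L by apply: bmeasM; apply: (bmeas_comp bf); mfun.
transitivity (Ex std_gauss (fun z => Ex std_gauss (fun x => Ex std_gauss (fun y => K (z, x, y))))).
  apply: etrans (esym (Ex_fubini std_gauss std_gauss (bmeas_Ex2 std_gauss bK))).
  apply: eq_Ex => x; rewrite expr2 -(ExZ _ _ (bfx x)).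
  by apply: eq_Ex => z; rewrite -(ExZr _ _ (bfx x)).
(* Reflecting (x, y) at fixed z turns a x + b y into x and, the reflection being an involution, x
   into a x + b y. *)
transitivity (Ex std_gauss (fun z => Ex std_gauss (fun x => Ex std_gauss (fun y => L (z, x, y))))).
  apply: eq_Ex => z.
  have bLz : bmeas (fun v : euclid R n * euclid R n => L (z, v.1, v.2)).
    by apply: (bmeas_comp bL); mfun.
  apply: etrans (Ex_std_gauss_refl ab bn bLz).
  apply: eq_Ex => x; apply: eq_Ex => y; rewrite /K /L/=; congr (_ * f (lincomb _ _ _ _)).
  apply: eq_euclid => i; rewrite !ecoord_lincomb.
  rewrite [RHS](_ : _ = (a ^+ 2 + b ^+ 2) * ecoord x i); last by ring.
  by rewrite ab mul1r.
apply: etrans (Ex_fubini std_gauss std_gauss (bmeas_Ex2 std_gauss bL)) _.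
apply: eq_Ex => x.
have bLx : bmeas (fun v : euclid R n * euclid R n => L (v.1, x, v.2)).
  by apply: (bmeas_comp bL); mfun.
apply: etrans (Ex_fubini std_gauss std_gauss bLx) _.
rewrite -(ExZ _ (f x) (bmeas_pair1 x (bmeas_lincomb (a ^+ 2) b' bf))) -/b'.
have bq : bmeas (fun w => f x * f (lincomb (a ^+ 2) b' x w)).
  by apply: bmeasM; [exact: bmeas_cst|exact: (bmeas_pair1 x (bmeas_lincomb (a ^+ 2) b' bf))].
(* Given x, the second argument of [L] is a^2 x + a b y + b z, and a b y + b z is [b'] times a
   normalized combination of y and z. *)
have cd : (a * b / b') ^+ 2 + (b / b') ^+ 2 = 1.
  rewrite [LHS](_ : _ = b ^+ 2 * (1 + a ^+ 2) / b' ^+ 2); last by field.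
  rewrite b2 b'2 (_ : (1 - a ^+ 2) * _ = 1 - (a ^+ 2) ^+ 2) ?divff ?gt_eqF//; ring.
have dn : b / b' != 0 by rewrite mulf_neq0// invr_neq0.
apply: etrans (Ex_std_gauss_comb cd dn bq).
apply: eq_Ex => y; apply: eq_Ex => z; rewrite /L/=; congr (_ * f _).
by apply: eq_euclid => i; rewrite !ecoord_lincomb; field.
Qed.

Lemma stab_sqr a f : 0 < a < 1 -> bmeas f ->
  stab a f ^+ 2 <= Ex std_gauss (fun x => f x ^+ 2) * stab (a ^+ 2) f.
Proof.
move=> a01 bf; rewrite -Ex_noise_sqr//.
exact: (Ex_CS std_gauss bf (bmeas_noise a bf)).
Qed.

Lemma noise_ge0 a f x : (forall y, 0 <= f y) -> 0 <= noise a f x.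
Proof. by move=> f0; apply: Ex_ge0 => y; exact: f0. Qed.

Lemma stab_ge0 a f : (forall y, 0 <= f y) -> 0 <= stab a f.
Proof. by move=> f0; apply: Ex_ge0 => y; rewrite mulr_ge0// noise_ge0. Qed.

Section idempotent.
Variables (f : euclid R n -> R) (p : R).
Hypotheses (bf : bmeas f) (f2 : forall x, f x ^+ 2 = f x) (Efp : Ex std_gauss f = p).
Let f0 x : 0 <= f x. Proof. by rewrite -f2 sqr_ge0. Qed.
Let p0 : 0 <= p. Proof. by rewrite -Efp; exact: Ex_ge0. Qed.
Let pE : Ex std_gauss (fun x => f x ^+ 2) = p.
Proof. by rewrite -Efp; apply: eq_Ex => x; exact: f2. Qed.

(** This is the inequality (stab a f / p)^(2^m) <= stab (a^(2^m)) f / p with its denominators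
    cleared, which keeps it free of division in the induction. *)
Lemma stab_iter m a : 0 < a < 1 ->
  p * stab a f ^+ (2 ^ m) <= p ^+ (2 ^ m) * stab (a ^+ (2 ^ m)) f.
Proof.
elim: m a => [|m IH] a a01; first by rewrite !expn0 !expr1.
rewrite expnS !exprM.
have a201 : 0 < a ^+ 2 < 1.
  by case/andP: a01 => a0 a1; rewrite exprn_gt0//= expr_lt1// ltW.
have S1 : stab a f ^+ 2 <= p * stab (a ^+ 2) f by rewrite -pE; exact: stab_sqr.
have {IH} := IH _ a201.
have s0 : 0 <= stab a f ^+ 2 by exact: sqr_ge0.
move: (stab a f ^+ 2) (stab (a ^+ 2) f) (stab ((a ^+ 2) ^+ (2 ^ m)) f) S1 s0 => x y z xy x0 IH.
apply: le_trans (_ : p * (p * y) ^+ (2 ^ m) <= _).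
  apply: ler_wpM2l; first exact: p0.
  by apply: lerXn2r; [rewrite nnegrE|rewrite nnegrE (le_trans x0)|exact: xy].
rewrite exprMn mulrCA -exprM mulnC exprM expr2 -mulrA.
by apply: ler_wpM2l IH; apply: exprn_ge0; exact: p0.
Qed.

(** Two uses of Cauchy-Schwarz play the role of Hoelder's inequality with exponents 4/3 and 4: the
    stability is at most p^(3/4) times the L^4 norm of the noisy function, which hypercontractivity
    bounds by the L^2 norm p^(1/2). *)
Lemma stab_small a : a ^+ 2 <= 100^-1 -> stab a f ^+ 4 <= p ^+ 5.
Proof.
move=> a100.
have b1 : 0 < 1 - a ^+ 2 by lra.
have b0 : 0 < Num.sqrt (1 - a ^+ 2) by rewrite sqrtr_gt0.
have ab : a ^+ 2 + Num.sqrt (1 - a ^+ 2) ^+ 2 = 1 by rewrite sqr_sqrtr ?ltW// addrC subrK.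
set u := noise a f.
have bu : bmeas u by exact: bmeas_noise.
have H : Ex std_gauss (fun x => u x ^+ 4) <= p ^+ 2.
  by rewrite -pE; exact: (hypercontractive b0 ab a100 bf f0).
have S1 : stab a f ^+ 2 <= p * Ex std_gauss (fun x => f x * u x ^+ 2).
  rewrite -{1}pE.
  have -> : stab a f = Ex std_gauss (fun x => f x * (f x * u x)).
    by apply: eq_Ex => x; rewrite mulrA -expr2 f2.
  have -> : Ex std_gauss (fun x => f x * u x ^+ 2) = Ex std_gauss (fun x => (f x * u x) ^+ 2).
    by apply: eq_Ex => x; rewrite exprMn f2.
  by apply: Ex_CS; bm.
have S2 : Ex std_gauss (fun x => f x * u x ^+ 2) ^+ 2 <= p * Ex std_gauss (fun x => u x ^+ 4).
  have -> : Ex std_gauss (fun x => u x ^+ 4) = Ex std_gauss (fun x => (u x ^+ 2) ^+ 2).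
    by apply: eq_Ex => x; rewrite -exprM.
  by rewrite -{1}pE; apply: Ex_CS; bm.
have E0 : 0 <= Ex std_gauss (fun x => f x * u x ^+ 2).
  by apply: Ex_ge0 => x; rewrite mulr_ge0// sqr_ge0.
rewrite (exprM _ 2 2).
apply: le_trans (_ : (p * Ex std_gauss (fun x => f x * u x ^+ 2)) ^+ 2 <= _).
  by rewrite lerXn2r ?nnegrE ?sqr_ge0// mulr_ge0.
rewrite exprMn (_ : p ^+ 5 = p ^+ 2 * (p * p ^+ 2)); last by ring.
rewrite ler_wpM2l ?sqr_ge0//; apply: le_trans S2 _.
by rewrite ler_wpM2l.
Qed.

(** After the [m] squarings the correlation is in the hypercontractive range, where the fourth power
    of the ratio is at most p^5 / p^4 = p. *)
Lemma stab_le m a : 0 < a < 1 -> (a ^+ (2 ^ m)) ^+ 2 <= 100^-1 -> 0 < p ->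
  (stab a f / p) ^+ (4 * 2 ^ m) <= p.
Proof.
move=> a01 a100 pp.
have S1 := stab_iter m a01.
have S2 := stab_small a100.
have s0 : 0 <= stab a f by exact: stab_ge0.
have t0 : 0 <= stab (a ^+ (2 ^ m)) f by exact: stab_ge0.
move: (stab a f) (stab (a ^+ (2 ^ m)) f) S1 S2 s0 t0 => x y S1 S2 x0 y0.
rewrite expr_div_n ler_pdivrMr ?exprn_gt0// mulnC -exprS exprM.
rewrite -(ler_pM2l (exprn_gt0 4 pp)) -exprMn.
apply: le_trans (_ : (p ^+ (2 ^ m) * y) ^+ 4 <= _).
  apply: lerXn2r; last exact: S1.
    by rewrite nnegrE mulr_ge0 ?exprn_ge0.
  by rewrite nnegrE mulr_ge0 ?exprn_ge0.
rewrite exprMn -exprM.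
apply: (@le_trans _ _ (p ^+ (2 ^ m * 4) * p ^+ 5)).
  by apply: ler_wpM2l S2; exact: exprn_ge0.
by rewrite -!exprD [X in _ <= _ ^+ X]addnC addSnnS.
Qed.

End idempotent.
End noise_stability.

(** * Crossing estimate *)

Section moments.
Context {R : realType}.
Notation std_normal := (@std_normal R).
Notation std_gauss := (@std_gauss R).

Lemma ge0_integral_std_normalN (f : measurableTypeR R -> \bar R) :
  measurable_fun [set: measurableTypeR R] f -> (forall x, (0 <= f x)%E) ->
  (\int[std_normal]_x f (- x)%R = \int[std_normal]_x f x)%E.
Proof.
move=> mf f0.
have cst (c : \bar R) : (0 <= c)%E -> (\int[std_normal]_x c)%E = c.
  move=> c0; rewrite integral_cst//; have /= -> := probability_setT std_normal.
  exact: mule1.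
have ab : (0 : R) ^+ 2 + (-1) ^+ 2 = 1 by rewrite expr0n sqrrN expr1n add0r.
have b0 : (-1 : R) != 0 by rewrite oppr_eq0 oner_eq0.
have mF : measurable_fun setT (fun z : measurableTypeR R * measurableTypeR R => f z.1).
  exact: (measurableT_comp mf measurable_fst).
have H := ge0_integral_std_normal_refl ab b0 mF (fun z => f0 _).
apply: etrans (etrans H _); last first.
  by apply: eq_integral => x _; exact: (cst (f x) (f0 x)).
rewrite /= -[LHS]cst; last exact: integral_ge0.
apply: eq_integral => x _; apply: eq_integral => y _.
by rewrite mul0r add0r mulN1r.
Qed.

(** A crude bound on the variance: t^2 <= 4 exp (t^2 / 4), whose Gaussian integral is 4 sqrt 2. *)
Lemma integral_std_normal_sqr : (\int[std_normal]_t (t ^+ 2)%:E <= 6%:E)%E.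
Proof.
have k0 : 0 < 1 - 2 * (4^-1 : R) by lra.
have m2 : measurable_fun [set: measurableTypeR R] (fun t : measurableTypeR R => ((t : R) ^+ 2)%:E).
  by apply/measurable_EFinP; exact: measurable_funX.
have mE : measurable_fun [set: measurableTypeR R]
    (fun t : measurableTypeR R => (expR (4^-1 * t ^+ 2 + 0 * t))%:E).
  by apply/measurable_EFinP; exact: measurable_exp_quadratic.
apply: (@le_trans _ _ (\int[std_normal]_t (4%:E * (expR (4^-1 * t ^+ 2 + 0 * t))%:E))%E).
  apply: ge0_le_integral => //.
  - by move=> t _; rewrite lee_fin sqr_ge0.
  - exact: emeasurable_funM.
  - move=> t _; rewrite -EFinM lee_fin.
    have := expR_ge1Dx (4^-1 * t ^+ 2 + 0 * t); lra.
rewrite ge0_integralZl//.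
rewrite integral_std_normal_expR// -EFinM lee_fin expr0n mul0r expR0 mulr1.
have s1 : 2 / 3 <= Num.sqrt (1 - 2 * 4^-1) :> R.
  rewrite -[leLHS]ger0_norm; last by lra.
  by rewrite -sqrtr_sqr ler_sqrt; lra.
rewrite ler_pdivrMr; first by lra.
by rewrite sqrtr_gt0.
Qed.

(** Averaging the integrands for [m] and [- m] removes the cross term, so that all integrals are of
    nonnegative functions. *)
Lemma integral_std_normal_affine_sqr (k m : R) :
  (\int[std_normal]_t ((k + m * t) ^+ 2)%:E <= (k ^+ 2 + 6 * m ^+ 2)%:E)%E.
Proof.
pose g (m : R) (t : measurableTypeR R) := ((k + m * t) ^+ 2)%:E.
have mg m' : measurable_fun [set: measurableTypeR R] (g m').
  by apply/measurable_EFinP; apply: measurable_funX; mfun.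
have g0 m' t : (0 <= g m' t)%E by rewrite lee_fin sqr_ge0.
have m2 : measurable_fun [set: measurableTypeR R] (fun t : measurableTypeR R => ((t : R) ^+ 2)%:E).
  by apply/measurable_EFinP; exact: measurable_funX.
have sym : (\int[std_normal]_t g (- m)%R t = \int[std_normal]_t g m t)%E.
  apply: etrans (ge0_integral_std_normalN (mg m) (g0 m)).
  by apply: eq_integral => t _; rewrite /g mulrN mulNr.
have : (\int[std_normal]_t g m t + \int[std_normal]_t g (- m)%R t <= (2 * (k ^+ 2 + 6 * m ^+ 2))%:E)%E.
  rewrite -ge0_integralD//.
  have -> : (\int[std_normal]_t (g m t + g (- m)%R t) =
     \int[std_normal]_t ((2 * k ^+ 2)%:E + (2 * m ^+ 2)%:E * (t ^+ 2)%:E))%E.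
    apply: eq_integral => t _; rewrite /g -EFinM -!EFinD; congr (_%:E); ring.
  rewrite ge0_integralD//; last 3 first.
  - by move=> t _; rewrite lee_fin mulr_ge0 ?sqr_ge0.
  - by move=> t _; rewrite -EFinM lee_fin mulr_ge0 ?sqr_ge0// mulr_ge0 ?sqr_ge0.
  - exact: emeasurable_funM.
  rewrite ge0_integralZl//; last 2 first.
  - by move=> t _; rewrite lee_fin sqr_ge0.
  - by rewrite lee_fin mulr_ge0 ?sqr_ge0.
  rewrite integral_cst//; have /= -> := probability_setT std_normal.
  rewrite mule1 mulrDr EFinD leeD2l//.
  rewrite (_ : 2 * (6 * m ^+ 2) = 2 * m ^+ 2 * 6); last by ring.
  rewrite [X in (_ <= X)%E]EFinM; apply: lee_wpmul2l; last exact: integral_std_normal_sqr.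
  by rewrite lee_fin mulr_ge0 ?sqr_ge0.
rewrite sym -/(g m).
case: (\int[std_normal]_t g m t)%E => [r| |]//=.
- by rewrite -EFinD !lee_fin; lra.
- by move=> _; rewrite leNye.
Qed.

Definition dot n (N : 'I_n -> R) (y : euclid R n) : R := \sum_(i < n) N i * ecoord y i.

Lemma dot_econs n (N : 'I_n.+1 -> R) t y :
  dot N (econs (t, y)) = N ord0 * t + dot (fun i => N (lift ord0 i)) y.
Proof.
rewrite /dot big_ord_recl ecoord_econs0; congr (_ + _).
by apply: eq_bigr => i _; rewrite ecoord_econsS.
Qed.

Lemma measurable_dot n (N : 'I_n -> R) : measurable_fun [set: euclid R n] (dot N).
Proof.
apply: measurable_sum => i; apply: measurable_funM => //.
exact: measurable_ecoord.
Qed.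

(** The additive constant [k] makes the induction work: at fixed first coordinate t, the inner
    integral is of the same kind with constant k + N_0 t. *)
Lemma integral_std_gauss_dot_sqr n (N : 'I_n -> R) (k : R) :
  (\int[std_gauss n]_y ((k + dot N y) ^+ 2)%:E <= (k ^+ 2 + 6 * \sum_(i < n) N i ^+ 2)%:E)%E.
Proof.
have mD m (M : 'I_m -> R) (l : R) : measurable_fun [set: euclid R m]
    (fun y => ((l + dot M y) ^+ 2)%:E).
  apply/measurable_EFinP; apply: measurable_funX; apply: measurable_funD => //.
  exact: measurable_dot.
elim: n N k => [|n IH] N k.
  rewrite big_ord0 mulr0 addr0.
  have -> : (\int[std_gauss 0]_y ((k + dot N y) ^+ 2)%:E = \int[std_gauss 0]_y (k ^+ 2)%:E)%E.
    by apply: eq_integral => y _; rewrite /dot big_ord0 addr0.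
  rewrite integral_cst//; have /= -> := probability_setT (std_gauss 0).
  by rewrite mule1.
rewrite ge0_integral_std_gaussS//; last by move=> x; rewrite lee_fin sqr_ge0.
set S := \sum_(i < n) N (lift ord0 i) ^+ 2.
have S0 : 0 <= S by apply: sumr_ge0 => i _; exact: sqr_ge0.
apply: (@le_trans _ _ (\int[std_normal]_t (((k + N ord0 * t) ^+ 2)%:E + (6 * S)%:E))%E).
  apply: ge0_le_integral => //.
  - by move=> t _; apply: integral_ge0 => y _; rewrite lee_fin sqr_ge0.
  - apply: (measurable_fun_fubini_tonelli_F (m2 := std_gauss n)
      (fun z => ((k + dot N (econs z)) ^+ 2)%:E)).
    + exact: (measurableT_comp (mD _ N k) measurable_econs).
    + by move=> z; rewrite lee_fin sqr_ge0.
  - apply: emeasurable_funD => //; apply/measurable_EFinP; apply: measurable_funX; mfun.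
  - move=> t _; rewrite -EFinD.
    have -> : (\int[std_gauss n]_y ((k + dot N (econs (t, y))) ^+ 2)%:E =
      \int[std_gauss n]_y (((k + N ord0 * t) + dot (fun i => N (lift ord0 i)) y) ^+ 2)%:E)%E.
      by apply: eq_integral => y _; rewrite dot_econs addrA.
    exact: IH.
rewrite ge0_integralD//; last 3 first.
- by move=> t _; rewrite lee_fin sqr_ge0.
- by apply/measurable_EFinP; apply: measurable_funX; mfun.
- by move=> t _; rewrite lee_fin mulr_ge0.
rewrite integral_cst//; have /= -> := probability_setT std_normal.
rewrite mule1 big_ord_recl -/S mulrDr addrA EFinD leeD2r//.
exact: integral_std_normal_affine_sqr.
Qed.

Lemma integral_std_gauss_enorm_sqr n :
  (\int[std_gauss n]_y (\sum_(i < n) ecoord y i ^+ 2)%:E <= (6 * n%:R)%:E)%E.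
Proof.
have mX (i : 'I_n) : measurable_fun [set: euclid R n] (fun y => (ecoord y i ^+ 2)%:E).
  by apply/measurable_EFinP; apply: measurable_funX; exact: measurable_ecoord.
have -> : (\int[std_gauss n]_y (\sum_(i < n) ecoord y i ^+ 2)%:E =
    \sum_(i < n) \int[std_gauss n]_y (ecoord y i ^+ 2)%:E)%E.
  rewrite -ge0_integral_sum//; last by move=> i y _; rewrite lee_fin sqr_ge0.
  by apply: eq_integral => y _; rewrite sumEFin.
rewrite (_ : 6 * n%:R = \sum_(i < n) 6); last by rewrite sumr_const card_ord mulr_natr.
rewrite -sumEFin; apply: lee_sum => i _.
pose N (j : 'I_n) : R := (j == i)%:R.
have := integral_std_gauss_dot_sqr N 0.
have -> : (0 : R) ^+ 2 + 6 * \sum_(j < n) N j ^+ 2 = 6.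
  rewrite (bigD1 i)//= big1 => [|j ji]; last by rewrite /N (negbTE ji) expr0n.
  by rewrite /N eqxx expr0n expr1n add0r addr0 mulr1.
apply: le_trans; rewrite le_eqVlt; apply/orP; left; apply/eqP.
apply: eq_integral => y _; congr ((_ ^+ 2)%:E).
rewrite add0r /dot (bigD1 i)//= big1 => [|j ji]; last by rewrite /N (negbTE ji) mul0r.
by rewrite /N eqxx mul1r addr0.
Qed.

End moments.

(** * Euclidean neighborhoods and their measurability *)

Section neighborhood.
Context {R : realType} {n : nat}.
Implicit Types (x y b : euclid R n) (B : set (euclid R n)) (e : R).

Definition sqdist x y : R := \sum_(i < n) (ecoord x i - ecoord y i) ^+ 2.

Lemma sqdist_ge0 x y : 0 <= sqdist x y.
Proof. by apply: sumr_ge0 => i _; exact: sqr_ge0. Qed.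

Lemma edist_lt x y e : 0 < e -> (Defs.edist x y < e) = (sqdist x y < e ^+ 2).
Proof.
move=> e0; rewrite /Defs.edist -/(sqdist x y) -[in LHS](gtr0_norm e0) -sqrtr_sqr.
by rewrite ltr_sqrt// exprn_gt0.
Qed.

Lemma enbhdP B e x : 0 < e ->
  enbhd B e x <-> exists2 b, B b & sqdist x b < e ^+ 2.
Proof.
move=> e0; split.
  move=> /ereal_inf_ltP[_ [b Bb <-]]; rewrite lte_fin edist_lt// => h.
  by exists b.
move=> [b Bb h]; apply/ereal_inf_ltP; exists (Defs.edist x b)%:E; first by exists b.
by rewrite lte_fin edist_lt.
Qed.

Let box (w : n.-tuple rat * rat) : set (euclid R n) :=
  [set x | forall i, `|ecoord x i - ratr (tnth w.1 i)| < ratr w.2].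

Let measurable_box w : measurable (box w).
Proof.
rewrite (_ : box w = \bigcap_(i in [set: 'I_n])
   ((fun x => `|ecoord x i - ratr (tnth w.1 i)|) @^-1` `]-oo, (ratr w.2 : R)[)).
  apply: fin_bigcap_measurable => // i _.
  rewrite -[X in measurable X]setTI.
  have mi : measurable_fun [set: euclid R n] (fun x => `|ecoord x i - ratr (tnth w.1 i)|).
    apply: measurableT_comp => //; apply: measurable_funB => //.
    exact: measurable_ecoord.
  exact: mi.
apply/seteqP; split => x /=.
  by move=> h i _ /=; rewrite in_itv/=; exact: h.
by move=> h i; have := h i I; rewrite /= in_itv.
Qed.

Let box_nbhd x r : 0 < r -> exists2 w, box w x &
  forall y, box w y -> forall i, `|ecoord y i - ecoord x i| < r.
Proof.
move=> r0.
have [q] : exists q : rat, ratr q \in `]0, (r / 2)[ by apply: rat_in_itvoo; lra.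
rewrite in_itv/= => /andP[q0 qr].
have /choice[t tP] (i : 'I_n) : exists t : rat, `|ecoord x i - ratr t| < ratr q.
  have [t] : exists t : rat, ratr t \in `](ecoord x i - ratr q), (ecoord x i + ratr q)[.
    by apply: rat_in_itvoo; lra.
  rewrite in_itv/= => /andP[h1 h2]; exists t.
  by rewrite ltr_norml; apply/andP; split; lra.
exists ([tuple t i | i < n], q) => [i|y yw i] /=; first by rewrite tnth_mktuple.
have := yw i; rewrite /= tnth_mktuple => h1.
have h2 := tP i; move: h1 h2; rewrite !ltr_norml => /andP[h1 h2] /andP[h3 h4].
by apply/andP; split; lra.
Qed.

(** A neighborhood is open, whatever the set [B], hence the union of the countably many rational
    boxes that it contains. *)
Lemma measurable_enbhd B e : 0 < e -> measurable (enbhd B e).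
Proof.
move=> e0.
pose F w := if `[< box w `<=` enbhd B e >] then box w else set0.
rewrite (_ : enbhd B e = \bigcup_w F w).
  apply: countable_bigcupT_measurable; first exact: countableP.
  by move=> w; rewrite /F; case: ifP => _; [exact: measurable_box|exact: measurable0].
apply/seteqP; split => x; last first.
  by move=> [w _]; rewrite /F; case: asboolP => // + xw; exact.
move=> /(enbhdP _ _ e0)[b Bb xb].
set S := \sum_(i < n) `|ecoord x i - ecoord b i|.
have S0 : 0 <= S by exact: sumr_ge0.
set gap := e ^+ 2 - sqdist x b.
have gap0 : 0 < gap by rewrite subr_gt0.
(* Moving every coordinate of x by at most r <= 1 increases its squared distance to b by at most r
   (2 S + n), which this choice keeps below [gap]. *)
pose r := Num.min 1 (gap / (2 * S + n%:R + 1)).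
have d0 : 0 < 2 * S + n%:R + 1 by rewrite ltr_wpDl// addr_ge0// mulr_ge0.
have r0 : 0 < r by rewrite lt_min ltr01/= divr_gt0.
have [w wx wr] := box_nbhd x r0.
exists w => //; rewrite /F; case: asboolP => // -[] y yw.
apply/(enbhdP _ _ e0); exists b => //.
apply: (@le_lt_trans _ _ (sqdist x b + r * (2 * S + n%:R))).
  rewrite /sqdist mulrDr mulr_natr mulrCA !mulr_sumr.
  rewrite -[X in _ + (_ + r *+ X)](card_ord n) -sumr_const -!big_split/=.
  apply: ler_sum => i _.
  set u := ecoord y i - ecoord x i; set v := ecoord x i - ecoord b i.
  have ur : `|u| <= r by rewrite ltW// wr.
  rewrite (_ : ecoord y i - ecoord b i = u + v); last by rewrite /u /v; ring.
  have r1 : r <= 1 by rewrite ge_min lexx.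
  have h1 : u * v <= r * `|v|.
    by rewrite (le_trans (ler_norm _))// normrM ler_wpM2r.
  have h2 : u ^+ 2 <= r.
    rewrite -real_normK ?num_real// (le_trans (_ : _ <= r ^+ 2))//.
      by rewrite lerXn2r ?nnegrE// ltW.
    by rewrite expr2 ler_piMr// ltW.
  rewrite (_ : (u + v) ^+ 2 = v ^+ 2 + (2 * (u * v) + u ^+ 2)); last by ring.
  by rewrite lerD2l; apply: lerD => //; lra.
have : r * (2 * S + n%:R + 1) <= gap.
  by rewrite -ler_pdivlMr// ge_min lexx orbT.
rewrite /gap; lra.
Qed.

End neighborhood.

(** Applied twice in the one-step estimate: to the integral in y, with the direction [N], then to
    the integral in x, with the indicator. A projection on a vector of norm at most 1 costs a
    constant, and only the term in the full square norm costs a factor [n]. *)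
Lemma Ex_std_gauss_quadratic_le (R : realType) n (h : euclid R n -> R) (N : 'I_n -> R)
    (S : set (euclid R n)) (c0 c1 c2 c3 : R) :
  bmeas h -> measurable S -> 0 <= c0 -> 0 <= c1 -> 0 <= c2 -> 0 <= c3 ->
  \sum_(i < n) N i ^+ 2 <= 1 ->
  (forall y, 0 <= h y <= c0 + c1 * dot N y ^+ 2 +
     c2 * (\sum_(i < n) ecoord y i ^+ 2) + c3 * \1_S y) ->
  Ex (std_gauss n) h <= c0 + 6 * c1 + 6 * n%:R * c2 + c3 * Ex (std_gauss n) \1_S.
Proof.
move=> bh mS c00 c10 c20 c30 N1 hU; rewrite -lee_fin (ExE _ bh).
have bS : bmeas (\1_S : euclid R n -> R) by exact: bmeas_indic.
have m1 : measurable_fun [set: euclid R n] (fun y => (c1 * dot N y ^+ 2)%:E).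
  apply/measurable_EFinP; apply: measurable_funM => //; apply: measurable_funX.
  exact: measurable_dot.
have m2 : measurable_fun [set: euclid R n] (fun y => (c2 * \sum_(i < n) ecoord y i ^+ 2)%:E).
  apply/measurable_EFinP; apply: measurable_funM => //; apply: measurable_sum => i.
  by apply: measurable_funX; exact: measurable_ecoord.
have m3 : measurable_fun [set: euclid R n] (fun y => (c3 * \1_S y)%:E).
  by apply/measurable_EFinP; case: (bmeasM (bmeas_cst c3) bS).
have ss0 (y : euclid R n) : 0 <= \sum_(i < n) ecoord y i ^+ 2.
  by apply: sumr_ge0 => i _; exact: sqr_ge0.
have n1 y : (0 <= (c1 * dot N y ^+ 2)%:E)%E by rewrite lee_fin mulr_ge0 ?sqr_ge0.
have n2 (y : euclid R n) : (0 <= (c2 * \sum_(i < n) ecoord y i ^+ 2)%:E)%E.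
  by rewrite lee_fin mulr_ge0.
have n3 (y : euclid R n) : (0 <= (c3 * \1_S y)%:E)%E by rewrite lee_fin mulr_ge0.
have n0 : (0 <= c0%:E)%E by rewrite lee_fin.
apply: (@le_trans _ _ (\int[std_gauss n]_y (c0%:E + (c1 * dot N y ^+ 2)%:E +
    (c2 * \sum_(i < n) ecoord y i ^+ 2)%:E + (c3 * \1_S y)%:E))%E).
  apply: ge0_le_integral => //.
  - by move=> y _; rewrite lee_fin; case/andP: (hU y).
  - by apply/measurable_EFinP; case: bh.
  - by do 3! apply: emeasurable_funD => //.
  - by move=> y _; rewrite -!EFinD lee_fin; case/andP: (hU y).
rewrite ge0_integralD//; last 2 first.
- by move=> y _; rewrite !adde_ge0.
- by do 2! apply: emeasurable_funD => //.
rewrite ge0_integralD//; last 2 first.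
- by move=> y _; rewrite !adde_ge0.
- by apply: emeasurable_funD.
rewrite ge0_integralD// integral_cst//; have /= -> := probability_setT (std_gauss n).
rewrite mule1 !EFinD; apply: leeD; [apply: leeD; [apply: leeD => //|]|].
- under eq_integral do rewrite EFinM.
  rewrite ge0_integralZl//; last 2 first.
  + by apply/measurable_EFinP; apply: measurable_funX; exact: measurable_dot.
  + by move=> y _; rewrite lee_fin sqr_ge0.
  rewrite mulrC EFinM; apply: lee_wpmul2l; first by rewrite lee_fin.
  apply: (@le_trans _ _ (0 ^+ 2 + 6 * \sum_(i < n) N i ^+ 2)%:E).
    apply: le_trans (integral_std_gauss_dot_sqr N 0).
    by rewrite le_eqVlt; apply/orP; left; apply/eqP; apply: eq_integral => y _; rewrite add0r.
  by rewrite lee_fin expr0n add0r; lra.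
- under eq_integral do rewrite EFinM.
  rewrite ge0_integralZl//; last 2 first.
  + apply/measurable_EFinP; apply: measurable_sum => i.
    by apply: measurable_funX; exact: measurable_ecoord.
  + by move=> y _; rewrite lee_fin.
  rewrite mulrC EFinM; apply: lee_wpmul2l; first by rewrite lee_fin.
  exact: integral_std_gauss_enorm_sqr.
- by rewrite -(ExZ _ _ bS) ExE//; exact: (bmeasM (bmeas_cst c3) bS).
Qed.

(** * The truncated squared distance and its one-step growth *)

Section cutoff.
Context {R : realType} {n : nat}.
Variables (B : set (euclid R n)) (e : R).
Hypotheses (mB : measurable B) (B0 : B !=set0) (e0 : 0 < e).
Implicit Types (x y b : euclid R n).
Notation std_gauss := (@std_gauss R n).

Definition sqdist_set x : R := inf [set sqdist x b | b in B].

Definition strip : set (euclid R n) := enbhd B e `\` B.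

Definition cutoff x : R := Num.min 1 (sqdist_set x / e ^+ 2).

Let lb x : has_lbound [set sqdist x b | b in B].
Proof. by exists 0 => _ [b _ <-]; exact: sqdist_ge0. Qed.

Let ne x : [set sqdist x b | b in B] !=set0.
Proof. by case: B0 => b Bb; exists (sqdist x b), b. Qed.

Lemma sqdist_set_le x b : B b -> sqdist_set x <= sqdist x b.
Proof. by move=> Bb; apply: ge_inf => //; exists b. Qed.

Lemma sqdist_set_lt x c : sqdist_set x < c -> exists2 b, B b & sqdist x b < c.
Proof. by move=> /(inf_lt (ne x))[_ [b Bb <-] h]; exists b. Qed.

Lemma sqdist_set_ge0 x : 0 <= sqdist_set x.
Proof. by apply: lb_le_inf => // _ [b _ <-]; exact: sqdist_ge0. Qed.

Lemma measurable_sqdist_set : measurable_fun [set: euclid R n] sqdist_set.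
Proof.
move=> mD; apply: (measurability _ (RGenInftyO.measurableE R)) => //.
move=> _ [_ [c ->] <-]; rewrite setTI.
have [c0|c0] := leP c 0.
  rewrite (_ : _ @^-1` _ = set0); first exact: measurable0.
  apply/seteqP; split => x //=; rewrite in_itv/= => h.
  by have := sqdist_set_ge0 x; rewrite leNgt (lt_le_trans h).
have sc0 : 0 < Num.sqrt c by rewrite sqrtr_gt0.
rewrite (_ : _ @^-1` _ = enbhd B (Num.sqrt c)); first exact: measurable_enbhd.
apply/seteqP; split => x /=; rewrite in_itv/=.
  move=> /sqdist_set_lt[b Bb h]; apply/(enbhdP _ _ sc0); exists b => //.
  by rewrite sqr_sqrtr// ltW.
move=> /(enbhdP _ _ sc0)[b Bb]; rewrite sqr_sqrtr ?ltW// => h.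
exact: le_lt_trans (sqdist_set_le x Bb) h.
Qed.

Let e20 : 0 < e ^+ 2. Proof. by rewrite exprn_gt0. Qed.

Lemma cutoff_ge0 x : 0 <= cutoff x.
Proof. by rewrite le_min ler01/= divr_ge0 ?sqdist_set_ge0// ltW. Qed.

Lemma cutoff_le1 x : cutoff x <= 1.
Proof. by rewrite ge_min lexx. Qed.

Lemma bmeas_cutoff : bmeas cutoff.
Proof.
split; last by exists 1 => x; rewrite ger0_norm ?cutoff_ge0 ?cutoff_le1.
apply: measurable_minr => //; apply: measurable_funM => //.
exact: measurable_sqdist_set.
Qed.

Lemma measurable_strip : measurable strip.
Proof. by apply: measurableD => //; exact: measurable_enbhd. Qed.

Lemma cutoff_le x b : B b -> cutoff x <= sqdist x b / e ^+ 2.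
Proof.
move=> Bb; rewrite ge_min; apply/orP; right.
by rewrite ler_pM2r ?invr_gt0// sqdist_set_le.
Qed.

Lemma cutoff1 x : ~ enbhd B e x -> cutoff x = 1.
Proof.
move=> h; apply/le_anti; rewrite cutoff_le1/= le_min lexx/= ler_pdivlMr// mul1r.
rewrite leNgt; apply/negP => /sqdist_set_lt[b Bb xb].
by apply: h; apply/(enbhdP _ _ e0); exists b.
Qed.

Lemma sqdistxx x : sqdist x x = 0.
Proof. by apply: big1 => i _; rewrite subrr expr0n. Qed.

Lemma cutoff0 x : B x -> cutoff x = 0.
Proof.
move=> Bx; apply/le_anti; rewrite cutoff_ge0 andbT.
by rewrite (le_trans (cutoff_le x Bx))// sqdistxx mul0r.
Qed.

(* The squared distance to a fixed point is an exact quadratic polynomial, so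
   the squared distance to B has an affine upper bound with error |x' - x|^2:
   this replaces the almost everywhere differentiability of Lipschitz maps. *)
Lemma cutoff_step x (eta : R) : 0 < eta -> exists N : 'I_n -> R,
  \sum_(i < n) N i ^+ 2 <= 1 /\
  forall x', Num.max 0 (cutoff x' - cutoff x) <=
    \1_strip x * (2 / e) * `|\sum_(i < n) N i * (ecoord x' i - ecoord x i)| +
    sqdist x' x / e ^+ 2 + eta.
Proof.
move=> eta0.
have sd0 x' : 0 <= sqdist x' x / e ^+ 2 by rewrite divr_ge0 ?sqdist_ge0// ltW.
have [Bx|nBx] := pselect (B x).
  exists (fun=> 0); split; first by rewrite big1// => i _; rewrite expr0n.
  move=> x'; rewrite (cutoff0 Bx) subr0 (max_idPr (cutoff_ge0 _)).
  rewrite big1 => [|i _]; last by rewrite mul0r.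
  rewrite normr0 mulr0 add0r (le_trans (cutoff_le _ Bx))//; lra.
have [Ex|nEx] := pselect (enbhd B e x); last first.
  exists (fun=> 0); split; first by rewrite big1// => i _; rewrite expr0n.
  move=> x'; rewrite (cutoff1 nEx) (max_idPl _); last by rewrite subr_le0 cutoff_le1.
  rewrite big1 => [|i _]; last by rewrite mul0r.
  rewrite normr0 mulr0 add0r addr_ge0// ltW//.
have lt1 : sqdist_set x < e ^+ 2.
  have [b Bb h] := (enbhdP _ _ e0).1 Ex.
  exact: le_lt_trans (sqdist_set_le x Bb) h.
(* The infimum need not be attained, whence the error [eta]. The other half of the minimum makes (x
   - b) / e a vector of norm at most 1. *)
have [b Bb] : exists2 b, B b & sqdist x b < Num.min (e ^+ 2) (sqdist_set x + eta * e ^+ 2).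
  by apply: sqdist_set_lt; rewrite lt_min lt1/= ltrDl mulr_gt0.
rewrite lt_min => /andP[b1 b2].
exists (fun i => (ecoord x i - ecoord b i) / e); split.
  under eq_bigr do rewrite exprMn exprVn.
  by rewrite -mulr_suml ler_pdivrMr// mul1r ltW.
move=> x'; rewrite ge_max; apply/andP; split.
  by rewrite !addr_ge0 ?(ltW eta0)// !mulr_ge0// invr_ge0 ltW.
rewrite indicE mem_set// mul1r.
have -> : cutoff x = sqdist_set x / e ^+ 2.
  by apply/min_idPr; rewrite ler_pdivrMr// mul1r ltW.
rewrite lerBlDr (le_trans (cutoff_le x' Bb))//.
set T := \sum_(i < n) _.
have -> : sqdist x' b = sqdist x b + (2 * e * T + sqdist x' x).
  rewrite /sqdist /T mulr_sumr -!big_split/=; apply: eq_bigr => i _.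
  by field; rewrite gt_eqF.
rewrite !mulrDl.
have h1 : 2 * e * T / e ^+ 2 <= 2 / e * `|T|.
  rewrite (_ : 2 * e * T / e ^+ 2 = 2 / e * T); last by field; rewrite gt_eqF.
  by rewrite ler_wpM2l ?ler_norm// divr_ge0// ltW.
have h2 : sqdist x b / e ^+ 2 <= sqdist_set x / e ^+ 2 + eta.
  by rewrite ler_pdivrMr// mulrDl divfK ?gt_eqF// ltW.
lra.
Qed.

End cutoff.

(** * Quadratic bounds on the cosine *)

Section trigonometry.
Context {R : realType}.
Implicit Types x : R.

Lemma sin_le_id x : 0 <= x -> sin x <= x.
Proof.
rewrite le_eqVlt => /predU1P[<-|x0]; first by rewrite sin0.
have [|c cI] := @MVT R sin cos 0 x x0.
  by apply: continuous_subspaceT => y; exact: continuous_sin.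
rewrite sin0 !subr0 => ->.
by rewrite ler_piMl ?cos_le1// ltW.
Qed.

Lemma cos_ge_sqr x : 0 <= x -> 1 - x ^+ 2 / 2 <= cos x.
Proof.
move=> x0; have x20 : 0 <= x / 2 by rewrite divr_ge0.
rewrite (_ : cos x = cos ((x / 2) *+ 2)); last by congr cos; rewrite -mulr_natr; field.
rewrite cos_mulr2n cos2sin2.
suff : sin (x / 2) ^+ 2 <= (x / 2) ^+ 2 by rewrite -mulr_natr; lra.
rewrite -(real_normK (num_real (sin _))) lerXn2r ?nnegrE//.
rewrite ler_norml sin_le_id// andbT.
(* For the lower bound -x/2 <= sin (x/2): the sine is nonnegative for x/2 <= 2, and x/2 exceeds 1
   beyond. *)
have [x4|x4] := leP x 4.
  suff : 0 <= sin (x / 2) by lra.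
  rewrite le_eqVlt in x20; case/predU1P: x20 => [<-|x20]; first by rewrite sin0.
  rewrite le_eqVlt in x4; case/predU1P: x4 => [->|x4].
    rewrite (_ : 4 / 2 = 1 *+ 2); last by rewrite -mulr_natr; field.
    by rewrite sin_mulr2n mulrn_wge0// mulr_ge0// ltW ?cos1_gt0// sin2_gt0; lra.
  by rewrite ltW// sin2_gt0; lra.
by rewrite (le_trans _ (sin_geN1 _))//; lra.
Qed.

Lemma sin_ge_half x : 0 <= x <= 1 -> x / 2 <= sin x.
Proof.
move=> /andP[]; rewrite le_eqVlt => /predU1P[<-|x0] x1; first by rewrite sin0 mul0r.
have [|c cI] := @MVT R sin cos 0 x x0.
  by apply: continuous_subspaceT => y; exact: continuous_sin.
move: cI; rewrite in_itv/= => /andP[c0 cx]; rewrite sin0 !subr0 => ->.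
rewrite mulrC ler_pM2r//.
have := cos_ge_sqr (ltW c0).
have : c ^+ 2 <= 1 by rewrite expr_le1 ?ltW// (lt_le_trans cx).
lra.
Qed.

Lemma cos_le_sqr x : 0 <= x <= 1 -> cos x <= 1 - x ^+ 2 / 8.
Proof.
move=> /andP[x0 x1].
rewrite (_ : cos x = cos ((x / 2) *+ 2)); last by congr cos; rewrite -mulr_natr; field.
rewrite cos_mulr2n cos2sin2.
suff : (x / 4) ^+ 2 <= sin (x / 2) ^+ 2 by rewrite -mulr_natr; lra.
have h : x / 2 / 2 <= sin (x / 2) by apply: sin_ge_half; lra.
by rewrite lerXn2r ?nnegrE//; lra.
Qed.

End trigonometry.

Lemma max0_triangle (R : realDomainType) (u v w : R) :
  Num.max 0 (w - u) <= Num.max 0 (v - u) + Num.max 0 (w - v).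
Proof.
have max0_ge0 (t : R) : 0 <= Num.max 0 t by rewrite le_max lexx.
rewrite ge_max addr_ge0//= (_ : w - u = (v - u) + (w - v)); last by ring.
by apply: lerD; rewrite le_max lexx orbT.
Qed.

(** * Mean rise of the cutoff along a rotation *)

Section rotation.
Context {R : realType} {n : nat}.
Variables (B : set (euclid R n)) (e : R).
Hypotheses (mB : measurable B) (B0 : B !=set0) (e0 : 0 < e).
Implicit Types (x y b : euclid R n).
Notation std_gauss := (@std_gauss R n).
Notation f := (cutoff B e).
Notation S := (strip B e).

Definition cutoff_rise (c s : R) : R :=
  Ex std_gauss (fun x => Ex std_gauss (fun y => Num.max 0 (f (lincomb c s x y) - f x))).

Let bf : bmeas f. Proof. exact: bmeas_cutoff. Qed.
Let mS : measurable S. Proof. exact: measurable_strip. Qed.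

Let bD d1 d2 : bmeas (fun z : euclid R n * euclid R n =>
  Num.max 0 (f (lincomb d1 d2 z.1 z.2) - f z.1)).
Proof.
apply: bmeas_max0; apply: bmeasB; first exact: bmeas_lincomb.
by apply: (bmeas_comp bf); mfun.
Qed.

Let ss0 y : 0 <= \sum_(i < n) ecoord y i ^+ 2.
Proof. by apply: sumr_ge0 => i _; exact: sqr_ge0. Qed.

Let indic_ge0 x : 0 <= (\1_S x : R). Proof. by []. Qed.

Let indic_le1 x : (\1_S x : R) <= 1.
Proof. by rewrite indicE; case: (_ \in _). Qed.

(** Collects the dimension-dependent part of the one-step bound; it is multiplied by 1 - c, of
    second order in the angle. *)
Let K : R := (1 + 6 * n%:R) / e + 48 * n%:R / e ^+ 2.

(** The displacement is s y - (1 - c) x, and its first order part is controlled by |N . y| <= (1 +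
    (N . y)^2) / 2 with mean at most (1 + 6) / 2; the slope 2 / e turns this into 7 / e. The
    direction [N] is chosen for each x without any measurability in x: only its norm bound survives
    the integration in y. *)
Lemma cutoff_rise_le c s : c ^+ 2 + s ^+ 2 = 1 ->
  cutoff_rise c s <= 7 / e * `|s| * Ex std_gauss \1_S + K * (1 - c).
Proof.
move=> cs.
have e20 : 0 < e ^+ 2 by rewrite exprn_gt0.
have c1 : c <= 1.
  rewrite leNgt; apply/negP => c1.
  have : 1 < c ^+ 2 by rewrite exprn_egt1.
  have := sqr_ge0 s; lra.
have cN1 : -1 <= c.
  rewrite leNgt; apply/negP => c1'.
  have : 1 < (- c) ^+ 2 by rewrite exprn_egt1//; lra.
  rewrite sqrrN; have := sqr_ge0 s; lra.
have s2 : s ^+ 2 <= 2 * (1 - c).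
  have : 0 <= (1 - c) * (1 - c) by rewrite mulr_ge0; lra.
  by rewrite -expr2 (_ : s ^+ 2 = 1 - c ^+ 2); [lra|rewrite -cs; ring].
have c2 : (1 - c) ^+ 2 <= 2 * (1 - c).
  have : 0 <= (1 + c) * (1 - c) by rewrite mulr_ge0; lra.
  lra.
apply/ler_addgt0Pr => eta eta0.
have n0 : 0 <= n%:R :> R by [].
have ie0 : 0 <= e^-1 by rewrite invr_ge0 ltW.
have ie20 : 0 <= (e ^+ 2)^-1 by rewrite invr_ge0 ltW.
have c10 : 0 <= 1 - c by lra.
(* [q1] and [q0] are the coefficient of |x|^2 and the constant that remain once y has been
   integrated. *)
pose q1 := (1 - c) / e + 2 * (1 - c) ^+ 2 / e ^+ 2.
have q10 : 0 <= q1 by rewrite addr_ge0// mulr_ge0// mulr_ge0// sqr_ge0.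
pose q0 := eta + (1 - c) / e + 12 * s ^+ 2 * n%:R / e ^+ 2.
have q00 : 0 <= q0.
  apply: addr_ge0; first by apply: addr_ge0; [exact: ltW|exact: mulr_ge0].
  by do 2! apply: mulr_ge0 => //; apply: mulr_ge0 => //; exact: sqr_ge0.
have q30 : 0 <= 7 / e * `|s| by rewrite !mulr_ge0.
have := @Ex_std_gauss_quadratic_le R n (fun x => Ex std_gauss (fun y => Num.max 0 (f (lincomb c s x y) - f x)))
  (fun=> 0) S q0 0 q1 (7 / e * `|s|) (bmeas_Ex2 std_gauss (bD c s)) mS q00 (lexx 0) q10 q30.
rewrite big1 => [|i _]; last by rewrite expr0n.
move=> /(_ ler01) H; apply: le_trans (H _) _; last first.
  rewrite /q0 /q1 /K mulr0 addr0.
  have h1 : s ^+ 2 * (n%:R / e ^+ 2) <= 2 * (1 - c) * (n%:R / e ^+ 2).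
    by rewrite ler_wpM2r// mulr_ge0.
  have h2 : (1 - c) ^+ 2 * (n%:R / e ^+ 2) <= 2 * (1 - c) * (n%:R / e ^+ 2).
    by rewrite ler_wpM2r// mulr_ge0.
  set P := 7 / e * `|s| * Ex std_gauss \1_S.
  rewrite (_ : _ + P = eta + P + (1 - c) * (1 + 6 * n%:R) / e +
     12 * (s ^+ 2 * (n%:R / e ^+ 2) + (1 - c) ^+ 2 * (n%:R / e ^+ 2))); last by ring.
  rewrite (_ : _ + eta = eta + P + (1 - c) * (1 + 6 * n%:R) / e +
     12 * (2 * (1 - c) * (n%:R / e ^+ 2) + 2 * (1 - c) * (n%:R / e ^+ 2))); last by ring.
  by rewrite lerD2l ler_wpM2l// lerD.
move=> x; apply/andP; split.
  by apply: Ex_ge0 => y; rewrite le_max lexx.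
rewrite mul0r addr0.
have [N [N1 HN]] := cutoff_step B0 e0 x eta0.
set X := \sum_(i < n) ecoord x i ^+ 2.
have X0 : 0 <= X by exact: ss0.
pose d0 := \1_S x * (1 / e) * `|s| + (1 - c) * (1 + X) / e + 2 * (1 - c) ^+ 2 * X / e ^+ 2 + eta.
have d00 : 0 <= d0.
  have h1 : 0 <= \1_S x * (1 / e) * `|s| by rewrite mulr_ge0// mulr_ge0// mulr_ge0.
  have h2 : 0 <= (1 - c) * (1 + X) / e by rewrite mulr_ge0// mulr_ge0// addr_ge0.
  have h3 : 0 <= 2 * (1 - c) ^+ 2 * X / e ^+ 2.
    by rewrite mulr_ge0// mulr_ge0// mulr_ge0// sqr_ge0.
  by rewrite /d0; lra.
pose d1 := \1_S x * (1 / e) * `|s|.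
have d10 : 0 <= d1 by rewrite mulr_ge0// mulr_ge0// mulr_ge0.
pose d2 := 2 * s ^+ 2 / e ^+ 2.
have d20 : 0 <= d2 by rewrite mulr_ge0// mulr_ge0// sqr_ge0.
have := @Ex_std_gauss_quadratic_le R n (fun y => Num.max 0 (f (lincomb c s x y) - f x))
  N S d0 d1 d2 0 (bmeas_pair1 x (bD c s)) mS d00 d10 d20 (lexx 0) N1.
move=> H'; apply: le_trans (H' _) _; last first.
  rewrite /d0 /d1 /d2 /q0 /q1 mul0r.
  by rewrite le_eqVlt; apply/orP; left; apply/eqP; ring.
move=> y; rewrite le_max lexx/= mul0r addr0.
apply: le_trans (HN _) _.
set Y := \sum_(i < n) ecoord y i ^+ 2.
have -> : \sum_(i < n) N i * (ecoord (lincomb c s x y) i - ecoord x i) =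
    s * dot N y - (1 - c) * dot N x.
  rewrite /dot !mulr_sumr -sumrB; apply: eq_bigr => i _; rewrite ecoord_lincomb; ring.
have dx : `|dot N x| <= (1 + X) / 2.
  apply: le_trans (ler_norm_sum _ _ _) _.
  apply: (@le_trans _ _ (\sum_(i < n) (N i ^+ 2 + ecoord x i ^+ 2) / 2)).
    apply: ler_sum => i _; rewrite normrM -(real_normK (num_real (N i))).
    rewrite -(real_normK (num_real (ecoord x i))).
    have := sqr_ge0 (`|N i| - `|ecoord x i|); rewrite sqrrB; lra.
  by rewrite -mulr_suml big_split/= ler_pM2r// lerD2r.
have dy : `|dot N y| <= (1 + dot N y ^+ 2) / 2.
  rewrite -(real_normK (num_real (dot N y))).
  have := sqr_ge0 (`|dot N y| - 1); rewrite sqrrB; lra.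
have sq : sqdist (lincomb c s x y) x <= 2 * (1 - c) ^+ 2 * X + 2 * s ^+ 2 * Y.
  rewrite /sqdist /X /Y !mulr_sumr -big_split/=; apply: ler_sum => i _.
  rewrite ecoord_lincomb.
  have := sqr_ge0 (s * ecoord y i + (1 - c) * ecoord x i); lra.
have a1 : `|s * dot N y - (1 - c) * dot N x| <=
   `|s| * ((1 + dot N y ^+ 2) / 2) + (1 - c) * ((1 + X) / 2).
  apply: le_trans (ler_normB _ _) _; rewrite !normrM (ger0_norm c10).
  by apply: lerD; rewrite ler_wpM2l.
have a2 : sqdist (lincomb c s x y) x / e ^+ 2 <=
   2 * (1 - c) ^+ 2 * X / e ^+ 2 + 2 * s ^+ 2 * Y / e ^+ 2.
  by rewrite -mulrDl ler_wpM2r.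
have t0 : 0 <= \1_S x * (2 / e) by rewrite !mulr_ge0.
have a3 := ler_wpM2l t0 a1.
have a4 : \1_S x * (2 / e) * ((1 - c) * ((1 + X) / 2)) <= (1 - c) * (1 + X) / e.
  rewrite (_ : _ * _ = \1_S x * ((1 - c) * (1 + X) / e)); last by field; rewrite gt_eqF.
  by rewrite ler_piMl// !mulr_ge0// addr_ge0.
rewrite /d0 /d1 /d2.
have -> : \1_S x * (1 / e) * `|s| + (1 - c) * (1 + X) / e + 2 * (1 - c) ^+ 2 * X / e ^+ 2 + eta +
   \1_S x * (1 / e) * `|s| * dot N y ^+ 2 + 2 * s ^+ 2 / e ^+ 2 * Y =
   \1_S x * (2 / e) * (`|s| * ((1 + dot N y ^+ 2) / 2)) + (1 - c) * (1 + X) / e +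
   (2 * (1 - c) ^+ 2 * X / e ^+ 2 + 2 * s ^+ 2 * Y / e ^+ 2) + eta.
  by field; rewrite gt_eqF.
move: a3; rewrite mulrDr; move: a2 a4; lra.
Qed.

(* Stationarity: the pair of positions at the angles alpha and alpha + delta has
   the law of (X, cos delta X - sin delta Y). *)
Lemma cutoff_riseD alpha delta : sin alpha != 0 ->
  cutoff_rise (cos (alpha + delta)) (sin (alpha + delta)) <=
  cutoff_rise (cos alpha) (sin alpha) + cutoff_rise (cos delta) (- sin delta).
Proof.
move=> sa.
have ab := cos2Dsin2 alpha.
pose G (z : euclid R n * euclid R n) :=
  Num.max 0 (f (lincomb (cos delta) (- sin delta) z.1 z.2) - f z.1).
have bG : bmeas G by exact: bD.
pose G' (z : euclid R n * euclid R n) :=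
  G (lincomb (cos alpha) (sin alpha) z.1 z.2, lincomb (sin alpha) (- cos alpha) z.1 z.2).
have bG' : bmeas G' by apply: (bmeas_comp bG); mfun.
have E : Ex std_gauss (fun x => Ex std_gauss (fun y => G' (x, y))) =
  cutoff_rise (cos delta) (- sin delta) := Ex_std_gauss_refl ab sa bG.
rewrite -E /cutoff_rise.
rewrite -(ExD _ (bmeas_Ex2 std_gauss (bD _ _)) (bmeas_Ex2 std_gauss bG')).
apply: le_Ex; [exact: (bmeas_Ex2 std_gauss (bD _ _))| |move=> x].
  by apply: bmeasD; [exact: (bmeas_Ex2 std_gauss (bD _ _))|exact: (bmeas_Ex2 std_gauss bG')].
rewrite -(ExD _ (bmeas_pair1 x (bD _ _)) (bmeas_pair1 x bG')).
apply: le_Ex; [exact: (bmeas_pair1 x (bD _ _))| |move=> y /=].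
  by apply: bmeasD; [exact: (bmeas_pair1 x (bD _ _))|exact: (bmeas_pair1 x bG')].
rewrite /G' /G/=.
(* The reflection reverses the orientation of the plane, hence the sign of [sin delta]. *)
have -> : lincomb (cos (alpha + delta)) (sin (alpha + delta)) x y =
  lincomb (cos delta) (- sin delta) (lincomb (cos alpha) (sin alpha) x y)
     (lincomb (sin alpha) (- cos alpha) x y).
  by apply: eq_euclid => i; rewrite !ecoord_lincomb cosD sinD; ring.
exact: max0_triangle.
Qed.

(* The rotation is cut into N equal steps; the second order terms add up to O(1/N). *)
Lemma cutoff_rise_rotation theta : 0 <= theta <= 1 ->
  cutoff_rise (cos theta) (sin theta) <= 7 / e * theta * Ex std_gauss \1_S.
Proof.
move=> /andP[t0 t1].
have p0 : 0 <= Ex std_gauss \1_S by apply: Ex_ge0.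
have K0 : 0 <= K.
  by rewrite /K addr_ge0// divr_ge0 ?addr_ge0 ?mulr_ge0 ?exprn_ge0// ltW.
have ie0 : 0 <= e^-1 by rewrite invr_ge0 ltW.
have key (N : nat) : (0 < N)%N ->
   cutoff_rise (cos theta) (sin theta) <= 7 / e * theta * Ex std_gauss \1_S + (K / 2) / N%:R.
  move=> N0; have N0' : (0 : R) < N%:R by rewrite ltr0n.
  set d := theta / N%:R.
  have d0 : 0 <= d by rewrite divr_ge0// ltW.
  have dN : d * N%:R = theta by rewrite divfK// gt_eqF.
  pose M := 7 / e * d * Ex std_gauss \1_S + K * (d ^+ 2 / 2).
  have sd : `|sin d| <= d.
    rewrite ger0_norm ?sin_le_id//.
    have [->|dn0] := eqVneq d 0; first by rewrite sin0.
    rewrite ltW// sin2_gt0// lt_neqAle eq_sym dn0 d0/=.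
    by rewrite (@le_lt_trans _ _ theta)//; [rewrite -dN ler_peMr// ler1n|lra].
  (* Both signs occur: the first step has [sin d], the later ones [- sin d]. *)
  have QM s : `|s| = `|sin d| -> cutoff_rise (cos d) s <= M.
    move=> sE; have cs : cos d ^+ 2 + s ^+ 2 = 1.
      by rewrite -[s ^+ 2]real_normK ?num_real// sE real_normK ?num_real// cos2Dsin2.
    apply: le_trans (cutoff_rise_le cs) _; rewrite /M sE; apply: lerD.
      by rewrite ler_wpM2r// ler_wpM2l// mulr_ge0.
    by rewrite ler_wpM2l//; have := cos_ge_sqr d0; lra.
  have step j : (0 < j)%N -> (j <= N)%N ->
      cutoff_rise (cos (j%:R * d)) (sin (j%:R * d)) <= j%:R * M.
    elim: j => // -[|j] IH _ jN; first by rewrite !mul1r; exact: QM.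
    have := IH isT (ltnW jN) => {}IH.
    rewrite -[j.+2]addn1 natrD !mulrDl !mul1r.
    have [d00|dn0] := eqVneq d 0.
      move: IH; rewrite d00 !mulr0 addr0 => /le_trans; apply.
      by rewrite lerDl /M d00 expr0n !mul0r !(mulr0, mul0r) addr0.
    have dp : 0 < d by rewrite lt_neqAle eq_sym dn0.
    apply: le_trans (cutoff_riseD _ _) _; last first.
      by rewrite lerD// QM// normrN.
    rewrite gt_eqF// sin2_gt0// mulr_gt0//=.
    apply: (@le_lt_trans _ _ (d * N%:R)); last by rewrite dN; lra.
    by rewrite mulrC ler_wpM2l// ler_nat ltnW.
  have := step N N0 (leqnn N); rewrite (mulrC _ d) dN => /le_trans; apply.
  rewrite /M mulrDr.
  have -> : N%:R * (7 / e * d * Ex std_gauss \1_S) = 7 / e * (d * N%:R) * Ex std_gauss \1_S by ring.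
  rewrite dN lerD2l.
  have -> : N%:R * (K * (d ^+ 2 / 2)) = (K / 2 / N%:R) * theta ^+ 2.
    by rewrite /d; field; rewrite gt_eqF.
  by rewrite ler_piMr// ?expr_le1// divr_ge0// ?divr_ge0// ltW.
apply/ler_addgt0Pr => eta eta0.
pose N := (Num.bound (K / 2 / eta)).+1.
apply: le_trans (key N _) _ => //; rewrite lerD2l.
have N0 : (0 : R) < N%:R by rewrite ltr0n.
rewrite ler_pdivrMr// [leRHS]mulrC -ler_pdivrMr//.
have h : 0 <= K / 2 / eta by rewrite divr_ge0 ?divr_ge0// ltW.
rewrite ltW// (lt_le_trans (archi_boundP h))// ler_nat.
exact: leqnSn.
Qed.

End rotation.

Section lower_bound.
Context {R : realType} {n : nat}.
Notation std_gauss := (@std_gauss R n).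

(** By stationarity the left side is P(X not in A, X_t in A). On this event either X_t lies in the
    strip, or X_t is at distance at least [e] from the complement and the cutoff has risen from 0 to
    1. *)
Lemma stab_strip (A : set (euclid R n)) (e theta : R) :
  measurable A -> ~` A !=set0 -> 0 < e -> 0 < theta <= 1 ->
  Ex std_gauss \1_A - stab (cos theta) \1_A <=
  Ex std_gauss \1_(strip (~` A) e) * (1 + 7 * theta / e).
Proof.
move=> mA B0 e0 /andP[t0 t1].
have mB : measurable (~` A) by exact: measurableC.
have t01 : 0 <= theta <= 1 by rewrite ltW.
have Q := cutoff_rise_rotation mB B0 e0 t01.
set S := strip (~` A) e in Q *; set f := cutoff (~` A) e.
have bA : bmeas (\1_A : euclid R n -> R) by exact: bmeas_indic.
have bS : bmeas (\1_S : euclid R n -> R) by apply: bmeas_indic; exact: measurable_strip.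
have bf : bmeas f by exact: bmeas_cutoff.
have s0 : 0 < sin theta by rewrite sin2_gt0// t0/=; lra.
have sE : Num.sqrt (1 - cos theta ^+ 2) = sin theta.
  by rewrite -sin2cos2 sqrtr_sqr gtr0_norm.
have cs := cos2Dsin2 theta.
have sn : sin theta != 0 by rewrite gt_eqF.
rewrite -(Ex_std_gauss_comb cs sn bA) /stab /noise sE.
pose r := lincomb (n := n) (cos theta) (sin theta).
have br (g : euclid R n -> R) : bmeas g -> bmeas (fun z : euclid R n * euclid R n => g (r z.1 z.2)).
  by move=> bg; exact: bmeas_lincomb.
have b1 (g : euclid R n -> R) : bmeas g -> bmeas (fun z : euclid R n * euclid R n => g z.1).
  by move=> bg; apply: (bmeas_comp bg); mfun.
have bAA : bmeas (fun z : euclid R n * euclid R n => \1_A z.1 * \1_A (r z.1 z.2) : R).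
  by apply: bmeasM; [exact: b1|exact: br].
rewrite -(ExB _ (bmeas_Ex2 std_gauss (br _ bA))); last first.
  apply: bmeasM => //; exact: (bmeas_Ex2 std_gauss (br _ bA)).
have bL : bmeas (fun z : euclid R n * euclid R n => \1_A (r z.1 z.2) - \1_A z.1 * \1_A (r z.1 z.2) : R).
  by apply: bmeasB => //; exact: br.
have bM : bmeas (fun z : euclid R n * euclid R n => Num.max 0 (f (r z.1 z.2) - f z.1)).
  by apply: bmeas_max0; apply: bmeasB; [exact: br|exact: b1].
have bU : bmeas (fun z : euclid R n * euclid R n => \1_S (r z.1 z.2) + Num.max 0 (f (r z.1 z.2) - f z.1)).
  by apply: bmeasD => //; exact: br.
apply: (@le_trans _ _ (Ex std_gauss (fun x => Ex std_gauss (fun y =>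
    \1_A (r x y) - \1_A x * \1_A (r x y))))).
  rewrite le_eqVlt; apply/orP; left; apply/eqP; apply: eq_Ex => x.
  have bAx : bmeas (fun y => \1_A (r x y) : R) by exact: (bmeas_pair1 x (br _ bA)).
  have bAAx : bmeas (fun y => \1_A x * \1_A (r x y) : R) by exact: (bmeas_pair1 x bAA).
  by rewrite (ExB _ bAx bAAx) (ExZ _ _ bAx).
apply: (@le_trans _ _ (Ex std_gauss (fun x => Ex std_gauss (fun y =>
    \1_S (r x y) + Num.max 0 (f (r x y) - f x))))).
  apply: le_Ex; [exact: (bmeas_Ex2 std_gauss bL)|exact: (bmeas_Ex2 std_gauss bU)|move=> x].
  apply: le_Ex; [exact: (bmeas_pair1 x bL)|exact: (bmeas_pair1 x bU)|move=> y].
  set x' := r x y.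
  have m0 : 0 <= Num.max 0 (f x' - f x) by rewrite le_max lexx.
  have i0 : 0 <= (\1_S x' : R) by [].
  rewrite {1 2 3}/indic/=.
  have [Ax|nAx] := pselect (A x).
    by rewrite (mem_set Ax) mul1r subrr addr_ge0.
  rewrite (memNset nAx) mul0r subr0.
  have [Ax'|nAx'] := pselect (A x'); last by rewrite (memNset nAx') addr_ge0.
  rewrite (mem_set Ax').
  have [Sx'|nSx'] := pselect (S x').
    by rewrite indicE (mem_set Sx') lerDl.
  rewrite indicE (memNset nSx') add0r le_max; apply/orP; right.
  rewrite /f (cutoff0 B0 e0 nAx) subr0 (cutoff1 B0 e0)// => ex'.
  by apply: nSx'; split => // + ; apply.
have -> : Ex std_gauss (fun x => Ex std_gauss (fun y => \1_S (r x y) + Num.max 0 (f (r x y) - f x))) =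
   Ex std_gauss \1_S + cutoff_rise (~` A) e (cos theta) (sin theta).
  rewrite -(Ex_std_gauss_comb cs sn bS) -(ExD _ (bmeas_Ex2 std_gauss (br _ bS)) (bmeas_Ex2 std_gauss bM)).
  apply: eq_Ex => x.
  by rewrite (ExD _ (bmeas_pair1 x (br _ bS)) (bmeas_pair1 x bM)).
by rewrite mulrDr mulr1 lerD2l (le_trans Q)// le_eqVlt; apply/orP; left; apply/eqP; ring.
Qed.

End lower_bound.

(** * Lower bound on the boundary measure *)

(** The inductive step is (1 - x) (1 + (K + 1) x) <= 1 + K x. *)
Lemma onemX_bernoulli_le (R : realDomainType) (x : R) K : 0 <= x <= 1 ->
  (1 - x) ^+ K * (1 + K%:R * x) <= 1.
Proof.
move=> /andP[x0 x1]; elim: K => [|K IH]; first by rewrite expr0 mul0r addr0 mulr1.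
apply: le_trans IH; rewrite exprSr -mulrA ler_wpM2l ?exprn_ge0 ?subr_ge0//.
have K0 : 0 <= K%:R * (x * x) by rewrite !mulr_ge0.
have xx0 : 0 <= x * x by rewrite mulr_ge0.
rewrite -[K.+1]addn1 natrD; lra.
Qed.

Lemma onemX_bernoulli_ge (R : realDomainType) (x : R) K : 0 <= x <= 1 ->
  1 - K%:R * x <= (1 - x) ^+ K.
Proof.
move=> /andP[x0 x1]; elim: K => [|K IH]; first by rewrite expr0 mul0r subr0.
have h : (1 - K%:R * x) * (1 - x) <= (1 - x) ^+ K * (1 - x) by rewrite ler_wpM2r ?subr_ge0.
have K0 : 0 <= K%:R * (x * x) by rewrite !mulr_ge0.
rewrite exprSr -[K.+1]addn1 natrD; lra.
Qed.

(** Otherwise Bernoulli's inequality gives u^K > (1 - 1 / (2 K))^K >= 1/2. *)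
Lemma expr_le_half (R : realFieldType) (u : R) K : (0 < K)%N -> 0 <= u ->
  u ^+ K <= 2^-1 -> u <= 1 - (2 * K%:R)^-1.
Proof.
move=> K0 u0; apply: contraTT; rewrite -!ltNge => h.
have Kr : (1 : R) <= K%:R by rewrite ler1n.
have x0 : 0 <= (2 * K%:R)^-1 :> R by rewrite invr_ge0 mulr_ge0.
have x1 : (2 * K%:R)^-1 <= 1 :> R by rewrite invf_le1; lra.
have x01 : 0 <= ((2 : R) * K%:R)^-1 <= 1 by rewrite x0.
apply: le_lt_trans (_ : 1 - K%:R * (2 * K%:R)^-1 < _).
  by rewrite (_ : K%:R * _ = 2^-1); [lra|field; lra].
apply: le_lt_trans (@onemX_bernoulli_ge _ _ K x01) _.
by rewrite ltrXn2r -?lt0n ?subr_ge0//; lia.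
Qed.

Section lower_bound.
Context {R : realType} {n : nat}.
Notation std_gauss := (@std_gauss R n).

(* The angle is 2^(-m/2); after m + 7 squarings the correlation is at most 1/17,
   and 4 * 2^(m + 7) = 2^9 * 2^m. *)
Lemma stab_dyadic (A : set (euclid R n)) (k m : nat) :
  measurable A -> (0 < k)%N -> (2 ^ 2 ^ m <= k)%N -> Ex std_gauss \1_A = k%:R^-1 ->
  stab (cos (Num.sqrt ((2 : R) ^+ m))^-1) (\1_A : euclid R n -> R) <=
  (1 - (2 * (2 ^ 9)%:R)^-1) / k%:R.
Proof.
move=> mA k0 mk pE; set theta := (Num.sqrt _)^-1; set a := cos theta.
have kr : (0 : R) < k%:R by rewrite ltr0n.
have tm : 1 <= (2 : R) ^+ m by rewrite exprn_ege1// ler1n.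
have tm0 : 0 < (2 : R) ^+ m by rewrite exprn_gt0.
have s1 : 1 <= Num.sqrt ((2 : R) ^+ m).
  by rewrite -[leLHS]sqrtr1 ler_sqrt// ltW.
have s0 : 0 < Num.sqrt ((2 : R) ^+ m) by lra.
have t0 : 0 < theta by rewrite invr_gt0.
have t1 : theta <= 1 by rewrite invf_le1.
have t2 : theta ^+ 2 = ((2 : R) ^+ m)^-1 by rewrite exprVn sqr_sqrtr// ltW.
have t21 : theta ^+ 2 <= 1 by rewrite expr_le1// ltW.
have t20 : 0 < theta ^+ 2 by rewrite exprn_gt0.
have c1 : 1 - theta ^+ 2 / 2 <= a by apply: cos_ge_sqr; rewrite ltW.
have c2 : a <= 1 - theta ^+ 2 / 8 by apply: cos_le_sqr; rewrite ltW.
have a01 : 0 < a < 1 by apply/andP; split; lra.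
have /andP[a0 _] := a01.
have aN : (a ^+ (2 ^ (m + 7))) ^+ 2 <= 100^-1.
  have x01 : 0 <= theta ^+ 2 / 8 <= 1 by apply/andP; split; lra.
  have h := @onemX_bernoulli_le _ _ (2 ^ (m + 7))%N x01.
  have e16 : (2 ^ (m + 7))%:R * (theta ^+ 2 / 8) = 16 :> R.
    by rewrite t2 natrX exprD; field; rewrite gt_eqF.
  rewrite e16 in h.
  have h2 : a ^+ (2 ^ (m + 7)) <= (1 - theta ^+ 2 / 8) ^+ (2 ^ (m + 7)).
    by apply: lerXn2r => //; rewrite nnegrE; lra.
  have h3 : 0 <= a ^+ (2 ^ (m + 7)) by rewrite exprn_ge0// ltW.
  move: (a ^+ _) ((1 - _) ^+ _) h h2 h3 => u v h h2 h3.
  have : u ^+ 2 <= 17^-1 ^+ 2 by apply: lerXn2r; rewrite ?nnegrE; lra.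
  by lra.
pose f : euclid R n -> R := \1_A.
have bf : bmeas f by exact: bmeas_indic.
have f2 x : f x ^+ 2 = f x.
  by rewrite /f indicE; case: (_ \in _); rewrite ?expr1n ?expr0n.
have p0 : 0 < (k%:R^-1 : R) by rewrite invr_gt0.
have H := stab_le bf f2 pE a01 aN p0.
have st0 : 0 <= stab a f by apply: stab_ge0 => y; rewrite -f2 sqr_ge0.
rewrite -/f; move: (stab a f) st0 H => s st0 H.
have u0 : 0 <= s / k%:R^-1 by rewrite divr_ge0// ltW.
suff : s / k%:R^-1 <= 1 - (2 * (2 ^ 9)%:R)^-1 by rewrite invrK ler_pdivlMr.
apply: expr_le_half => //.
(* As k >= 2^(2^m), the root of order 2^m of 1/k is at most 1/2. *)
rewrite -(@ler_pXn2r _ (2 ^ m)) ?expn_gt0// ?nnegrE ?exprn_ge0//.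
rewrite -exprM (_ : (2 ^ 9 * 2 ^ m = 4 * 2 ^ (m + 7))%N); last first.
  by rewrite expnD mulnC mulnCA -[(2 ^ 9)%N]/(4 * 2 ^ 7)%N mulnCA.
apply: le_trans H _; rewrite exprVn lef_pV2 ?posrE//.
by rewrite -natrX ler_nat.
Qed.

(** The stability deficit is at least 1 / (1024 k), where 1024 = 2 * 2^9. For e <= theta the factor
    1 + 7 theta / e is at most 8 theta / e, and 8192 = 8 * 1024. *)
Lemma strip_lower (A : set (euclid R n)) (k m : nat) (e : R) :
  let theta := (Num.sqrt ((2 : R) ^+ m))^-1 in
  measurable A -> (1 < k)%N -> (2 ^ 2 ^ m <= k)%N -> gaussian A = (k%:R^-1)%:E ->
  0 < e <= theta ->
  e / (8192 * theta * k%:R) <= Ex std_gauss \1_(strip (~` A) e).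
Proof.
move=> theta mA k1 mk gA /andP[e0 et].
have k0 : (0 < k)%N by exact: ltnW.
have kr : (0 : R) < k%:R by rewrite ltr0n.
have pE : Ex std_gauss \1_A = k%:R^-1 by apply: EFin_inj; rewrite Ex_indic.
have tm : 1 <= (2 : R) ^+ m by rewrite exprn_ege1// ler1n.
have s1 : 1 <= Num.sqrt ((2 : R) ^+ m).
  by rewrite -[leLHS]sqrtr1 ler_sqrt// ltW// exprn_gt0.
have s0 : 0 < Num.sqrt ((2 : R) ^+ m) by lra.
have t0 : 0 < theta by rewrite invr_gt0.
have t1 : theta <= 1 by rewrite invf_le1.
have t01 : 0 < theta <= 1 by rewrite t0.
have An : ~` A !=set0.
  apply/set0P/negP => /eqP A0.
  have : gaussian A = 1%:E by rewrite -[A]setCK A0 setC0 gaussian_setT.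
  rewrite gA => -[kE].
  have : (1 : R) < k%:R by rewrite ltr1n.
  by rewrite -[k%:R]invrK kE invr1 ltxx.
have := stab_strip mA An e0 t01.
have := stab_dyadic mA k0 mk pE; rewrite pE -/theta.
set s := stab _ _; set p := Ex std_gauss _ => h1 h2.
have p0 : 0 <= p by exact: Ex_ge0.
have h3 : p * (1 + 7 * theta / e) <= p * (8 * theta / e).
  rewrite ler_wpM2l//.
  have : 1 <= theta / e by rewrite ler_pdivlMr// mul1r.
  lra.
have h4 : (1024 * k%:R)^-1 <= p * (8 * theta / e).
  apply: le_trans _ h3; apply: le_trans _ h2.
  have -> : (1024 * k%:R)^-1 = k%:R^-1 - (1 - 1024^-1) / k%:R :> R by field; rewrite gt_eqF.
  rewrite lerD2l lerN2; apply: le_trans h1 _.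
  apply: ler_wpM2r; first by rewrite invr_ge0 ltW.
  rewrite natrX (_ : (2 : R) * 2 ^+ 9 = 1024); last by ring.
  exact: lexx.
have h5 : 0 < 8 * theta / e by rewrite divr_gt0// mulr_gt0.
rewrite -(ler_pM2r h5); apply: le_trans h4.
by rewrite le_eqVlt; apply/orP; left; apply/eqP; field; rewrite !gt_eqF.
Qed.

End lower_bound.

(** * From strips to the boundary measure *)

Section partition_boundary.
Context {R : realType} {n k : nat}.
Variable A : 'I_k -> set (euclid R n).
Hypothesis Apart : is_partition A.

Lemma others_partition i : others A i = ~` A i.
Proof.
case: Apart => mA tA cA; apply/seteqP; split => x.
  move=> [j /= ji Ajx] Aix; move/eqP: ji; apply.
  by apply: (tA j i) => //; exists x.
move=> nAi; have : (\bigcup_i A i) x by rewrite cA.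
by move=> [j _ Ajx]; exists j => //=; apply/eqP => ji; apply: nAi; rewrite -ji.
Qed.

Lemma eboundary_partition e : eboundary A e = \bigcup_i strip (~` A i) e.
Proof. by apply: eq_bigcupr => i _; rewrite /strip others_partition. Qed.

Lemma measurable_eboundary e : 0 < e -> measurable (eboundary A e).
Proof.
case: Apart => mA _ _ e0; rewrite eboundary_partition.
apply: countable_bigcupT_measurable; first exact: countableP.
by move=> i; apply: measurable_strip => //; exact: measurableC.
Qed.

(** The strip of the complement of a part lies inside that part, so the strips are disjoint and
    their masses add up. *)
Lemma gaussian_eboundary e : 0 < e ->
  gaussian (eboundary A e) = (\sum_(i < k) Ex (std_gauss n) \1_(strip (~` A i) e))%:E.
Proof.
case: Apart => mA tA _ e0; rewrite eboundary_partition.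
have mS i : measurable (strip (~` A i) e) by apply: measurable_strip => //; exact: measurableC.
rewrite measure_fin_bigcup//=.
- rewrite (_ : [set: 'I_k] = [set` index_enum 'I_k]); last first.
    by apply/seteqP; split => i //= _; exact: mem_index_enum.
  rewrite -fsbig_seq ?index_enum_uniq// -sumEFin.
  by apply: eq_bigr => i _; rewrite (Ex_indic _ (mS _)).
- move=> i j _ _ [x [[_ Si] [_ Sj]]]; apply: (tA i j) => //.
  by exists x; split; apply: contrapT.
Qed.

End partition_boundary.

Section boundary.
Context {R : realType} {n k : nat}.
Implicit Type A : 'I_k -> set (euclid R n).

(** The lower limit is a supremum, over the sets of the filter, of infima: the interval ]0, t[ is
    one such set. The converse estimate below holds because every such set meets this interval. *)
Lemma le_boundary_measure A (t c : R) : 0 < t ->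
  (forall e, 0 < e < t ->
    ((c * (Num.sqrt (2 / pi) * e))%:E <= gaussian (eboundary A e))%E) ->
  (c%:E <= boundary_measure A)%E.
Proof.
move=> t0 H; rewrite /boundary_measure limf_einfE.
apply: le_trans (ereal_sup_ubound _); last first.
  exists `]0, t[%classic => //=.
  near=> e; rewrite /= in_itv/=; apply/andP; split; near: e.
    exact: nbhs_right_gt.
  exact: nbhs_right_lt.
apply: le_ereal_inf_tmp => _ [e + <-]; rewrite /= in_itv/= => e0t.
have /andP[e0 _] := e0t.
have s0 : 0 < Num.sqrt (2 / pi) * e :> R.
  by rewrite mulr_gt0// sqrtr_gt0 divr_gt0// pi_gt0.
by rewrite lee_pdivlMr// -EFinM H.
Unshelve. all: end_near. Qed.

Lemma boundary_measure_le A (t c : R) : 0 < t ->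
  (forall e, 0 < e < t ->
    (gaussian (eboundary A e) <= (c * (Num.sqrt (2 / pi) * e))%:E)%E) ->
  (boundary_measure A <= c%:E)%E.
Proof.
move=> t0 H; rewrite /boundary_measure limf_einfE.
apply: ge_ereal_sup => _ [V V0 <-].
have : (0 : R)^'+ (V `&` `]0, t[%classic).
  apply: filterI => //; near=> e; rewrite /= in_itv/=; apply/andP; split; near: e.
    exact: nbhs_right_gt.
  exact: nbhs_right_lt.
move=> /filter_ex[e [Ve]]; rewrite /= in_itv/= => e0t.
have /andP[e0 _] := e0t.
have s0 : 0 < Num.sqrt (2 / pi) * e :> R.
  by rewrite mulr_gt0// sqrtr_gt0 divr_gt0// pi_gt0.
apply: le_trans (_ : gaussian (eboundary A e) * ((Num.sqrt (2 / pi) * e)^-1)%:E <= _)%E.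
  by apply: ereal_inf_lbound; exists e.
by rewrite lee_pdivrMr// -EFinM H.
Unshelve. all: end_near. Qed.

End boundary.

(** Here sqrt (ln k) <= 2 / theta, so the sum e / (8192 theta) of the [k] strip bounds is at least
    sqrt (ln k) e / 16384; the normalization sqrt (2 / pi) is at most 1. *)
Lemma boundary_lower (R : realType) (n k : nat) (A : 'I_k -> set (euclid R n)) :
  (2 <= k)%N -> is_partition A -> (forall i, gaussian (A i) = (k%:R^-1)%:E) ->
  ((16384^-1 * Num.sqrt (ln k%:R))%:E <= boundary_measure A)%E.
Proof.
move=> k2 Apart gA; have [mA tA cA] := Apart.
have k0 : (0 < k)%N by lia.
have kr : (0 : R) < k%:R by rewrite ltr0n.
(* [m] is the integer with 2^(2^m) <= k < 2^(2^(m+1)), so 2^m is of order log k. *)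
pose L := trunc_log 2 k; pose m := trunc_log 2 L.
have L0 : (0 < L)%N by rewrite trunc_log_gt0.
have mk : (2 ^ 2 ^ m <= k)%N.
  apply: leq_trans _ (@trunc_logP 2 k isT k0).
  by rewrite leq_exp2l// trunc_logP.
have km : (k < 2 ^ 2 ^ m.+1)%N.
  apply: leq_trans (@trunc_log_ltn 2 k isT) _.
  by rewrite leq_exp2l// trunc_log_ltn.
pose theta : R := (Num.sqrt ((2 : R) ^+ m))^-1.
have tm0 : 0 < (2 : R) ^+ m by rewrite exprn_gt0.
have s0 : 0 < Num.sqrt ((2 : R) ^+ m) by rewrite sqrtr_gt0.
have t0 : 0 < theta by rewrite invr_gt0.
have lnk : Num.sqrt (ln k%:R) <= 2 / theta.
  rewrite /theta invrK (_ : 2 * Num.sqrt (2 ^+ m) = Num.sqrt (4 * 2 ^+ m)); last first.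
    by rewrite sqrtrM// (_ : 4 = 2 ^+ 2) ?sqrtr_sqr ?ger0_norm//; ring.
  rewrite ler_sqrt; last by rewrite mulr_ge0// ltW.
  apply: le_trans (_ : ln ((2 : R) ^+ (2 ^ m.+1)) <= _).
    by rewrite ler_ln ?posrE ?exprn_gt0// -natrX ler_nat ltnW.
  rewrite lnXn// (_ : ln 2 *+ (2 ^ m.+1) = 2 * (2 ^+ m * ln 2)); last first.
    by rewrite -[LHS]mulr_natl natrX exprS mulrA.
  have ln2 : ln 2 <= 1 :> R by have := @le_ln1Dx R 1; apply; lra.
  have : 2 ^+ m * ln 2 <= 2 ^+ m :> R by rewrite ler_piMr// ltW.
  lra.
apply: (le_boundary_measure t0) => e /andP[e0 et].
rewrite gaussian_eboundary// lee_fin.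
have e0t : 0 < e <= theta by rewrite e0 ltW.
apply: le_trans (_ : \sum_(i < k) e / (8192 * theta * k%:R) <= _); last first.
  by apply: ler_sum => i _; exact: strip_lower.
rewrite sumr_const card_ord -[leRHS]mulr_natr.
rewrite (_ : e / (8192 * theta * k%:R) * k%:R = 16384^-1 * (2 / theta) * e); last first.
  by field; rewrite !gt_eqF.
have p1 : Num.sqrt (2 / pi) <= 1 :> R.
  rewrite -[leRHS]sqrtr1 ler_sqrt// ler_pdivrMr ?pi_gt0// mul1r; exact: pi_ge2.
have sp0 : 0 <= Num.sqrt (2 / pi) :> R by [].
have ln0 : 0 <= Num.sqrt (ln k%:R) :> R by [].
rewrite [leLHS]mulrA ler_wpM2r ?(ltW e0)//.
have c0 : 0 <= 16384^-1 :> R by rewrite invr_ge0 ler0n.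
move: (Num.sqrt (2 / pi)) (Num.sqrt (ln _)) (2 / theta) (16384^-1) p1 sp0 lnk ln0 c0.
move=> p s u c p1 p0 su s0' c0.
apply: (@le_trans _ _ (c * u * p)).
  by apply: ler_wpM2r => //; exact: ler_wpM2l.
rewrite ler_piMr// mulr_ge0// (le_trans _ su)//.
Qed.

(** * The partition by largest coordinate and sign *)

Section insertion.
Context {R : realType}.
Notation std_normal := (@std_normal R).
Notation std_gauss := (@std_gauss R).

Definition insert_coord n (i : 'I_n.+1) (t : R) (y : euclid R n) : euclid R n.+1 :=
  [tuple if unlift i j is Some l then ecoord y l else t | j < n.+1].

Lemma ecoord_insert_coord n (i : 'I_n.+1) t y : ecoord (insert_coord i t y) i = t.
Proof. by rewrite /ecoord tnth_mktuple unlift_none. Qed.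

Lemma ecoord_insert_coord_lift n (i : 'I_n.+1) t (y : euclid R n) l :
  ecoord (insert_coord i t y) (lift i l) = ecoord y l.
Proof. by rewrite /ecoord tnth_mktuple liftK. Qed.

Lemma insert_coord0 n t (y : euclid R n) : insert_coord ord0 t y = econs (t, y).
Proof.
apply: eq_euclid => j; case: (unliftP ord0 j) => [l|] ->.
  by rewrite ecoord_insert_coord_lift ecoord_econsS.
by rewrite ecoord_insert_coord.
Qed.

Lemma insert_coordS n (i : 'I_n.+1) t s (y : euclid R n) :
  insert_coord (lift ord0 i) t (econs (s, y)) = econs (s, insert_coord i t y).
Proof.
apply: eq_euclid => j; case: (unliftP (lift ord0 i) j) => [l|] ->; last first.
  by rewrite ecoord_econsS !ecoord_insert_coord.
rewrite ecoord_insert_coord_lift; case: (unliftP ord0 l) => [l'|] ->.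
  have -> : lift (lift ord0 i) (lift ord0 l') = lift ord0 (lift i l').
    by apply: val_inj; rewrite /= /bump /=; lia.
  by rewrite !ecoord_econsS ecoord_insert_coord_lift.
have -> : lift (lift ord0 i) ord0 = ord0 by exact: val_inj.
by [].
Qed.

Lemma measurable_insert_coord d (T : measurableType d) n (i : 'I_n.+1)
    (f : T -> measurableTypeR R) (g : T -> euclid R n) :
  measurable_fun [set: T] f -> measurable_fun [set: T] g ->
  measurable_fun [set: T] (fun x => insert_coord i (f x) (g x)).
Proof.
move=> mf mg; apply/measurable_fun_tnthP => j.
case: (unliftP i j) => [l|] jE.
  have -> : (@tnth n.+1 (measurableTypeR R)) ^~ j \o (fun x => insert_coord i (f x) (g x)) =
      fun x => ecoord (g x) l.
    by apply/funext => x /=; rewrite -(ecoord_insert_coord_lift i (f x)) -jE.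
  exact: measurableT_comp (measurable_ecoord l) _.
have -> : (@tnth n.+1 (measurableTypeR R)) ^~ j \o (fun x => insert_coord i (f x) (g x)) = f.
  by apply/funext => x /=; rewrite -[RHS](ecoord_insert_coord i (f x) (g x)) -jE.
by [].
Qed.

(** For i > 0 the first coordinate is split off, the induction hypothesis inserts behind it, and
    Fubini brings the inserted variable to the front. *)
Lemma Ex_insert_coord n (i : 'I_n.+1) (f : euclid R n.+1 -> R) : bmeas f ->
  Ex (std_gauss n.+1) f = Ex std_normal (fun t => Ex (std_gauss n) (fun y => f (insert_coord i t y))).
Proof.
elim: n i f => [|n IH] i f bf.
  by rewrite (ord1 i) (Ex_std_gaussS bf); apply: eq_Ex => t; apply: eq_Ex => y; rewrite insert_coord0.
case: (unliftP ord0 i) => [i'|] ->; last first.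
  by rewrite (Ex_std_gaussS bf); apply: eq_Ex => t; apply: eq_Ex => y; rewrite insert_coord0.
rewrite (Ex_std_gaussS bf).
have bF : bmeas (fun w : measurableTypeR R * measurableTypeR R * euclid R n =>
    f (econs (w.1.1, insert_coord i' w.1.2 w.2))).
  apply: (bmeas_comp bf); apply: measurable_econs2; first by mfun.
  by apply: measurable_insert_coord; mfun.
transitivity (Ex std_normal (fun s => Ex std_normal (fun t => Ex (std_gauss n) (fun y =>
    f (econs (s, insert_coord i' t y)))))).
  by apply: eq_Ex => s; apply: IH; exact: (bmeas_pair1 s (bmeas_econs bf)).
apply: etrans (Ex_fubini std_normal std_normal (bmeas_Ex2 (std_gauss n) bF)) _.
apply: eq_Ex => t; rewrite Ex_std_gaussS; last first.
  by apply: (bmeas_comp bf); apply: measurable_insert_coord; mfun.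
by apply: eq_Ex => s; apply: eq_Ex => y; rewrite insert_coordS.
Qed.

Lemma Ex_std_normalN (f : measurableTypeR R -> R) : bmeas f ->
  Ex std_normal (fun t => f (- t)) = Ex std_normal f.
Proof.
move=> bf.
have ab : (0 : R) ^+ 2 + (-1) ^+ 2 = 1 by rewrite expr0n sqrrN expr1n add0r.
have b0 : (-1 : R) != 0 by rewrite oppr_eq0 oner_eq0.
have bF : bmeas (fun z : measurableTypeR R * measurableTypeR R => f z.1).
  by apply: (bmeas_comp bf); mfun.
transitivity (Ex std_normal (fun x => Ex std_normal (fun y => f (0 * x + -1 * y)))).
  rewrite -[LHS](Ex_cst std_normal); apply: eq_Ex => x; apply: eq_Ex => y.
  by rewrite mul0r add0r mulN1r.
apply: etrans (Ex_std_normal_refl ab b0 bF) _.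
by apply: eq_Ex => x; exact: (Ex_cst std_normal (f x)).
Qed.

End insertion.

(** * One-dimensional shells and tails *)

Section normal_bounds.
Context {R : realType}.
Notation std_normal := (@std_normal R).
Notation mu := (@lebesgue_measure R).
Implicit Types m t e : R.

Lemma std_normal_pdf_le m t : 0 <= m -> m <= `|t| -> std_normal_pdf t <= std_normal_pdf m.
Proof.
move=> m0 mt; rewrite !std_normal_pdfE ler_wpM2l ?invr_ge0// ler_expR lerN2 ler_pM2r//.
by rewrite -[leRHS]real_normK ?num_real// lerXn2r ?nnegrE.
Qed.

Lemma measurable_shell m e : measurable [set t : measurableTypeR R | m <= `|t| <= m + e].
Proof.
have mn : measurable_fun [set: measurableTypeR R] (fun t : measurableTypeR R => `|t|).
  exact: normr_measurable.
rewrite (_ : [set t | _] = (fun t : measurableTypeR R => `|t|) @^-1` `[m, m + e]%classic).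
  by rewrite -[X in measurable X]setTI; apply: mn.
by apply/seteqP; split => t /=; rewrite in_itv.
Qed.

Lemma Ex_std_normal_indic (A : set (measurableTypeR R)) : measurable A ->
  (Ex std_normal \1_A)%:E = (\int[mu]_t ((\1_A t)%:E * (std_normal_pdf t)%:E))%E.
Proof.
move=> mA; rewrite ExE; last exact: bmeas_indic.
rewrite ge0_integral_std_normal//; apply/measurable_EFinP; exact: measurable_indic.
Qed.

Lemma Ex_shell_le m e : 0 <= m -> 0 < e ->
  Ex std_normal \1_[set t | m <= `|t| <= m + e] <= 2 * e * std_normal_pdf m.
Proof.
move=> m0 e0; set A := [set t | _].
have mA : measurable (A : set (measurableTypeR R)) by exact: measurable_shell.
rewrite -lee_fin Ex_std_normal_indic//.
have mI (a b : R) : measurable (`[a, b]%classic : set (measurableTypeR R)) by exact: measurable_itv.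
pose I1 : set (measurableTypeR R) := `[m, m + e]%classic.
pose I2 : set (measurableTypeR R) := `[- (m + e), - m]%classic.
have mI1 : measurable I1 by exact: mI.
have mI2 : measurable I2 by exact: mI.
have mE (I : set (measurableTypeR R)) : measurable I ->
    measurable_fun [set: measurableTypeR R] (fun t => (\1_I t : R)%:E).
  by move=> mI'; apply/measurable_EFinP; exact: measurable_indic.
apply: (@le_trans _ _ (\int[mu]_t ((std_normal_pdf m)%:E * ((\1_I1 t)%:E + (\1_I2 t)%:E)))%E).
  apply: ge0_le_integral => //.
  - by move=> t _; rewrite mule_ge0// lee_fin std_normal_pdf_ge0.
  - apply: emeasurable_funM; first exact: mE.
    by apply/measurable_EFinP; exact: measurable_std_normal_pdf.
  - by apply: emeasurable_funM => //; apply: emeasurable_funD; exact: mE.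
  - move=> t _; rewrite -EFinD -!EFinM lee_fin.
    have [At|nAt] := pselect (A t); last first.
      by rewrite (indicE _ A) (memNset nAt) mul0r mulr_ge0 ?std_normal_pdf_ge0// addr_ge0.
    rewrite (indicE _ A) (mem_set At) mul1r.
    have /andP[A1 A2] := At.
    apply: le_trans (std_normal_pdf_le m0 A1) _; rewrite ler_peMr ?std_normal_pdf_ge0//.
    have [t0|t0] := leP 0 t.
      have : I1 t by move: A1 A2; rewrite /I1/= in_itv/= ger0_norm// => -> ->.
      by move=> /mem_set It; rewrite (indicE _ I1) It lerDl.
    have : I2 t.
      by move: A1 A2; rewrite /I2/= in_itv/= ltr0_norm// => h1 h2; apply/andP; split; lra.
    by move=> /mem_set It; rewrite (indicE _ I2) It lerDr.
rewrite ge0_integralZl//; last 3 first.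
- by apply: emeasurable_funD; exact: mE.
- by move=> t _; rewrite adde_ge0.
- by rewrite lee_fin std_normal_pdf_ge0.
rewrite ge0_integralD//; [|exact: mE|exact: mE].
rewrite !integral_indic// !setIT /I1 /I2 /= !lebesgue_measure_itv/= !lte_fin.
rewrite ltrDl e0 ltrN2 ltrDl e0 -!EFinD -EFinM lee_fin.
by rewrite le_eqVlt; apply/orP; left; apply/eqP; ring.
Qed.

(** The tail contains an interval of length s = 1 / (1 + m), along which the density drops by at
    most the factor exp (m s + s^2 / 2) <= exp (3/2). *)
Lemma std_normal_pdf_le_tail m : 0 <= m ->
  std_normal_pdf m <= expR (3 / 2) * (1 + m) * Ex std_normal \1_[set t | m < t].
Proof.
move=> m0; set A := [set t | _].
have mA : measurable (A : set (measurableTypeR R)).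
  rewrite (_ : A = `]m, +oo[%classic); first exact: measurable_itv.
  by apply/seteqP; split => t /=; rewrite in_itv/= andbT.
have m1 : 0 < 1 + m by lra.
pose s := (1 + m)^-1.
have s0 : 0 < s by rewrite invr_gt0.
pose I : set (measurableTypeR R) := `]m, m + s]%classic.
have mI : measurable I by exact: measurable_itv.
have mE (J : set (measurableTypeR R)) : measurable J ->
    measurable_fun [set: measurableTypeR R] (fun t => (\1_J t : R)%:E).
  by move=> mI'; apply/measurable_EFinP; exact: measurable_indic.
have key : std_normal_pdf (m + s) * s <= Ex std_normal \1_A.
  rewrite -lee_fin Ex_std_normal_indic//.
  apply: (@le_trans _ _ (\int[mu]_t ((std_normal_pdf (m + s))%:E * (\1_I t)%:E))%E).
    rewrite ge0_integralZl//; [|exact: mE|by rewrite lee_fin std_normal_pdf_ge0].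
    rewrite integral_indic// setIT /I /= lebesgue_measure_itv/= lte_fin ltrDl s0.
    by rewrite -EFinD -EFinM lee_fin addrAC subrr add0r.
  apply: ge0_le_integral => //.
  - by move=> t _; rewrite mule_ge0// lee_fin std_normal_pdf_ge0.
  - by apply: emeasurable_funM => //; exact: mE.
  - apply: emeasurable_funM; first exact: mE.
    by apply/measurable_EFinP; exact: measurable_std_normal_pdf.
  - move=> t _; rewrite -!EFinM lee_fin.
    have [It|nIt] := pselect (I t); last first.
      by rewrite (indicE _ I) (memNset nIt) mulr0 mulr_ge0 ?std_normal_pdf_ge0.
    rewrite (indicE _ I) (mem_set It) mulr1.
    move: (It); rewrite /I/= in_itv/= => /andP[h1 h2].
    have At : A t by [].
    rewrite (indicE _ A) (mem_set At) mul1r !std_normal_pdfE ler_wpM2l ?invr_ge0//.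
    by rewrite ler_expR lerN2 ler_pM2r// lerXn2r ?nnegrE//; lra.
have h : std_normal_pdf m <= expR (3 / 2) * std_normal_pdf (m + s).
  rewrite !std_normal_pdfE mulrCA ler_wpM2l ?invr_ge0// -expRD ler_expR.
  have ms : m * s <= 1 by rewrite ler_pdivrMr//; lra.
  have s1 : s <= 1 by rewrite invf_le1//; lra.
  have s2 : s ^+ 2 <= 1 by rewrite expr_le1 // ltW.
  lra.
apply: le_trans h _; rewrite -mulrA ler_wpM2l ?expR_ge0//.
by rewrite -ler_pdivrMl// mulrC.
Qed.

(** The coefficient of the tail no longer depends on [m], so the bound can be averaged over a random
    [m]. Below [T] the tail bound applies, above [T] the density is monotone. *)
Lemma std_normal_pdf_le_interp m T : 0 <= m -> 0 <= T ->
  std_normal_pdf m <= std_normal_pdf T + expR (3 / 2) * (1 + T) * Ex std_normal \1_[set t | m < t].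
Proof.
move=> m0 T0.
have E0 : 0 <= Ex std_normal \1_[set t | m < t] by exact: Ex_ge0.
have C0 : 0 <= expR (3 / 2) :> R by exact: expR_ge0.
have [mT|Tm] := leP m T.
  apply: le_trans (std_normal_pdf_le_tail m0) _.
  have h : expR (3 / 2) * (1 + m) * Ex std_normal \1_[set t | m < t] <=
     expR (3 / 2) * (1 + T) * Ex std_normal \1_[set t | m < t].
    by rewrite ler_wpM2r// ler_wpM2l// lerD2l.
  by have := std_normal_pdf_ge0 T; lra.
apply: (@le_trans _ _ (std_normal_pdf T)); first by rewrite std_normal_pdf_le// ger0_norm// ltW.
by rewrite lerDl !mulr_ge0// addr_ge0.
Qed.

End normal_bounds.

Lemma measurable_bigmax d (T : measurableType d) (R : realType) (I : Type)
    (r : seq I) (P : pred I) (F : I -> T -> R) (x0 : R) :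
  (forall i, measurable_fun [set: T] (F i)) ->
  measurable_fun [set: T] (fun x => \big[Num.max/x0]_(i <- r | P i) F i x).
Proof.
move=> mF; elim: r => [|i r IH].
  under eq_fun do rewrite big_nil.
  exact: measurable_cst.
under eq_fun do rewrite big_cons.
by case: (P i); [exact: measurable_maxr|exact: IH].
Qed.

Lemma bmeas_sum d (T : measurableType d) (R : realType) (I : Type)
    (r : seq I) (F : I -> T -> R) : (forall i, bmeas (F i)) ->
  bmeas (fun x => \sum_(i <- r) F i x).
Proof.
move=> bF; elim: r => [|i r IH].
  under eq_fun do rewrite big_nil.
  exact: bmeas_cst.
under eq_fun do rewrite big_cons.
exact: bmeasD.
Qed.

Lemma Ex_sum d (T : measurableType d) (R : realType) (P : probability T R) (I : Type)
    (r : seq I) (F : I -> T -> R) : (forall i, bmeas (F i)) ->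
  Ex P (fun x => \sum_(i <- r) F i x) = \sum_(i <- r) Ex P (F i).
Proof.
move=> bF; elim: r => [|i r IH].
  under eq_fun do rewrite big_nil.
  by rewrite Ex_cst big_nil.
under eq_fun do rewrite big_cons.
by rewrite (ExD _ (bF i) (bmeas_sum r bF)) IH big_cons.
Qed.

Lemma indic_bool (R : realType) (T : Type) (b : T -> bool) x :
  (\1_[set x | b x] x : R) = (b x)%:R.
Proof.
rewrite indicE; case: (boolP (b x)) => bx; first by rewrite mem_set.
by rewrite memNset//=; exact/negP.
Qed.

(** * Cells where one signed coordinate dominates, and their boundary shells *)

Section cells.
Context {R : realType} {n : nat}.
Notation std_normal := (@std_normal R).
Notation std_gauss := (@std_gauss R).
Implicit Types (k : nat) (i j : 'I_n.+1) (x : euclid R n.+1) (y : euclid R n).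

Definition othermax k i x : R :=
  \big[Num.max/0]_(j < n.+1 | (j != i) && (j < k)%N) `|ecoord x j|.

Definition restmax k y : R := \big[Num.max/0]_(l < n | (l < k)%N) `|ecoord y l|.

Definition cell k i (s : R) : set (euclid R n.+1) :=
  [set x | othermax k i x < s * ecoord x i].

Definition shell k i (e : R) : set (euclid R n.+1) :=
  [set x | othermax k i x <= `|ecoord x i| <= othermax k i x + e].

Lemma othermax_ge0 k i x : 0 <= othermax k i x.
Proof. exact: bigmax_ge_id. Qed.

Lemma restmax_ge0 k y : 0 <= restmax k y.
Proof. exact: bigmax_ge_id. Qed.

Lemma othermax_ge k i j x : j != i -> (j < k)%N -> `|ecoord x j| <= othermax k i x.
Proof. by move=> ji jk; apply: (le_bigmax_cond _ (fun j => `|ecoord x j|)); rewrite ji. Qed.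

Lemma othermax_le k i x c : 0 <= c ->
  (forall j, j != i -> (j < k)%N -> `|ecoord x j| <= c) -> othermax k i x <= c.
Proof. by move=> c0 H; apply: bigmax_le => // j /andP[]; exact: H. Qed.

(** Removing one of the first [k] coordinates leaves the first [k.-1] of the remaining vector. The
    default 0 of the maxima is harmless since absolute values are nonnegative. *)
Lemma othermax_insert_coord k i t y : (i < k)%N -> othermax k i (insert_coord i t y) = restmax k.-1 y.
Proof.
move=> ik; apply/le_anti/andP; split.
  apply: othermax_le => [|j ji jk]; first exact: restmax_ge0.
  case: (unliftP i j) => [l|] jE; last by rewrite jE eqxx in ji.
  rewrite jE ecoord_insert_coord_lift; apply: (le_bigmax_cond _ (fun l => `|ecoord y l|)).
  by move: jk; rewrite jE /= /bump; lia.
apply: bigmax_le => [|l lk]; first exact: othermax_ge0.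
rewrite -(ecoord_insert_coord_lift i t); apply: othermax_ge.
  by rewrite eq_sym neq_lift.
by rewrite /= /bump; lia.
Qed.

Lemma measurable_othermax k i : measurable_fun [set: euclid R n.+1] (othermax k i).
Proof.
apply: measurable_bigmax => j; apply: measurableT_comp => //.
exact: measurable_ecoord.
Qed.

Lemma measurable_cell k i s : measurable (cell k i s).
Proof.
have mf : measurable_fun [set: euclid R n.+1] (fun x => s * ecoord x i - othermax k i x).
  apply: measurable_funB; last exact: measurable_othermax.
  by apply: measurable_funM => //; exact: measurable_ecoord.
rewrite (_ : cell k i s = (fun x => s * ecoord x i - othermax k i x) @^-1` `]0, +oo[%classic).
  by rewrite -[X in measurable X]setTI; exact: mf.
by apply/seteqP; split => x; rewrite /cell /= in_itv/= andbT subr_gt0.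
Qed.

Lemma measurable_shell_set k i e : measurable (shell k i e).
Proof.
have mf : measurable_fun [set: euclid R n.+1] (fun x => `|ecoord x i| - othermax k i x).
  apply: measurable_funB; last exact: measurable_othermax.
  by apply: measurableT_comp => //; exact: measurable_ecoord.
rewrite (_ : shell k i e = (fun x => `|ecoord x i| - othermax k i x) @^-1` `[0, e]%classic).
  by rewrite -[X in measurable X]setTI; exact: mf.
apply/seteqP; split => x; rewrite /shell /= in_itv/= subr_ge0 => /andP[h1 h2];
  by apply/andP; split; lra.
Qed.

Definition tail k t : R := Ex (std_gauss n) (fun y => (restmax k y < t)%R%:R).

Definition cell_mass k : R := Ex std_normal (tail k).

Let bmeas_rest k : (0 < k)%N ->
  bmeas (fun z : measurableTypeR R * euclid R n => (restmax k.-1 z.2 < z.1)%R%:R : R).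
Proof.
move=> k0; have bc := bmeas_indic (R := R) (measurable_cell k ord0 1).
have bz : bmeas (fun z : measurableTypeR R * euclid R n => \1_(cell k ord0 1) (insert_coord ord0 z.1 z.2) : R).
  by apply: (bmeas_comp bc); apply: measurable_insert_coord; mfun.
rewrite (_ : (fun z => _) = (fun z : measurableTypeR R * euclid R n =>
   \1_(cell k ord0 1) (insert_coord ord0 z.1 z.2) : R))//.
apply/funext => -[t y] /=; rewrite /cell.
by rewrite (indic_bool _ (fun x => othermax k ord0 x < 1 * ecoord x ord0)) othermax_insert_coord// ecoord_insert_coord mul1r.
Qed.

Lemma bmeas_tail k : (0 < k)%N -> bmeas (tail k.-1).
Proof. by move=> k0; exact: (bmeas_Ex2 (std_gauss n) (bmeas_rest k0)). Qed.

(** The coordinate [i] can be integrated separately whatever its position, and the symmetry of the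
    normal law removes the sign. *)
Lemma Ex_cell k i (b : bool) : (i < k)%N ->
  Ex (std_gauss n.+1) \1_(cell k i ((-1) ^+ b)) = cell_mass k.-1.
Proof.
move=> ik; have k0 : (0 < k)%N by exact: leq_ltn_trans ik.
have bc := bmeas_indic (R := R) (measurable_cell k i ((-1) ^+ b)).
rewrite (Ex_insert_coord i bc).
transitivity (Ex std_normal (fun t => tail k.-1 ((-1) ^+ b * t))).
  apply: eq_Ex => t; apply: eq_Ex => y; rewrite /cell.
  rewrite (indic_bool _ (fun x => othermax k i x < (-1) ^+ b * ecoord x i)).
  by rewrite othermax_insert_coord// ecoord_insert_coord.
case: b {bc}.
  rewrite -[RHS](Ex_std_normalN (bmeas_tail k0)); apply: eq_Ex => t.
  by rewrite expr1 mulN1r.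
by apply: eq_Ex => t; rewrite expr0 mul1r.
Qed.

(** At fixed other coordinates, of maximum M, the shell has mass at most 2 e phi(M), and phi(M) is
    bounded by an affine function of P(g > M). Averaging over the other coordinates turns P(g > M)
    into the mass of a cell. *)
Lemma Ex_shell_set_le k i e T : (i < k)%N -> 0 < e -> 0 <= T ->
  Ex (std_gauss n.+1) \1_(shell k i e) <=
  2 * e * (std_normal_pdf T + expR (3 / 2) * (1 + T) * cell_mass k.-1).
Proof.
move=> ik e0 T0; have k0 : (0 < k)%N by exact: leq_ltn_trans ik.
have bs := bmeas_indic (R := R) (measurable_shell_set k i e).
rewrite (Ex_insert_coord i bs).
have bz : bmeas (fun z : measurableTypeR R * euclid R n => \1_(shell k i e) (insert_coord i z.1 z.2) : R).
  by apply: (bmeas_comp bs); apply: measurable_insert_coord; mfun.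
apply: le_trans (_ : Ex (std_gauss n) (fun y => Ex std_normal (fun t => \1_(shell k i e) (insert_coord i t y))) <= _).
  by rewrite le_eqVlt; apply/orP; left; apply/eqP; exact: (Ex_fubini std_normal (std_gauss n) bz).
have br := bmeas_rest k0.
set C := expR (3 / 2) * (1 + T).
pose h y := Ex std_normal (fun t => (restmax k.-1 y < t)%R%:R : R).
have bh : bmeas h by exact: (bmeas_Ex1 std_normal br).
have Eh : Ex (std_gauss n) h = cell_mass k.-1 by exact: esym (Ex_fubini std_normal (std_gauss n) br).
have -> : 2 * e * (std_normal_pdf T + C * cell_mass k.-1) =
    Ex (std_gauss n) (fun y => 2 * e * std_normal_pdf T + 2 * e * C * h y).
  rewrite ExD; [|exact: bmeas_cst|by apply: bmeasM => //; exact: bmeas_cst].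
  by rewrite Ex_cst (ExZ _ _ bh) Eh; ring.
apply: le_Ex; first exact: (bmeas_Ex1 std_normal bz).
  by apply: bmeasD; [exact: bmeas_cst|apply: bmeasM => //; exact: bmeas_cst].
move=> y.
have -> : Ex std_normal (fun t => \1_(shell k i e) (insert_coord i t y)) =
    Ex std_normal \1_[set t | restmax k.-1 y <= `|t| <= restmax k.-1 y + e].
  apply: eq_Ex => t; rewrite /shell.
  rewrite (indic_bool _ (fun x => othermax k i x <= `|ecoord x i| <= othermax k i x + e)).
  by rewrite othermax_insert_coord// ecoord_insert_coord -(indic_bool R (fun t => restmax k.-1 y <= `|t| <= restmax k.-1 y + e)).
have m0 := restmax_ge0 k.-1 y.
apply: le_trans (Ex_shell_le m0 e0) _.
have e2 : 0 <= 2 * e by rewrite mulr_ge0// ltW.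
have hE : h y = Ex std_normal \1_[set t | restmax k.-1 y < t].
  by apply: eq_Ex => t; rewrite -(indic_bool R (fun t => restmax k.-1 y < t)).
rewrite [leRHS](_ : _ = 2 * e * (std_normal_pdf T + C * h y)); last by ring.
rewrite ler_wpM2l// hE.
exact: std_normal_pdf_le_interp.
Qed.

End cells.

(** * The partition of the space and its boundary *)

Section cube_partition.
Context {R : realType} {n k : nat}.
Hypotheses (k1 : (1 < k)%N) (kn : (k <= n.+1)%N).
Notation std_gauss := (@std_gauss R n.+1).
Implicit Types (i : 'I_k) (j : 'I_(2 * k)) (x : euclid R n.+1).
Notation w := (widen_ord kn).

Let k0 : (0 < k)%N. Proof. exact: ltnW. Qed.

Let idx_subproof j : (j./2 < k)%N.
Proof. by have := ltn_ord j; lia. Qed.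

Definition idx j : 'I_k := Ordinal (idx_subproof j).

(** The open cone over a facet of the cube in the first [k] coordinates, the others being free; the
    index 2 i + b codes the coordinate i and the sign (-1)^b. *)
Definition facet j : set (euclid R n.+1) := cell k (w (idx j)) ((-1) ^+ odd j).

Let label_subproof i (b : bool) : (i.*2 + b < 2 * k)%N.
Proof. by have := ltn_ord i; case: b; lia. Qed.

Lemma facet_of i x : othermax k (w i) x < `|ecoord x (w i)| ->
  exists2 j, idx j = i & (-1) ^+ odd j * ecoord x (w i) = `|ecoord x (w i)|.
Proof.
move=> h; pose b := ecoord x (w i) < 0.
exists (Ordinal (label_subproof i b)).
  by apply: val_inj => /=; case: b; lia.
rewrite /= oddD odd_double /= oddb /b; case: ltP => x0.
  by rewrite expr1 mulN1r ltr0_norm.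
by rewrite expr0 mul1r ger0_norm.
Qed.

Lemma facet_abs j x : facet j x ->
  ecoord x (w (idx j)) != 0 /\
  (-1) ^+ odd j * ecoord x (w (idx j)) = `|ecoord x (w (idx j))|.
Proof.
rewrite /facet /cell/=; set t := ecoord x _ => h.
have p : 0 < (-1) ^+ odd j * t by rewrite (le_lt_trans (othermax_ge0 k (w (idx j)) x)).
have t0 : t != 0 by apply: contraTneq p => ->; rewrite mulr0 ltxx.
split => //; case: (odd j) p; first by rewrite expr1 mulN1r oppr_gt0 => /ltr0_norm.
by rewrite expr0 mul1r => /gtr0_norm.
Qed.

Lemma facet_inj j j' x : facet j x -> facet j' x -> j = j'.
Proof.
move=> fj fj'; have [t0 tE] := facet_abs fj; have [t0' tE'] := facet_abs fj'.
have ij : idx j = idx j'.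
  apply/eqP; apply: contraT => ij.
  have wij : w (idx j') != w (idx j).
    by apply: contra ij => /eqP/(congr1 val) /= h; apply/eqP/val_inj.
  have wij' : w (idx j) != w (idx j') by rewrite eq_sym.
  have lt1 := fj; have lt2 := fj'; rewrite /facet /cell /= tE in lt1.
  rewrite /facet /cell /= tE' in lt2.
  have le1 := othermax_ge x wij (ltn_ord (idx j')).
  have le2 := othermax_ge x wij' (ltn_ord (idx j)).
  by have := lt_trans (le_lt_trans le1 lt1) (le_lt_trans le2 lt2); rewrite ltxx.
have oj : odd j = odd j'.
  move: tE tE' t0; rewrite -ij => tE tE' t0.
  by apply: (@signr_inj R); apply: (mulIf t0); rewrite tE tE'.
apply: val_inj => /=; rewrite -(odd_double_half j) -(odd_double_half j') oj.
by have /(congr1 val) /= -> := ij.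
Qed.

Lemma exists_argmax x : exists i, othermax k (w i) x <= `|ecoord x (w i)|.
Proof.
case: (@arg_maxP _ R 'I_k (Ordinal k0) xpredT (fun i => `|ecoord x (w i)|)) => // i _ H.
exists i; apply: othermax_le => // j _ jk.
have -> : j = w (Ordinal jk) by exact: val_inj.
exact: H.
Qed.

Definition base_facet : 'I_(2 * k) := Ordinal (label_subproof (Ordinal k0) false).

(* The part [base_facet] also receives the ties, a null set. *)
Definition cube_part j : set (euclid R n.+1) :=
  if j == base_facet then ~` \bigcup_(j in [set j | j != base_facet]) facet j else facet j.

Lemma facet_sub j : facet j `<=` cube_part j.
Proof.
rewrite /cube_part; case: eqP => [->|_]; last exact: subset_refl.
move=> x fx [j1 /= jj0 fj1].
by move: jj0; rewrite (facet_inj fj1 fx) eqxx.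
Qed.

Lemma measurable_facet j : measurable (facet j).
Proof. exact: measurable_cell. Qed.

Lemma cube_partP : is_partition cube_part.
Proof.
split.
- move=> j; rewrite /cube_part; case: ifP => _; last exact: measurable_facet.
  apply: measurableC.
  rewrite bigcup_mkcond; apply: countable_bigcupT_measurable; first exact: countableP.
  by move=> i; case: ifP => _; [exact: measurable_facet|exact: measurable0].
- move=> j j' _ _ [x []]; rewrite /cube_part.
  case: eqP => [->|/eqP jj0]; case: eqP => [->|/eqP j'j0] //.
  + by move=> h f; case: h; exists j'.
  + by move=> f h; case: h; exists j.
  + exact: facet_inj.
- apply/seteqP; split => // x _.
  have [[j /= jj0 fj]|h] := pselect ((\bigcup_(j in [set j | j != base_facet]) facet j) x).
    by exists j => //; exact: facet_sub.
  by exists base_facet => //; rewrite /cube_part eqxx.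
Qed.

(** If the largest coordinate leads by more than 2 e, a move shorter than [e] lowers it by less than
    [e] and raises the others by less than [e], so the whole [e]-ball stays in the same facet. *)
Lemma eboundary_cube_part e : 0 < e ->
  eboundary cube_part e `<=` \bigcup_i shell k (w i) (2 * e).
Proof.
move=> e0 x [j1 _ [nx ox]].
have [i ile] := exists_argmax x.
exists i => //; rewrite /shell/= ile/= leNgt; apply/negP => lt.
have lt' : othermax k (w i) x < `|ecoord x (w i)|.
  by apply: lt_trans lt; rewrite ltrDl mulr_gt0.
have [j ji jx] := facet_of lt'.
have fx : facet j x by rewrite /facet /cell /= ji jx.
have Ax := facet_sub fx.
have jj1 : j1 = j.
  apply/eqP; apply: contraT => h; case: ox; exists j => //=.
  by rewrite eq_sym.
move: nx; rewrite jj1 => /(enbhdP _ _ e0)[b [j2 /= j2j Ab] xb].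
have [_ tI _] := cube_partP.
have cb l : `|ecoord x l - ecoord b l| < e.
  rewrite -(@ltr_pXn2r _ 2) ?nnegrE ?(ltW e0)// real_normK ?num_real//.
  apply: le_lt_trans xb; rewrite /sqdist (bigD1 l)//= lerDl.
  by apply: sumr_ge0 => l' _; exact: sqr_ge0.
suff fb : facet j b.
  move/eqP: j2j; apply; apply: (tI j2 j) => //.
  by exists b; split => //; exact: facet_sub.
rewrite /facet /cell /= ji.
have M0 := othermax_ge0 k (w i) x.
apply: (@le_lt_trans _ _ (othermax k (w i) x + e)).
  apply: othermax_le => [|l li lk]; first by rewrite addr_ge0// ltW.
  have h1 := othermax_ge x li lk; have h2 := cb l.
  have h3 : `|ecoord b l| <= `|ecoord x l| + `|ecoord x l - ecoord b l|.
    by have := ler_normB (ecoord x l) (ecoord x l - ecoord b l); rewrite opprB addrC subrK.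
  lra.
have h1 := cb (w i).
have h2 : (-1) ^+ odd j * ecoord x (w i) - (-1) ^+ odd j * ecoord b (w i) <= `|ecoord x (w i) - ecoord b (w i)|.
  rewrite -mulrBr; apply: le_trans (ler_norm _) _.
  by rewrite normrM normrX normrN1 expr1n mul1r.
move: h2; rewrite jx; lra.
Qed.

Let bshell i e : bmeas (\1_(shell k (w i) e) : euclid R n.+1 -> R).
Proof. by apply: bmeas_indic; exact: measurable_shell_set. Qed.

Let bfacet j : bmeas (\1_(facet j) : euclid R n.+1 -> R).
Proof. by apply: bmeas_indic; exact: measurable_facet. Qed.

Let Ex_facet j : Ex std_gauss \1_(facet j) = @cell_mass R n k.-1.
Proof. exact: (@Ex_cell R n k (w (idx j)) (odd j) (ltn_ord (idx j))). Qed.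

Lemma sum_Ex_shell_le e T : 0 < e -> 0 <= T ->
  \sum_(i < k) Ex std_gauss \1_(shell k (w i) e) <=
  2 * e * (k%:R * std_normal_pdf T + expR (3 / 2) * (1 + T) * (k%:R * @cell_mass R n k.-1)).
Proof.
move=> e0 T0.
apply: (@le_trans _ _ (\sum_(i < k)
  2 * e * (std_normal_pdf T + expR (3 / 2) * (1 + T) * @cell_mass R n k.-1))).
  by apply: ler_sum => i _; exact: (@Ex_shell_set_le R n k (w i) e T (ltn_ord i) e0 T0).
rewrite sumr_const card_ord -[leLHS]mulr_natr.
by rewrite le_eqVlt; apply/orP; left; apply/eqP; ring.
Qed.

Definition ties : set (euclid R n.+1) := ~` \bigcup_j facet j.

Let measurable_ties : measurable ties.
Proof.
apply: measurableC; apply: countable_bigcupT_measurable; first exact: countableP.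
exact: measurable_facet.
Qed.

Let bties : bmeas (\1_ties : euclid R n.+1 -> R).
Proof. exact: bmeas_indic. Qed.

Lemma sum_facet x : \sum_j (\1_(facet j) x : R) + \1_ties x = 1.
Proof.
have [[j _ fj]|h] := pselect ((\bigcup_j facet j) x).
  rewrite (bigD1 j)//= big1 => [|j' jj'].
    rewrite (indicE _ (facet j)) (mem_set fj) addr0 indicE memNset ?addr0//.
    by apply; exists j.
  rewrite indicE memNset// => fj'; move: jj'.
  by rewrite (facet_inj fj' fj) eqxx.
rewrite big1 => [|j _]; first by rewrite add0r indicE mem_set.
by rewrite indicE memNset// => fj; apply: h; exists j.
Qed.

Lemma cell_mass_ties : (2 * k)%:R * @cell_mass R n k.-1 + Ex std_gauss \1_ties = 1.
Proof.
rewrite -[RHS](Ex_cst std_gauss 1).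
transitivity (Ex std_gauss (fun x => \sum_j (\1_(facet j) x : R) + \1_ties x)); last first.
  by apply: eq_Ex => x; exact: sum_facet.
rewrite ExD; [|exact: bmeas_sum|exact: bties].
rewrite Ex_sum//; congr (_ + _).
under eq_bigr do rewrite Ex_facet.
by rewrite sumr_const card_ord -[RHS]mulr_natr mulrC.
Qed.

Lemma ties_shell e : 0 < e -> ties `<=` \bigcup_i shell k (w i) e.
Proof.
move=> e0 x tx; have [i ile] := exists_argmax x.
exists i => //; rewrite /shell/= ile/= leNgt; apply/negP => lt; apply: tx.
have lt' : othermax k (w i) x < `|ecoord x (w i)| by apply: lt_trans lt; rewrite ltrDl.
have [j ji jx] := facet_of lt'.
by exists j => //; rewrite /facet /cell /= ji jx.
Qed.

Lemma Ex_le_shells (D : set (euclid R n.+1)) e : measurable D ->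
  D `<=` \bigcup_i shell k (w i) e ->
  Ex std_gauss \1_D <= \sum_(i < k) Ex std_gauss \1_(shell k (w i) e).
Proof.
move=> mD DS; rewrite -Ex_sum//.
have bD : bmeas (\1_D : euclid R n.+1 -> R) by exact: bmeas_indic.
have bS : bmeas (fun x => \sum_(i < k) (\1_(shell k (w i) e) x : R)) by exact: bmeas_sum.
apply: le_Ex => // x.
have [Dx|nDx] := pselect (D x); last first.
  by rewrite indicE memNset//; apply: sumr_ge0 => i _.
have [i _ Si] := DS _ Dx.
rewrite indicE mem_set// (bigD1 i)//= (indicE _ (shell _ _ _)) mem_set// lerDl.
by apply: sumr_ge0 => i' _.
Qed.

(** The ties lie in the shells of every width [e], whose total mass is at most [e] times a
    constant. *)
Lemma Ex_ties : Ex std_gauss \1_ties = 0.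
Proof.
apply/le_anti/andP; split; last exact: Ex_ge0.
set K := 2 * (k%:R * @std_normal_pdf R 0 + expR (3 / 2) * (1 + 0) * (k%:R * @cell_mass R n k.-1)).
have H e : 0 < e -> Ex std_gauss \1_ties <= e * K.
  move=> e0; apply: le_trans (Ex_le_shells measurable_ties (ties_shell e0)) _.
  apply: le_trans (sum_Ex_shell_le e0 (lexx 0)) _.
  by rewrite le_eqVlt; apply/orP; left; apply/eqP; rewrite /K; ring.
apply/ler_addgt0Pr => eta eta0; rewrite add0r.
have K1 : 0 < `|K| + 1 by rewrite ltr_wpDl.
apply: le_trans (H (eta / (`|K| + 1)) _) _; first by rewrite divr_gt0.
rewrite mulrAC ler_pdivrMr// ler_wpM2l ?(ltW eta0)//.
by rewrite (le_trans (ler_norm _))// lerDl.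
Qed.

(** The value follows by symmetry alone: the 2k facets have equal mass and cover everything up to
    the ties. *)
Lemma cell_massE : @cell_mass R n k.-1 = (2 * k)%:R^-1.
Proof.
have := cell_mass_ties; rewrite Ex_ties addr0 => h.
have k2 : (2 * k)%:R != 0 :> R by rewrite pnatr_eq0; lia.
by apply: (mulfI k2); rewrite h divff.
Qed.

Lemma gaussian_cube_part j : gaussian (cube_part j) = ((2 * k)%:R^-1)%:E.
Proof.
have [mA _ _] := cube_partP.
rewrite -[gaussian _]/(std_gauss (cube_part j)) -(Ex_indic std_gauss (mA j)); congr (_%:E).
rewrite -cell_massE -(Ex_facet j).
have [jj|jj0] := eqVneq j base_facet; last by rewrite /cube_part (negbTE jj0).
have bA : bmeas (\1_(cube_part j) : euclid R n.+1 -> R) by exact: bmeas_indic.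
apply/le_anti/andP; split; last first.
  apply: le_Ex => // x; rewrite !indicE.
  have [fx|nfx] := pselect (facet j x); last by rewrite memNset.
  by rewrite (mem_set fx) (mem_set (facet_sub fx)).
rewrite -[leRHS]addr0 -Ex_ties -(ExD std_gauss (bfacet j) bties).
apply: le_Ex => //; first exact: bmeasD.
move=> x; rewrite (indicE _ (cube_part j)).
have [Ax|nAx] := pselect (cube_part j x); last by rewrite memNset// addr_ge0.
rewrite mem_set//.
have [fx|nfx] := pselect (facet j x).
  by rewrite (indicE _ (facet j)) mem_set// lerDl.
rewrite (indicE _ ties) mem_set ?lerDr// => -[j' _ fj'].
move: Ax; rewrite /cube_part jj eqxx; apply; exists j' => //=.
by apply/eqP => j'E; apply: nfx; rewrite jj -j'E.
Qed.

Lemma boundary_cube_part :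
  (boundary_measure cube_part <= ((16 + 32 * expR (3 / 2)) * Num.sqrt (ln k%:R))%:E)%E.
Proof.
apply: (@boundary_measure_le _ _ _ cube_part 1) => // e /andP[e0 _].
set C := expR (3 / 2).
have C0 : 0 <= C by exact: expR_ge0.
have kr : (0 : R) < k%:R by rewrite ltr0n.
have mE := measurable_eboundary cube_partP e0.
rewrite -[gaussian _]/(std_gauss (eboundary cube_part e)) -(Ex_indic std_gauss mE) lee_fin.
apply: le_trans (Ex_le_shells mE (eboundary_cube_part e0)) _.
set s := Num.sqrt (ln k%:R).
have s2 : s ^+ 2 = ln k%:R by rewrite sqr_sqrtr// ln_ge0// ler1n.
have s0 : 0 <= s by exact: sqrtr_ge0.
(* As k >= 2, [s] is bounded below, so additive constants can be absorbed into multiples of [s]. *)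
have s12 : 2^-1 <= s.
  have h : (2^-1) ^+ 2 <= s ^+ 2.
    rewrite s2; apply: (@le_trans _ _ (ln 2)).
      have := @le_ln1Dx R (- 2^-1); rewrite (_ : 1 + - 2^-1 = 2^-1); last by field.
      rewrite lnV ?posrE//; lra.
    by rewrite ler_ln ?posrE// ler_nat.
  by rewrite -(@ler_pXn2r _ 2) ?nnegrE.
have e20 : 0 < 2 * e by rewrite mulr_gt0.
(* With this level exp (- T^2 / 2) = k^(-2), so k phi(T) is at most 1, while 1 + T is still of order
   [s]. *)
pose T := 2 * s.
have T0 : 0 <= T by rewrite mulr_ge0.
apply: le_trans (sum_Ex_shell_le e20 T0) _.
rewrite cell_massE -/C.
have -> : k%:R * (2 * k)%:R^-1 = 2^-1 :> R by rewrite natrM; field; rewrite gt_eqF.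
have kphi : k%:R * std_normal_pdf T <= 1.
  rewrite std_normal_pdfE /T exprMn s2.
  have q1 : (Num.sqrt (2 * pi))^-1 <= 1 :> R.
    rewrite invf_le1 ?sqrtr_gt0 ?mulr_gt0 ?pi_gt0//.
    rewrite -[leLHS]sqrtr1 ler_sqrt ?mulr_ge0 ?pi_ge0//; have := pi_ge2 R; lra.
  have q2 : expR (- (2 ^+ 2 * ln k%:R / 2)) <= k%:R^-1 :> R.
    rewrite -[leRHS]lnK ?posrE ?invr_gt0// ler_expR lnV ?posrE//.
    have : 0 <= ln (k%:R : R) by rewrite ln_ge0// ler1n.
    lra.
  have q3 : 0 <= expR (- (2 ^+ 2 * ln k%:R / 2)) :> R by exact: expR_ge0.
  apply: (@le_trans _ _ (k%:R * (1 * k%:R^-1))).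
    by rewrite ler_wpM2l ?(ltW kr)// ler_pM// invr_ge0.
  by rewrite mul1r divff// gt_eqF.
have p1 : 2^-1 <= Num.sqrt (2 / pi) :> R.
  rewrite -[leLHS]ger0_norm// -sqrtr_sqr ler_sqrt ?divr_ge0 ?pi_ge0//.
  by rewrite ler_pdivlMr ?pi_gt0//; have := @pihalf_lt2 R; lra.
apply: (@le_trans _ _ ((16 + 32 * C) * s * (2^-1 * e))); last first.
  by rewrite ler_wpM2l ?mulr_ge0 ?addr_ge0 ?mulr_ge0// ler_wpM2r// ltW.
rewrite [leLHS](_ : _ = e * (4 * (k%:R * std_normal_pdf T) + 2 * C + 4 * (C * s))); last first.
  by rewrite /T; field.
(* Since s >= 1/2, the terms 4 k phi(T) <= 4 and 2 C are at most 8 s and 4 C s. *)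
rewrite [leRHS](_ : _ = e * (8 * s + 16 * (C * s))); last by field.
have Cs : C * 2^-1 <= C * s by rewrite ler_wpM2l.
by rewrite ler_wpM2l ?(ltW e0)//; lra.
Qed.


End cube_partition.

Theorem corollary1 (R : realType) :
  exists c C : R, [/\ 0 < c, c < C &
    forall k n : nat, (2 <= k)%N -> (1 <= n)%N ->
      (forall A : 'I_k -> set (euclid R n),
         is_partition A ->
         (forall i, gaussian (A i) = (k%:R^-1)%:E) ->
         ((c * Num.sqrt (ln k%:R))%:E <= boundary_measure A)%E) /\
      ((k <= n)%N ->
       exists A : 'I_(2 * k)%N -> set (euclid R n),
         [/\ is_partition A,
             forall i, gaussian (A i) = ((2 * k)%N%:R^-1)%:E &
             (boundary_measure A <= (C * Num.sqrt (ln k%:R))%:E)%E])].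
Proof.
exists 16384^-1, (16 + 32 * expR (3 / 2)).
have C0 : 0 < expR (3 / 2) :> R by exact: expR_gt0.
have c0 : 0 < 16384^-1 :> R by rewrite invr_gt0 ltr0n.
split=> [//| |k n k2 n1].
  have c1 : 16384^-1 <= 1 :> R by rewrite invf_le1 ?ltr0n// ler1n.
  move: (16384^-1) c1 => c c1; lra.
split=> [A Apart gA|kn]; first exact: boundary_lower.
case: n n1 kn => // n _ kn.
exists (cube_part k2 kn); split.
- exact: cube_partP.
- exact: gaussian_cube_part.
- exact: boundary_cube_part.
Qed.
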